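(* There is a universal numerical constant $C$ such that the following holds. Let $T$ be a finite nonempty set, $X$ a real separable $(2,D)$-smooth Banach space with $D\ge 1$, and let $f_j(t)=\sum_{i=1}^j A_i(t)\gamma_i$ ($0\le j\le N$, $t\in T$) be a family of predictable Gaussian sums in $X$ as described in the context, with terminal square-function pseudometric $d=d_N$ on $T$. Let $\mu$ be a deterministic probability measure on $T$ with $\mu(\{t\})>0$ for every $t\in T$. Then for every $p\ge 1$, $$\Big\|\max_{0\le j\le N}\operatorname{osc}_T f_j\Big\|_{L^p}\le C D\,\big\|\Gamma_\mu(d)+\sqrt p\,\Delta_d\big\|_{L^p},$$ where $\operatorname{osc}_T f_j=\max_{t,u\in T}\|f_j(t)-f_j(u)\|$. (The constant $C$ does not depend on $X$, $D$, $T$, $\mu$, $N$, the dimensions $m_i$, or $p$.) In particular, $$\mathbb E\max_{0\le j\le N}\operatorname{osc}_T f_j\le C D\,\mathbb E\,\Gamma_\mu(d).$$ The inequalities are understood in the extended sense (trivially true) when the right-hand side is infinite.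
   Context: Smoothness: a Banach space $X$ is $(2,D)$-smooth if $\|x+y\|^2+\|x-y\|^2\le 2\|x\|^2+2D^2\|y\|^2$ for all $x,y\in X$. Predictable Gaussian sums: $(\mathcal F_j)_{j=0}^N$ is a filtration on a probability space; for each $i=1,\dots,N$, $\gamma_i$ is a standard Gaussian vector in $\mathbb R^{m_i}$ that is independent of $\mathcal F_{i-1}$ and $\mathcal F_i$-measurable; for each $t\in T$, $A_i(t):\mathbb R^{m_i}\to X$ is an $\mathcal F_{i-1}$-measurable random linear operator, with finite operator norm almost surely. Set $f_0(t)=0$ and $f_j(t)=\sum_{i=1}^jA_i(t)\gamma_i$. For a linear operator $A:\mathbb R^m\to X$, $\|A\|_\gamma=(\mathbb E\|Ag\|^2)^{1/2}$ with $g\sim N(0,I_m)$. Square-function pseudometric: $d_j(t,u)^2=\sum_{i=1}^j\|A_i(t)-A_i(u)\|_\gamma^2$ (a random pseudometric on $T$); $d=d_N$. For a pseudometric $d$ on $T$: $\Delta_d=\max_{t,u\in T}d(t,u)$, $B_d(t,r)=\{u\in T:d(t,u)\le r\}$, and the ball-mass functional is $$\Gamma_\mu(d)=\sup_{t\in T}\int_0^{\Delta_d}\sqrt{\log\frac{e}{\mu(B_d(t,r))}}\,dr$$ (equal to $0$ if $\Delta_d=0$). *)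

(* Defs.v *)
From HB Require Import structures.
From mathcomp Require Import all_boot all_order all_algebra.
From mathcomp Require Import all_classical all_reals all_analysis.
Set Implicit Arguments.
Unset Strict Implicit.
Unset Printing Implicit Defensive.
Import Order.TTheory GRing.Theory Num.Theory.
Import numFieldNormedType.Exports.
Local Open Scope classical_set_scope.
Local Open Scope ring_scope.

Definition separable (X : topologicalType) : Prop :=
  exists2 S : set X, countable S & dense S.

Definition smooth2 (R : realType) (X : normedModType R) (D : R) : Prop :=
  forall x y : X,
    `|x + y| ^+ 2 + `|x - y| ^+ 2 <= 2 * `|x| ^+ 2 + 2 * D ^+ 2 * `|y| ^+ 2.

Definition borel (X : topologicalType) : set (set X) := <<s @open X >>.

(* Random vectors take values in [m.-tuple R], which carries the product
   sigma-algebra; linear operators act on ['rV[R]_m]. *)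
Definition row_of_tuple (R : realType) (m : nat) (x : m.-tuple R) : 'rV[R]_m :=
  \row_k tnth x k.

(* [measurableTypeR R] is [R] with the Borel structure on which [normal_prob]
   and [lebesgue_measure] are defined. *)
Definition cons_pair (R : realType) (m : nat)
    (x : measurableTypeR R * m.-tuple R) : m.+1.-tuple R :=
  [tuple of x.1 :: x.2].

Lemma measurable_cons_pair (R : realType) (m : nat) :
  measurable_fun setT (@cons_pair R m).
Proof.
apply: measurable_cons; last exact: measurable_snd.
exact: (@measurable_fst _ _ (measurableTypeR R)).
Qed.

HB.instance Definition _ (R : realType) (m : nat) :=
  isMeasurableFun.Build _ _ _ _ (@cons_pair R m) (@measurable_cons_pair R m).

(* N(0, I_m), the m-fold product of N(0, 1); the second parameter of
   [normal_prob] is the standard deviation. *)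
Fixpoint std_gaussian (R : realType) (m : nat) : probability (m.-tuple R) R :=
  match m return probability (m.-tuple R) R with
  | 0%N => \d_ [tuple]
  | m'.+1 => distribution (normal_prob (0 : R) 1 \x std_gaussian R m')%E
                          (@cons_pair R m')
  end.

Lemma std_gaussian_box (R : realType) (m : nat) (B : 'I_m -> set R) :
  (forall k, measurable (B k)) ->
  std_gaussian R m [set x | forall k, B k (tnth x k)] =
  (\prod_(k < m) normal_prob 0 1 (B k))%E.
Proof.
elim: m B => [|m IH] B mB /=.
  rewrite big_ord0 diracE mem_set//; by case.
rewrite /distribution /pushforward big_ord_recl -IH; last by move=> k; exact: mB.
have -> : cons_pair (m:=m) @^-1` [set x | forall k, B k (tnth x k)] =
    B ord0 `*` [set x | forall k, B (lift ord0 k) (tnth x k)].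
  apply/seteqP; split=> -[x y] /=.
    move=> h; split; first exact: (h ord0).
    by move=> k; have := h (lift ord0 k); rewrite tnthS.
  move=> [h0 h] k; case: (unliftP ord0 k) => [j|] ->; last exact: h0.
  by rewrite tnthS; exact: h.
rewrite product_measure1E//; first exact: mB.
have -> : [set x : m.-tuple R | forall k, B (lift ord0 k) (tnth x k)] =
    \bigcap_k ((fun x => tnth x k) @^-1` B (lift ord0 k)).
  by apply/seteqP; split=> x /= h k => [_|]; exact: h.
apply: fin_bigcap_measurable => [|k _]; first exact: finite_finset.
rewrite -[X in measurable X]setTI.
by apply: measurable_tnth => //; exact: mB.
Qed.

(* [fine] is harmless: a linear map on ['rV[R]_m] is bounded, so the
   expectation is finite. *)
Definition gamma_norm (R : realType) (X : normedModType R) (m : nat)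
    (A : {linear 'rV[R]_m -> X}) : R :=
  Num.sqrt (fine 'E_(std_gaussian R m)[fun x => `|A (row_of_tuple x)| ^+ 2]).

(* Operator norm with respect to the Euclidean norm; the norm that the library
   puts on ['rV[R]_m] is the sup norm. *)
Definition op_norm (R : realType) (X : normedModType R) (m : nat)
    (A : {linear 'rV[R]_m -> X}) : \bar R :=
  ereal_sup [set `|A v|%:E | v in [set v : 'rV[R]_m | \sum_k v 0 k ^+ 2 <= 1]].

Definition is_filtration d (Omega : measurableType d) (N : nat)
    (F : nat -> set (set Omega)) : Prop :=
  [/\ forall j, (j <= N)%N -> sigma_algebra setT (F j),
      forall j, (j <= N)%N -> F j `<=` measurable &
      forall j k, (j <= k <= N)%N -> F j `<=` F k].

Definition std_gaussian_vector d (Omega : measurableType d) (R : realType)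
    (P : probability Omega R) (m : nat) (g : Omega -> m.-tuple R) : Prop :=
  forall B, measurable B -> P (g @^-1` B) = std_gaussian R m B.

Definition adapted_vector (Omega : Type) (R : realType) (F : set (set Omega))
    (m : nat) (g : Omega -> m.-tuple R) : Prop :=
  forall B, measurable B -> F (g @^-1` B).

Definition independent_of d (Omega : measurableType d) (R : realType)
    (P : probability Omega R) (F : set (set Omega)) (m : nat)
    (g : Omega -> m.-tuple R) : Prop :=
  forall E B, F E -> measurable B ->
    P (E `&` g @^-1` B) = (P E * P (g @^-1` B))%E.

(* Pointwise measurability in [v]; for separable [X] it is equivalent to Borel
   measurability in operator norm, the domain being finite-dimensional. *)
Definition adapted_operator (Omega : Type) (R : realType) (X : normedModType R)
    (F : set (set Omega)) (m : nat) (A : Omega -> {linear 'rV[R]_m -> X}) :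
    Prop :=
  forall (v : 'rV[R]_m) (B : set X), borel B -> F [set w | B (A w v)].

(* The families [m], [g], [A] are indexed by [nat], but only the indices
   1, ..., N are constrained or used. *)
Definition predictable_gaussian d (Omega : measurableType d) (R : realType)
    (P : probability Omega R) (T : finType) (X : normedModType R) (N : nat)
    (F : nat -> set (set Omega)) (m : nat -> nat)
    (g : forall i, Omega -> (m i).-tuple R)
    (A : forall i, T -> Omega -> {linear 'rV[R]_(m i) -> X}) : Prop :=
  forall i, (1 <= i <= N)%N ->
  [/\ std_gaussian_vector P (g i),
      independent_of P (F i.-1) (g i),
      adapted_vector (F i) (g i),
      forall t, adapted_operator (F i.-1) (A i t) &
      forall t, {ae P, forall w, (op_norm (A i t w) < +oo)%E}].

Definition gaussian_sum (Omega : Type) (R : realType) (T : finType)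
    (X : normedModType R) (m : nat -> nat)
    (g : forall i, Omega -> (m i).-tuple R)
    (A : forall i, T -> Omega -> {linear 'rV[R]_(m i) -> X})
    (w : Omega) (j : nat) (t : T) : X :=
  \sum_(1 <= i < j.+1) A i t w (row_of_tuple (g i w)).

Definition square_dist (Omega : Type) (R : realType) (T : finType)
    (X : normedModType R) (m : nat -> nat)
    (A : forall i, T -> Omega -> {linear 'rV[R]_(m i) -> X})
    (j : nat) (w : Omega) (t u : T) : R :=
  Num.sqrt (\sum_(1 <= i < j.+1) gamma_norm (A i t w \- A i u w) ^+ 2).

Definition osc (R : realType) (T : finType) (X : normedModType R) (f : T -> X) :
    R :=
  \big[Num.max/0]_(t : T) \big[Num.max/0]_(u : T) `|f t - f u|.

Definition max_osc (R : realType) (T : finType) (X : normedModType R) (N : nat)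
    (f : nat -> T -> X) : R :=
  \big[Num.max/0]_(0 <= j < N.+1) osc (f j).

Definition diam (R : realType) (T : finType) (d : T -> T -> R) : R :=
  \big[Num.max/0]_(t : T) \big[Num.max/0]_(u : T) d t u.

(* A probability measure on the finite set [T] is given by its mass function. *)
Definition ball_mass (R : realType) (T : finType) (mu : T -> R)
    (d : T -> T -> R) (t : T) (r : R) : R :=
  \sum_(u : T | d t u <= r) mu u.

(* When [diam d = 0] the integral is over a single point, hence 0. *)
Definition ball_mass_functional (R : realType) (T : finType) (mu : T -> R)
    (d : T -> T -> R) : \bar R :=
  ereal_sup (range (fun t : T =>
    (\int[lebesgue_measure]_(r in `[0%R, diam d])
      (Num.sqrt (ln (expR 1 / ball_mass mu d t r)))%:E)%E)).

(* Main.v *)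
(* For a predictable martingale M_j = sum_i B_i gamma_i in a (2,D)-smooth space whose
   energy sum_i |B_i|_gamma^2 is at most s^2, Fernique's theorem (obtained from
   rotation invariance) and smoothness turn exp(|M_j|^2 / h_j - drift_j), with
   h_j comparable to D^2 s^2, into a supermartingale; a pathwise Doob inequality
   then bounds the mean of exp(max_j |M_j|^2 / (K D^2 s^2)).

   The random pseudometric d_j is not available in advance, but
   W_i = Gamma_mu(d_i) + sqrt p * diam d_i is predictable and nondecreasing in i.
   The process is split according to the level eps 4^n of W_i. The increments of
   one level are chained along averages over mu-balls at the radii
   eps 4^n / (sqrt p 2^k); since only exponential moments integrated against
   mu x mu are used, a single random variable U, summing these moments over all
   levels and scales with E U <= C E (eps + W_N)^p, controls the chaining, and
   max_j osc f_j <= C D (eps + W_N + U^(1/p)). Finally eps tends to 0. *)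
Require Import Defs.
From HB Require Import structures.
From mathcomp Require Import all_boot all_order all_algebra.
From mathcomp Require Import all_classical all_reals all_analysis.
From mathcomp Require Import measurable_realfun ring lra zify.
Set Implicit Arguments.
Unset Strict Implicit.
Unset Printing Implicit Defensive.
Import Order.TTheory GRing.Theory Num.Theory.
Import numFieldNormedType.Exports.
Local Open Scope classical_set_scope.
Local Open Scope ring_scope.

(** * Rotation invariance of Gaussian measures *)

(** The exponential inequality asks for a deterministic energy bound, whereas the metric is random
    and complete only at time N. Nothing can therefore be chosen from the terminal metric, neither a
    net nor a partition. All pairs (u, v) are treated simultaneously by averaging exponential
    moments over mu x mu, the increments are cut off by predictable indicators, and the random balls
    enter only afterwards, path by path. The level of W_i supplies the deterministic scale; the
    ratio 4 of the thresholds is chosen so that its square root 2 still gives geometric sums. The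
    factor 1 / sqrt p in the radii has two sources that agree: W_i contains sqrt p times the
    diameter, and the logarithm of U / (eps 4^n)^p is of order p. The maximal inequality is
    localized to the event that a level is reached: the probability of this event, weighted by (eps
    4^n)^p, is what sums over the levels to a moment of eps + W_N. Level 0 has no lower threshold
    and is always reached; its price eps^p is the reason for the final limit. *)

Section integral_tools.
Import HBNNSimple.
Local Open Scope ereal_scope.
Context d (T : measurableType d) (R : realType).

(** The integral of a nonnegative function is a supremum over the simple functions below it, and
    enlarging the function only adds competitors. This form covers integrands such as [max_osc],
    whose measurability is never established. *)
Lemma ge0_integral_mono (mu : {measure set T -> \bar R}) (f g : T -> \bar R) :
  (forall x, 0 <= f x) -> (forall x, f x <= g x) ->
  \int[mu]_x f x <= \int[mu]_x g x.
Proof.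
move=> f0 fg.
have g0 x : 0 <= g x by exact: le_trans (fg x).
rewrite !ge0_integralE//; apply: ge_ereal_sup => _ [h hf <-].
apply: ereal_sup_ubound; exists h => // x.
by apply: le_trans (hf x) _; rewrite ?patchT ?inE.
Qed.

Lemma ge0_integral_density (mu nu : {measure set T -> \bar R}) (h : T -> R)
    (f : T -> \bar R) :
  measurable_fun setT h -> (forall x, 0 <= h x)%R ->
  (forall A, measurable A -> nu A = \int[mu]_(x in A) (h x)%:E) ->
  measurable_fun setT f -> (forall x, 0 <= f x) ->
  \int[nu]_x f x = \int[mu]_x (f x * (h x)%:E).
Proof.
move=> mh h0 nuE mf f0.
pose f_ := nnsfun_approx measurableT mf.
transitivity (limn (fun n => \int[nu]_x (f_ n x)%:E)).
  rewrite -monotone_convergence//.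
  - by apply: eq_integral => y _; apply/esym/cvg_lim => //; exact: cvg_nnsfun_approx.
  - by move=> n; exact/measurable_EFinP/measurable_funP.
  - by move=> n y _; rewrite lee_fin.
  - by move=> y _ m n mn; rewrite lee_fin; exact/lefP/nd_nnsfun_approx.
transitivity (limn (fun n => \int[mu]_x ((f_ n x)%:E * (h x)%:E))); last first.
  rewrite -monotone_convergence//.
  - apply: eq_integral => y _; apply/cvg_lim => //.
    by apply: cvgeZr => //; exact: cvg_nnsfun_approx.
  - by move=> n; apply: emeasurable_funM; exact/measurable_EFinP.
  - by move=> n y _; rewrite mule_ge0 ?lee_fin.
  - move=> y _ m n mn; rewrite lee_wpmul2r ?lee_fin//.
    exact/lefP/nd_nnsfun_approx.
congr (limn _); apply/funext => n.
transitivity (\sum_(k \in range (f_ n)) (k%:E * nu (f_ n @^-1` [set k]))).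
  by rewrite integralT_nnsfun sintegralE; apply: eq_fsbigr.
transitivity (\int[mu]_x \sum_(k \in range (f_ n))
    ((k * \1_(f_ n @^-1` [set k]) x) * h x)%:E); last first.
  apply: eq_integral => x _; rewrite -EFinM [in RHS]fimfunE.
  by rewrite fsumEFin// mulr_fsuml//.
rewrite ge0_integral_fsum//; last 2 first.
- move=> y; apply/measurable_EFinP/measurable_funM => //.
  by apply: measurable_funM => //; exact: measurable_indic.
- by move=> y x _; rewrite EFinM mule_ge0 ?lee_fin// -lee_fin nnfun_muleindic_ge0.
apply: eq_fsbigr => r /set_mem[z _ rE].
have r0 : (0 <= r)%R by rewrite -rE.
rewrite nuE//.
under [RHS]eq_integral do rewrite -mulrA EFinM.
rewrite ge0_integralZl_EFin//; last 2 first.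
- by move=> x _; rewrite lee_fin mulr_ge0// indicE.
- by apply/measurable_EFinP/measurable_funM => //; exact: measurable_indic.
congr (_ * _); rewrite integral_mkcond; apply: eq_integral => x _.
by rewrite patchE indicE; case: ifPn; rewrite ?mul1r ?mul0r.
Qed.

End integral_tools.

Section lebesgue_affine.
Local Open Scope ereal_scope.
Context (R : realType).
Local Notation mu := (@lebesgue_measure R).

Lemma measurable_affine (a b : R) :
  measurable_fun setT (fun x : measurableTypeR R => (a * x + b)%R : measurableTypeR R).
Proof. by apply: measurable_funD => //; exact: mulrl_measurable. Qed.

Lemma lebesgue_measure_affine (a b : R) (A : set (measurableTypeR R)) : (0 < a)%R ->
  measurable A ->
  mu A = a%:E * pushforward mu (fun x : measurableTypeR R => (a * x + b)%R : measurableTypeR R) A.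
Proof.
move=> a0 mA.
pose phi := fun x : measurableTypeR R => (a * x + b)%R : measurableTypeR R.
have mphi : measurable_fun setT phi by exact: measurable_affine.
pose a' := NngNum (ltW a0).
apply: (@lebesgue_measure_unique _ (mscale a' (measure_function_pushforward__canonical__measure_function_Measure mu mphi))).
  move=> _ [[u v]] _ <- /=.
  rewrite /mscale/= /pushforward/=.
  have -> : phi @^-1` `]u, v] = `]((u - b) / a)%R, ((v - b) / a)%R]%classic.
    apply/seteqP; split => x /=; rewrite /phi !in_itv/= ltr_pdivrMr// ler_pdivlMr//;
      rewrite ltrBlDr lerBrDr [(x * a)%R]mulrC//.
  rewrite !lebesgue_measure_itv/= !lte_fin ltr_pM2r ?invr_gt0// ltrD2r.
  case: ifPn => _; last by rewrite mule0.
  rewrite -!EFinB -EFinM; congr EFin.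
  by field; rewrite gt_eqF.
exact: mA.
Qed.

Lemma integral_affine (a b : R) (f : measurableTypeR R -> \bar R) : (0 < a)%R ->
  measurable_fun setT f -> (forall x, 0 <= f x) ->
  \int[mu]_x f x = a%:E * \int[mu]_x f (a * x + b)%R.
Proof.
move=> a0 mf f0.
pose phi := fun x : measurableTypeR R => (a * x + b)%R : measurableTypeR R.
have mphi : measurable_fun setT phi by exact: measurable_affine.
have -> : \int[mu]_x f (a * x + b)%R = \int[pushforward mu phi]_x f x.
  by rewrite ge0_integral_pushforward.
pose nu := measure_function_pushforward__canonical__measure_function_Measure mu mphi.
transitivity (\int[mscale (NngNum (ltW a0)) nu]_x f x); last exact: ge0_integral_mscale.
apply: eq_measure_integral => A mA _; exact: lebesgue_measure_affine.
Qed.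

Lemma integral_reflect (f : measurableTypeR R -> \bar R) :
  measurable_fun setT f -> (forall x, 0 <= f x) ->
  \int[mu]_x f x = \int[mu]_x f (- x)%R.
Proof.
move=> mf f0.
have mN : measurable_fun setT (-%R : measurableTypeR R -> measurableTypeR R).
  exact: oppr_measurable.
have -> : \int[mu]_x f (- x)%R = \int[pushforward mu (-%R : _ -> measurableTypeR R)]_x f x.
  by rewrite ge0_integral_pushforward.
by apply: eq_measure_integral => A mA _; exact/esym/lebesgue_measureN.
Qed.

End lebesgue_affine.

Section normal_rotation.
Local Open Scope ereal_scope.
Context (R : realType).
Local Notation mu := (@lebesgue_measure R).
Local Notation gauss := (normal_prob (0 : R) 1).
Local Notation pdf := (normal_pdf (0 : R) 1).

Lemma ge0_integral_normal (f : measurableTypeR R -> \bar R) :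
  measurable_fun setT f -> (forall x, 0 <= f x) ->
  \int[gauss]_x f x = \int[mu]_x (f x * (pdf x)%:E).
Proof.
move=> mf f0; apply: ge0_integral_density => //.
- exact: measurable_normal_pdf.
- by move=> x; exact: normal_pdf_ge0.
Qed.

Definition rot45 (z : measurableTypeR R * measurableTypeR R) : measurableTypeR R * measurableTypeR R :=
  (((z.1 + z.2) / Num.sqrt 2)%R, ((z.1 - z.2) / Num.sqrt 2)%R).

Lemma measurable_rot45 : measurable_fun setT rot45.
Proof.
apply: measurable_fun_pair; apply: measurable_funM => //.
- by apply: measurable_funD; [exact: measurable_fst|exact: measurable_snd].
- by apply: measurable_funB; [exact: measurable_fst|exact: measurable_snd].
Qed.

Lemma normal_pdf_rot45 (x y : R) :
  (pdf ((x + y) / Num.sqrt 2) * pdf ((x - y) / Num.sqrt 2) = pdf x * pdf y)%R.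
Proof.
rewrite !normal_pdfE ?oner_eq0// /normal_fun !subr0 expr1n.
rewrite mulrACA [RHS]mulrACA -!expRD; congr (_ * expR _)%R.
have s2 : (Num.sqrt (2 : R) ^+ 2 = 2)%R by rewrite sqr_sqrtr.
rewrite !mulNr !expr_div_n s2.
by field.
Qed.

(** Two one-dimensional substitutions with Tonelli in between. For fixed y, u = (x + y) / sqrt 2
    turns the second coordinate into u - sqrt 2 y and costs a factor sqrt 2; for fixed u, the
    substitution v = u - sqrt 2 y gives the factor back. *)
Lemma lebesgue_rot45 (k : measurableTypeR R * measurableTypeR R -> \bar R) :
  measurable_fun setT k -> (forall x, 0 <= k x) ->
  \int[mu]_x \int[mu]_y k (rot45 (x, y)) = \int[mu]_x \int[mu]_y k (x, y).
Proof.
move=> mk k0.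
have s20 : (0 < Num.sqrt (2 : R))%R by rewrite sqrtr_gt0.
set s := Num.sqrt 2 in s20.
have s0 : s != 0%R by rewrite gt_eqF.
have s2 : (s * s = 2)%R by rewrite -expr2 sqr_sqrtr.
rewrite (fubini_tonelli (k \o rot45)); last 2 first.
- by apply: measurableT_comp => //; exact: measurable_rot45.
- by move=> x /=.
transitivity (\int[mu]_y (s%:E * \int[mu]_u k (u, (u - s * y)%R))).
  apply: eq_integral => y _ /=.
  rewrite [in RHS](@integral_affine _ s^-1 (y / s)%R) ?invr_gt0//; last first.
  apply: (measurableT_comp mk); apply: measurable_fun_pair => //.
  by apply: measurable_funB.
  rewrite muleA -EFinM mulfV// mul1e; apply: eq_integral => x _.
  rewrite /rot45/=; congr (k (_, _)).
    by rewrite mulrDl [(s^-1 * _)%R]mulrC.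
  have -> : (s^-1 * x + y / s - s * y = (x + y - (s * s) * y) / s)%R by field.
  by rewrite s2; congr (_ / _)%R; ring.
have mk2 : measurable_fun setT (fun z : measurableTypeR R * measurableTypeR R => k (z.1, (z.1 - s * z.2)%R)).
  apply: (measurableT_comp mk); apply: measurable_fun_pair => //.
  apply: measurable_funB => //; apply: measurable_funM => //.
rewrite ge0_integralZl_EFin//; last 3 first.
- by move=> y _; exact: integral_ge0.
- exact: (measurable_fun_fubini_tonelli_G _ mk2).
- exact: ltW.
rewrite -(fubini_tonelli _ mk2)//=.
rewrite -ge0_integralZl_EFin//; last 3 first.
- by move=> y _; exact: integral_ge0.
- exact: (measurable_fun_fubini_tonelli_F _ mk2).
- exact: ltW.
apply: eq_integral => u _.
rewrite [RHS]integral_reflect//; last first.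
  by apply: (measurableT_comp mk); exact: measurable_pair1.
rewrite [RHS](@integral_affine _ s (- u)%R)//; last first.
  apply: (measurableT_comp mk); apply: measurable_fun_pair => //.
congr (_ * _); apply: eq_integral => y _; congr (k (_, _)).
by rewrite opprD opprK addrC.
Qed.

(** Both ingredients are invariant: Lebesgue measure on the plane, and the product density, which
    depends only on x^2 + y^2. *)
Lemma normal_rot45 (h : measurableTypeR R * measurableTypeR R -> \bar R) :
  measurable_fun setT h -> (forall x, 0 <= h x) ->
  \int[gauss]_x \int[gauss]_y h (rot45 (x, y)) = \int[gauss]_x \int[gauss]_y h (x, y).
Proof.
move=> mh h0.
have main (f : measurableTypeR R * measurableTypeR R -> \bar R) :
    measurable_fun setT f -> (forall x, 0 <= f x) ->
    \int[gauss]_x \int[gauss]_y f (x, y) =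
    \int[mu]_x \int[mu]_y (f (x, y) * (pdf x * pdf y)%:E).
  move=> mf f0.
  have mfx x : measurable_fun setT (fun y : measurableTypeR R => f (x, y)).
    by apply: (measurableT_comp mf); exact: measurable_pair1.
  rewrite ge0_integral_normal//; last 2 first.
  - exact: measurable_fun_fubini_tonelli_F.
  - by move=> x; exact: integral_ge0.
  apply: eq_integral => x _.
  rewrite ge0_integral_normal// -ge0_integralZr//; last 3 first.
  - by apply: emeasurable_funM => //; apply/measurable_EFinP; exact: measurable_normal_pdf.
  - by move=> y _; rewrite mule_ge0// lee_fin normal_pdf_ge0.
  - by rewrite lee_fin normal_pdf_ge0.
  by apply: eq_integral => y _; rewrite -muleA -EFinM [(pdf y * _)%R]mulrC.
rewrite (main (h \o rot45))//; last 2 first.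
- by apply: (measurableT_comp mh); exact: measurable_rot45.
- by move=> z /=.
have mpp : measurable_fun setT (fun z : measurableTypeR R * measurableTypeR R =>
    (pdf z.1 * pdf z.2)%R : measurableTypeR R).
  by apply: measurable_funM;
    apply: (measurableT_comp (@measurable_normal_pdf _ 0%R 1%R)).
rewrite (main h mh h0).
rewrite -(@lebesgue_rot45 (fun z => h z * (pdf z.1 * pdf z.2)%:E)); last 2 first.
- by apply: emeasurable_funM => //; apply/measurable_EFinP.
- by move=> z; rewrite mule_ge0// lee_fin mulr_ge0// normal_pdf_ge0.
by do 2 (apply: eq_integral => ? _); rewrite /= normal_pdf_rot45.
Qed.

End normal_rotation.

(** * Measurability of functions that are Lipschitz in the Gaussian argument *)

Section lipschitz_measurability.
Context d (T : measurableType d) (R : realType) (m : nat).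

Definition round_tuple (n : nat) (z : m.-tuple int) : m.-tuple R :=
  [tuple (tnth z i)%:~R / n.+1%:R | i < m].

Definition floor_tuple (n : nat) (x : m.-tuple R) : m.-tuple int :=
  [tuple Num.floor (n.+1%:R * tnth x i) | i < m].

Lemma measurable_floor_tuple_preimage n z :
  measurable [set x : m.-tuple R | floor_tuple n x = z].
Proof.
have -> : [set x : m.-tuple R | floor_tuple n x = z] =
    \bigcap_(i in [set: 'I_m]) ((fun x => n.+1%:R * tnth x i) @^-1`
      `[(tnth z i)%:~R, (tnth z i + 1)%:~R[).
  apply/seteqP; split => x /=.
    move=> xz i _ /=; rewrite -xz tnth_mktuple in_itv/=.
    by rewrite floor_itv.
  move=> h; apply: eq_from_tnth => i; rewrite tnth_mktuple.
  have /= := h i I; rewrite in_itv/= => /andP[h1 h2].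
  by apply: floor_def; rewrite h1 h2.
apply: fin_bigcap_measurable => [|i _]; first exact: finite_finset.
rewrite -[X in measurable X]setTI.
have mf : measurable_fun setT (fun x : m.-tuple R => n.+1%:R * tnth x i).
  by apply: measurable_funM => //; exact: measurable_tnth.
exact: mf.
Qed.

(* A Caratheodory function is the limit of its values at the dyadic roundings
   of the second argument, which range over a countable set. *)
Lemma measurable_fun_lipschitz (h : T * m.-tuple R -> R) :
  (forall x, measurable_fun setT (fun w => h (w, x))) ->
  (forall w, exists K, forall x y, `|h (w, x) - h (w, y)| <=
      K * \sum_i `|tnth x i - tnth y i|) ->
  measurable_fun setT h.
Proof.
move=> mh lip.
pose h_ n (z : T * m.-tuple R) := h (z.1, round_tuple n (floor_tuple n z.2)).
apply: (@measurable_fun_cvg _ _ _ _ h_) => [n|[w x] _].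
  move=> _ Y mY; rewrite setTI.
  have -> : h_ n @^-1` Y = \bigcup_(z : m.-tuple int)
      ((fun w => h (w, round_tuple n z)) @^-1` Y `*`
       [set x : m.-tuple R | floor_tuple n x = z]).
    apply/seteqP; split => [[w x]/= Yh|[w x] /= [z _ /= [] Yh zE]].
      by exists (floor_tuple n x).
    by rewrite /h_/= zE.
  apply: countable_bigcupT_measurable => [|z]; first exact: countableP.
  apply: measurableX; last exact: measurable_floor_tuple_preimage.
  by rewrite -[X in measurable X]setTI; exact: mh.
have [K hK] := lip w.
have bound n : `|h_ n (w, x) - h (w, x)| <= `|K| * m%:R / n.+1%:R.
  apply: le_trans (hK _ _) _; apply: le_trans (ler_norm _) _.
  rewrite normrM -mulrA ler_wpM2l//.
  rewrite ger0_norm; last by apply: sumr_ge0.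
  apply: (@le_trans _ _ (\sum_(i < m) n.+1%:R^-1)).
    apply: ler_sum => i _; rewrite !tnth_mktuple.
    set a := tnth x i.
    have n0 : (0 : R) < n.+1%:R by rewrite ltr0n.
    have := floor_itv (n.+1%:R * a); move=> /andP[h1 h2].
    rewrite ler_norml; apply/andP; split.
      rewrite -subr_ge0 opprK -(pmulr_rge0 _ n0) mulrDr mulrBr mulfV ?gt_eqF//.
      rewrite [_ * (_ / _)]mulrC divfK ?gt_eqF//.
      by move: h2; rewrite intrD; lra.
    rewrite -subr_ge0 -(pmulr_rge0 _ n0) mulrBr mulrBr mulfV ?gt_eqF//.
    by rewrite [_ * (_ / _)]mulrC divfK ?gt_eqF//; lra.
  by rewrite sumr_const card_ord -[leLHS]mulr_natl.
apply/cvgrPdist_le => /= e e0; near=> n.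
rewrite distrC; apply: le_trans (bound n) _.
rewrite ler_pdivrMr ?ltr0n//.
have : `|K| * m%:R / e <= n%:R.
  by near: n; exact: nbhs_infty_ger.
rewrite ler_pdivrMr// [leRHS]mulrC => /le_trans; apply.
by rewrite ler_wpM2l ?ler_nat// ltW.
Unshelve. all: end_near. Qed.

End lipschitz_measurability.

Section linear_norm.
Context (R : realType) (X : normedModType R) (m : nat).
Implicit Type B : {linear 'rV[R]_m -> X}.

Lemma linear_row_of_tuple B (x : m.-tuple R) :
  B (row_of_tuple x) = \sum_i tnth x i *: B (delta_mx 0 i).
Proof.
rewrite [row_of_tuple x]row_sum_delta linear_sum; apply: eq_bigr => i _.
by rewrite linearZ mxE.
Qed.

Lemma lipschitz_linear_norm B (y : X) : exists2 K, 0 <= K &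
  forall x x' : m.-tuple R,
    `| `|y + B (row_of_tuple x)| - `|y + B (row_of_tuple x')| | <=
    K * \sum_i `|tnth x i - tnth x' i|.
Proof.
exists (\sum_i `|B (delta_mx 0 i)|); first exact: sumr_ge0.
move=> x x'.
apply: le_trans (ler_dist_dist _ _) _.
rewrite opprD addrACA subrr add0r !linear_row_of_tuple -sumrB.
apply: le_trans (ler_norm_sum _ _ _) _.
rewrite mulr_sumr; apply: ler_sum => i _.
rewrite -scalerBl normrZ mulrC ler_wpM2r//.
by rewrite (bigD1 i)//= lerDl sumr_ge0.
Qed.

Lemma measurable_linear_norm B (y : X) :
  measurable_fun setT (fun x : m.-tuple R => `|y + B (row_of_tuple x)|).
Proof.
pose h (z : m.-tuple R * m.-tuple R) := `|y + B (row_of_tuple z.2)|.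
have mh : measurable_fun setT h.
  apply: measurable_fun_lipschitz => [x|w]; first exact: (@measurable_cst _ _ _ _ setT (h (x, x))).
  by have [K _ hK] := lipschitz_linear_norm B y; exists K; exact: hK.
rewrite (_ : (fun x => _) = h \o (fun x => (x, x)))//.
by apply: (measurableT_comp mh); exact: measurable_fun_pair.
Qed.

End linear_norm.

(** * Gaussian integrals and second moments *)

Section gaussian_integrals.
Local Open Scope ereal_scope.
Context (R : realType).
Local Notation gauss := (normal_prob (0 : R) 1).

Lemma integral_std_gaussian0 (f : 0.-tuple R -> \bar R) :
  measurable_fun setT f -> \int[std_gaussian R 0]_x f x = f [tuple].
Proof. by move=> mf; rewrite integral_dirac// diracT mul1e. Qed.

Lemma integral_std_gaussianS m (f : m.+1.-tuple R -> \bar R) :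
  measurable_fun setT f -> (forall x, 0 <= f x) ->
  \int[std_gaussian R m.+1]_x f x =
  \int[gauss]_a \int[std_gaussian R m]_x f (cons_pair (a, x)).
Proof.
move=> mf f0; rewrite ge0_integral_distribution//.
rewrite fubini_tonelli1//; last by move=> z; exact: f0.
by apply: (measurableT_comp mf); exact: measurable_cons_pair.
Qed.

(** Comparison with the density of standard deviation 2: the exponents differ by 3/8 x^2, and 3/8
    x^2 <= exp (3/8 x^2) absorbs the factor x^2 at the price 8/3. *)
Lemma normal_second_moment : \int[gauss]_x (x ^+ 2)%:E < +oo.
Proof.
rewrite ge0_integral_normal; last 2 first.
- apply/measurable_EFinP; exact: exprn_measurable.
- by move=> x; rewrite lee_fin sqr_ge0.
pose c : R := (8 / 3 * (normal_peak 1 / normal_peak 2))%R.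
have p2 : (0 < normal_peak (2 : R))%R by rewrite normal_peak_gt0.
have p1 : (0 < normal_peak (1 : R))%R by rewrite normal_peak_gt0.
apply: (@le_lt_trans _ _ (\int[lebesgue_measure]_x (c%:E * (normal_pdf (0:R) 2 x)%:E))).
  apply: ge0_integral_mono => x.
    by rewrite -EFinM lee_fin mulr_ge0 ?sqr_ge0 ?normal_pdf_ge0.
  rewrite -!EFinM lee_fin !normal_pdfE// /normal_fun !subr0 expr1n.
  have -> : (- x ^+ 2 / (1 *+ 2) = - (3 / 8 * x ^+ 2) - x ^+ 2 / (2 ^+ 2 *+ 2))%R.
    by field.
  rewrite expRD [expR (- (3 / 8 * _))]expRN mulNr.
  have h : (3 / 8 * x ^+ 2 <= expR (3 / 8 * x ^+ 2))%R.
    by apply: le_trans (expR_ge1Dx _); rewrite lerDr.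
  have -> : (c * (normal_peak 2 * expR (- (x ^+ 2 / (2 ^+ 2 *+ 2)))) =
     8 / 3 * (normal_peak 1 * expR (- (x ^+ 2 / (2 ^+ 2 *+ 2)))))%R.
    by rewrite /c; field; rewrite gt_eqF.
  rewrite [leLHS](_ : _ = (x ^+ 2 / expR (3 / 8 * x ^+ 2)) * (normal_peak 1 * expR (- (x ^+ 2 / (2 ^+ 2 *+ 2)))))%R; last by ring.
  rewrite ler_wpM2r ?mulr_ge0 ?expR_ge0 ?(ltW p1)//.
  by rewrite ler_pdivrMr ?expR_gt0//; lra.
rewrite ge0_integralZl_EFin//.
- by rewrite integral_normal_pdf mule1 ltry.
- by move=> x _; rewrite lee_fin normal_pdf_ge0.
- by apply/measurable_EFinP; exact: measurable_normal_pdf.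
- by rewrite /c !mulr_ge0// ?invr_ge0 ?(ltW p1) ?(ltW p2).
Qed.

Lemma measurable_sqnorm m : measurable_fun setT (fun x : m.-tuple R => \sum_i tnth x i ^+ 2)%R.
Proof.
apply: measurable_sum => i; apply: measurable_funX; exact: measurable_tnth.
Qed.

Lemma std_gaussian_second_moment m :
  \int[std_gaussian R m]_x (\sum_i tnth x i ^+ 2)%:E < +oo.
Proof.
elim: m => [|m IH].
  rewrite integral_std_gaussian0 ?big_ord0 ?ltry//.
  by apply/measurable_EFinP; exact: measurable_sqnorm.
rewrite integral_std_gaussianS; last 2 first.
- by apply/measurable_EFinP; exact: measurable_sqnorm.
- by move=> x; rewrite lee_fin sumr_ge0// => i _; rewrite sqr_ge0.
have sE a x : (\sum_i tnth (cons_pair (a, x)) i ^+ 2 =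
    a ^+ 2 + \sum_(i < m) tnth x i ^+ 2 :> R)%R.
  by rewrite big_ord_recl; congr (_ + _)%R; apply: eq_bigr => i _; rewrite tnthS.
set S := \int[std_gaussian R m]_x _ in IH.
have S0 : 0 <= S.
  by apply: integral_ge0 => x _; rewrite lee_fin sumr_ge0// => i _; rewrite sqr_ge0.
have -> : \int[gauss]_a \int[std_gaussian R m]_x
    (\sum_i tnth (cons_pair (a, x)) i ^+ 2)%:E = \int[gauss]_a ((a ^+ 2)%:E + S).
  apply: eq_integral => a _.
  under eq_integral do rewrite sE EFinD.
  rewrite ge0_integralD//=.
  - congr (_ + _); rewrite (_ : (fun _ => _) = cst (a ^+ 2)%:E)// integral_cst//.
    by rewrite [X in _ * X]probability_setT mule1.
  - by move=> x _; rewrite lee_fin sqr_ge0.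
  - by move=> x _; rewrite lee_fin sumr_ge0// => i _; rewrite sqr_ge0.
  - by apply/measurable_EFinP; exact: measurable_sqnorm.
rewrite ge0_integralD//=.
- rewrite (_ : (fun=> S) = cst S)// integral_cst// [X in _ * X]probability_setT mule1.
  by rewrite lte_add_pinfty// normal_second_moment.
- by move=> x _; rewrite lee_fin sqr_ge0.
- by apply/measurable_EFinP; exact: exprn_measurable.
Qed.

End gaussian_integrals.

(** * The rotation by 45 degrees in dimension m *)

Section tuple_rotation.
Context (R : realType) (m : nat).
Local Notation V := (m.-tuple R).

Definition rot45_tuple (z : V * V) : V * V :=
  ([tuple (tnth z.1 i + tnth z.2 i) / Num.sqrt 2 | i < m],
   [tuple (tnth z.1 i - tnth z.2 i) / Num.sqrt 2 | i < m]).

Definition opp_tuple (x : V) : V := [tuple - tnth x i | i < m].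

Lemma measurable_rot45_tuple : measurable_fun setT rot45_tuple.
Proof.
apply: measurable_fun_pair; apply/measurable_fun_tnthP => i.
- rewrite (_ : _ \o _ = fun z : V * V => (tnth z.1 i + tnth z.2 i) / Num.sqrt 2).
    apply: measurable_funM => //; apply: measurable_funD.
      by apply: (measurableT_comp (measurable_tnth i)).
    by apply: (measurableT_comp (measurable_tnth i)).
  by apply/funext => z /=; rewrite tnth_mktuple.
- rewrite (_ : _ \o _ = fun z : V * V => (tnth z.1 i - tnth z.2 i) / Num.sqrt 2).
    apply: measurable_funM => //; apply: measurable_funB.
      by apply: (measurableT_comp (measurable_tnth i)).
    by apply: (measurableT_comp (measurable_tnth i)).
  by apply/funext => z /=; rewrite tnth_mktuple.
Qed.

Lemma measurable_opp_tuple : measurable_fun setT opp_tuple.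
Proof.
apply/measurable_fun_tnthP => i.
rewrite (_ : _ \o _ = fun z : V => - tnth z i).
  by apply: measurable_funN; exact: measurable_tnth.
by apply/funext => z /=; rewrite tnth_mktuple.
Qed.

(** The matrix of [rot45_tuple] is an involution, and conjugating the exchange of x and y by it
    gives diag(1, -1). Hence rotation invariance and Tonelli already imply the symmetry of the
    Gaussian measure. *)
Lemma rot45_swap_rot45 (x y : V) :
  rot45_tuple ((rot45_tuple (x, y)).2, (rot45_tuple (x, y)).1) = (x, opp_tuple y).
Proof.
have s0 : Num.sqrt (2 : R) != 0 by rewrite gt_eqF ?sqrtr_gt0.
have s2 : Num.sqrt (2 : R) ^+ 2 = 2 by rewrite sqr_sqrtr.
rewrite /rot45_tuple; move: (Num.sqrt 2) s0 s2 => s s0 s2.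
have e1 (a b : R) : ((a - b) / s + (a + b) / s) / s = a.
  by transitivity (2 * a / s ^+ 2); [field|rewrite s2; field].
have e2 (a b : R) : ((a - b) / s - (a + b) / s) / s = - b.
  by transitivity (- (2 * b) / s ^+ 2); [field|rewrite s2; field].
congr (_, _); apply: eq_from_tnth => i /=; rewrite !tnth_mktuple/= ?tnth_mktuple.
  exact: e1.
exact: e2.
Qed.

End tuple_rotation.

Section gaussian_rotation.
Local Open Scope ereal_scope.
Context (R : realType).
Local Notation gauss := (normal_prob (0 : R) 1).
Local Notation G := (std_gaussian R).

Lemma integral_std_gaussianSS m (k : m.+1.-tuple R * m.+1.-tuple R -> \bar R) :
  measurable_fun setT k -> (forall z, 0 <= k z) ->
  \int[G m.+1]_x \int[G m.+1]_y k (x, y) =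
  \int[gauss]_a \int[gauss]_b \int[G m]_x \int[G m]_y
    k (cons_pair (a, x), cons_pair (b, y)).
Proof.
move=> mk k0.
rewrite integral_std_gaussianS//=; last 2 first.
- exact: measurable_fun_fubini_tonelli_F.
- by move=> x; exact: integral_ge0.
apply: eq_integral => a _.
pose k' (z : (m.-tuple R * measurableTypeR R) * m.-tuple R) :=
  k (cons_pair (a, z.1.1), cons_pair (z.1.2, z.2)).
have mk' : measurable_fun setT k'.
  apply: (measurableT_comp mk); apply: measurable_fun_pair.
    apply: (measurableT_comp (@measurable_cons_pair R m)).
    apply: measurable_fun_pair => //.
    by apply: (measurableT_comp measurable_fst).
  apply: (measurableT_comp (@measurable_cons_pair R m)).
  apply: measurable_fun_pair => //.
  by apply: (measurableT_comp measurable_snd).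
transitivity (\int[G m]_x \int[gauss]_b \int[G m]_y k' ((x, b), y)).
  apply: eq_integral => x _; rewrite integral_std_gaussianS//.
  by apply: (measurableT_comp mk); exact: measurable_pair1.
rewrite (fubini_tonelli (fun z : m.-tuple R * measurableTypeR R => \int[G m]_y k' (z, y)))//.
- exact: (measurable_fun_fubini_tonelli_F _ mk' (fun z => k0 _)).
- by move=> z; apply: integral_ge0 => y _; exact: k0.
Qed.

(** Induction on the dimension: the rotation acts separately on each pair of matching coordinates,
    so the first pair is rotated by [normal_rot45] and the others by the induction hypothesis.
    [integral_std_gaussianSS] reorders the integrals to separate them. *)
Lemma std_gaussian_rot45 m (h : m.-tuple R * m.-tuple R -> \bar R) :
  measurable_fun setT h -> (forall z, 0 <= h z) ->
  \int[G m]_x \int[G m]_y h (rot45_tuple (x, y)) =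
  \int[G m]_x \int[G m]_y h (x, y).
Proof.
elim: m h => [|m IH] h mh h0.
  apply: eq_integral => x _; apply: eq_integral => y _; congr h.
  by rewrite [x]tuple0 [y]tuple0; congr (_, _); exact: tuple0.
rewrite [LHS](@integral_std_gaussianSS _ (h \o @rot45_tuple R m.+1)); last 2 first.
- by apply: (measurableT_comp mh); exact: measurable_rot45_tuple.
- by move=> z; exact: h0.
apply: etrans (esym (integral_std_gaussianSS mh h0)).
pose H (z : measurableTypeR R * measurableTypeR R) :=
  \int[G m]_x \int[G m]_y h (cons_pair (z.1, x), cons_pair (z.2, y)).
have mhc (c : measurableTypeR R * measurableTypeR R) : measurable_fun setT
    (fun z : m.-tuple R * m.-tuple R => h (cons_pair (c.1, z.1), cons_pair (c.2, z.2))).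
  apply: (measurableT_comp mh); apply: measurable_fun_pair.
    apply: (measurableT_comp (@measurable_cons_pair R m)).
    by apply: measurable_fun_pair.
  apply: (measurableT_comp (@measurable_cons_pair R m)).
  by apply: measurable_fun_pair.
transitivity (\int[gauss]_a \int[gauss]_b H (rot45 (a, b))).
  apply: eq_integral => a _; apply: eq_integral => b _.
  apply: etrans (IH _ (mhc (rot45 (a, b))) (fun z => h0 _)).
  apply: eq_integral => x _; apply: eq_integral => y _ /=; congr h.
  congr (_, _); apply: eq_from_tnth => i; rewrite tnth_mktuple;
    case: (unliftP ord0 i) => [j|] ->; rewrite ?tnthS ?tnth_mktuple//.
suff mH : measurable_fun setT H.
  by apply: (normal_rot45 mH) => z; do 2 apply: integral_ge0 => ? _.
pose h1 (z : ((measurableTypeR R * measurableTypeR R) * m.-tuple R) * m.-tuple R) :=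
  h (cons_pair (z.1.1.1, z.1.2), cons_pair (z.1.1.2, z.2)).
have mh1 : measurable_fun setT h1.
  apply: (measurableT_comp mh); apply: measurable_fun_pair.
    apply: (measurableT_comp (@measurable_cons_pair R m)).
    apply: measurable_fun_pair.
      apply: (measurableT_comp measurable_fst); apply: (measurableT_comp measurable_fst).
      exact: measurable_fst.
    by apply: (measurableT_comp measurable_snd).
  apply: (measurableT_comp (@measurable_cons_pair R m)).
  apply: measurable_fun_pair => //.
  apply: (measurableT_comp measurable_snd); apply: (measurableT_comp measurable_fst).
  exact: measurable_fst.
have mh2 := measurable_fun_fubini_tonelli_F (m2 := G m) _ mh1 (fun z => h0 _).
exact: (measurable_fun_fubini_tonelli_F (m2 := G m) _ mh2 (fun z => integral_ge0 _ (fun y _ => h0 _))).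
Qed.

Lemma std_gaussian_opp m (h : m.-tuple R -> \bar R) :
  measurable_fun setT h -> (forall z, 0 <= h z) ->
  \int[G m]_x h (opp_tuple x) = \int[G m]_x h x.
Proof.
move=> mh h0.
have cstE (c : \bar R) : \int[G m]_x c = c.
  by rewrite (_ : (fun=> c) = cst c)// integral_cst// [X in _ * X]probability_setT mule1.
pose K (z : m.-tuple R * m.-tuple R) := h z.2.
have mK : measurable_fun setT K by exact: (measurableT_comp mh).
have K0 z : 0 <= K z by exact: h0.
pose K1 z := K (rot45_tuple z).
have mK1 : measurable_fun setT K1 by apply: (measurableT_comp mK); exact: measurable_rot45_tuple.
pose K2 (z : m.-tuple R * m.-tuple R) := K1 (z.2, z.1).
have mK2 : measurable_fun setT K2.
  by apply: (measurableT_comp mK1); apply: measurable_fun_pair.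
transitivity (\int[G m]_x \int[G m]_y K2 (rot45_tuple (x, y))).
  rewrite -[LHS]cstE; apply: eq_integral => x _; apply: eq_integral => y _.
  by rewrite /K2 /K1 rot45_swap_rot45.
rewrite std_gaussian_rot45//; last by move=> z; exact: h0.
rewrite fubini_tonelli//; last by move=> z; exact: h0.
transitivity (\int[G m]_x \int[G m]_y K (rot45_tuple (x, y))); first by [].
rewrite std_gaussian_rot45//; exact: (cstE (\int[G m]_y h y)).
Qed.

End gaussian_rotation.

(** * Exponential moments of Gaussian vectors in smooth spaces *)

Lemma expR_le2 (R : realType) (u : R) : u <= 2^-1 -> expR u <= 2.
Proof.
move=> u2; rewrite -[u]opprK expRN -[2]invrK lef_pV2 ?posrE ?expR_gt0//.
by apply: le_trans (expR_ge1Dx _); lra.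
Qed.

Section gaussian_seminorm.
Context (R : realType) (X : normedModType R) (m : nat) (A : {linear 'rV[R]_m -> X}).
Local Notation G := (std_gaussian R m).
Local Notation q := (fun x : m.-tuple R => `|A (row_of_tuple x)|).

Lemma measurable_seminorm : measurable_fun setT q.
Proof.
have := measurable_linear_norm A 0.
by under eq_fun do rewrite add0r.
Qed.

Lemma seminorm_rot45 (x y : m.-tuple R) :
  `|A (row_of_tuple (rot45_tuple (x, y)).1)| =
    `|A (row_of_tuple x) + A (row_of_tuple y)| / Num.sqrt 2 /\
  `|A (row_of_tuple (rot45_tuple (x, y)).2)| =
    `|A (row_of_tuple x) - A (row_of_tuple y)| / Num.sqrt 2.
Proof.
split.
- have -> : row_of_tuple (rot45_tuple (x, y)).1 =
    (Num.sqrt 2)^-1 *: (row_of_tuple x + row_of_tuple y).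
    by apply/rowP => i; rewrite !mxE tnth_mktuple mulrC.
  rewrite linearZ linearD normrZ mulrC ger0_norm//.
- have -> : row_of_tuple (rot45_tuple (x, y)).2 =
    (Num.sqrt 2)^-1 *: (row_of_tuple x - row_of_tuple y).
    by apply/rowP => i; rewrite !mxE tnth_mktuple mulrC.
  rewrite linearZ linearB normrZ mulrC ger0_norm//.
Qed.

Lemma linear_opp_tuple (x : m.-tuple R) :
  A (row_of_tuple (opp_tuple x)) = - A (row_of_tuple x).
Proof.
rewrite -linearN; congr (A _).
by apply/rowP => i; rewrite !mxE tnth_mktuple.
Qed.

Lemma measurable_seminorm_gt t : measurable [set x | t < q x].
Proof.
rewrite -[X in measurable X]setTI.
have -> : [set x | t < q x] = q @^-1` `]t, +oo[.
  by apply/seteqP; split => x /=; rewrite in_itv/= andbT.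
exact: measurable_seminorm.
Qed.

Local Open Scope ereal_scope.

Lemma integral_indicM (B C : set (m.-tuple R)) : measurable B -> measurable C ->
  \int[G]_x \int[G]_y (\1_B x * \1_C y)%:E = G B * G C.
Proof.
move=> mB mC.
transitivity (\int[G]_x ((\1_B x)%:E * G C)).
  apply: eq_integral => x _; under eq_integral do rewrite EFinM.
  rewrite ge0_integralZl_EFin// ?integral_indic ?setIT//.
  by apply/measurable_EFinP; exact: measurable_indic.
rewrite ge0_integralZr// ?integral_indic ?setIT//.
by apply/measurable_EFinP; exact: measurable_indic.
Qed.

(* With x' = (x + y) / sqrt 2 and y' = (x - y) / sqrt 2, [q x' <= s] and
   [t < q y'] force both [q x] and [q y] above [(t - s) / sqrt 2]. *)
Lemma fernique_step s t :
  G [set x | (q x <= s)%R] * G [set x | (t < q x)%R] <=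
  G [set x | ((t - s) / Num.sqrt 2 < q x)%R] ^+ 2.
Proof.
have mgt := measurable_seminorm_gt.
have mle : measurable [set x | (q x <= s)%R].
  have -> : [set x | (q x <= s)%R] = ~` [set x | (s < q x)%R].
    by apply/seteqP; split => x /=; rewrite leNgt => /negP.
  exact: measurableC.
pose h (z : m.-tuple R * m.-tuple R) : \bar R :=
  (\1_[set x | (q x <= s)%R] z.1 * \1_[set x | (t < q x)%R] z.2)%:E.
have mh : measurable_fun setT h.
  apply/measurable_EFinP; apply: measurable_funM.
    by apply: (measurableT_comp (measurable_indic mle)).
  by apply: (measurableT_comp (measurable_indic (mgt t))).
have h0 z : 0 <= h z by rewrite lee_fin.
have -> : G [set x | (q x <= s)%R] * G [set x | (t < q x)%R] =
    \int[G]_x \int[G]_y h (rot45_tuple (x, y)).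
  apply: etrans (esym (integral_indicM mle (mgt t))) _.
  exact/esym/(std_gaussian_rot45 mh h0).
rewrite expe2 -(integral_indicM (mgt _) (mgt _)).
apply: ge0_integral_mono => x; first by apply: integral_ge0 => y _; rewrite lee_fin.
apply: ge0_integral_mono => y; first by rewrite lee_fin.
rewrite lee_fin !indicE.
set z := rot45_tuple (x, y).
case: (boolP (z.1 \in _)) => [|_]; last by rewrite mul0r mulr_ge0.
case: (boolP (z.2 \in _)) => [|_]; last by rewrite mulr0 mulr_ge0.
rewrite !inE /=.
have [-> ->] := seminorm_rot45 x y.
have s0 : (0 < Num.sqrt (2 : R))%R by rewrite sqrtr_gt0.
have s2 : (Num.sqrt (2 : R) * Num.sqrt 2 = 2)%R by rewrite -expr2 sqr_sqrtr.
rewrite ltr_pdivlMr// ler_pdivrMr// => h2 h1.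
set a := A (row_of_tuple x) in h1 h2 *; set b := A (row_of_tuple y) in h1 h2 *.
have ha : (`|a - b| <= 2 * `|a| + `|a + b|)%R.
  have -> : (a - b = a *+ 2 - (a + b))%R by rewrite mulr2n opprD addrA addrK.
  by apply: le_trans (ler_normB _ _) _; rewrite normrMn mulr_natl.
have hb : (`|a - b| <= 2 * `|b| + `|a + b|)%R.
  have -> : (a - b = a + b - b *+ 2)%R by rewrite mulr2n opprD addrA addrK.
  by apply: le_trans (ler_normB _ _) _; rewrite normrMn mulr_natl addrC.
have key c : (`|a - b| <= 2 * c + `|a + b| -> (t - s) / Num.sqrt 2 < c)%R.
  move=> hc; rewrite ltr_pdivrMr// -(ltr_pM2r s0).
  by rewrite -mulrA s2 mulrBl; lra.
have -> : x \in [set x0 | ((t - s) / Num.sqrt 2 < q x0)%R] by rewrite inE /=; exact: key.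
have -> : y \in [set x0 | ((t - s) / Num.sqrt 2 < q x0)%R] by rewrite inE /=; exact: key.
by [].
Qed.

Lemma seminorm_second_moment : \int[G]_x (q x ^+ 2)%:E = (gamma_norm A ^+ 2)%:E.
Proof.
have i0 : 0 <= \int[G]_x (q x ^+ 2)%:E.
  by apply: integral_ge0 => x _; rewrite lee_fin sqr_ge0.
rewrite /gamma_norm unlock sqr_sqrtr; last exact: fine_ge0.
rewrite fineK// ge0_fin_numE//.
have [K K0 hK] := lipschitz_linear_norm A 0%R.
apply: (@le_lt_trans _ _ (\int[G]_x ((K ^+ 2 * m%:R)%:E * (\sum_i tnth x i ^+ 2)%:E))).
  apply: ge0_integral_mono => x; first by rewrite lee_fin sqr_ge0.
  rewrite -EFinM lee_fin.
  have := hK x [tuple 0%R | i < m]; rewrite !add0r.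
  have -> : row_of_tuple [tuple 0%R | i < m] = 0%R :> 'rV[R]_m.
    by apply/rowP => i; rewrite !mxE tnth_mktuple.
  rewrite linear0 normr0 subr0 ger0_norm//.
  under eq_bigr do rewrite tnth_mktuple subr0.
  move=> h; apply: (@le_trans _ _ ((K * \sum_i `|tnth x i|) ^+ 2)%R).
    by rewrite ler_sqr ?nnegrE// mulr_ge0// sumr_ge0.
  rewrite exprMn -(mulrA (K ^+ 2)%R m%:R) ler_wpM2l ?sqr_ge0//.
  rewrite expr2 mulr_suml.
  apply: (@le_trans _ _ (\sum_(i < m) \sum_(j < m) ((tnth x i ^+ 2 + tnth x j ^+ 2) / 2))%R).
    apply: ler_sum => i _; rewrite mulr_sumr; apply: ler_sum => j _.
    rewrite ler_pdivlMr// -[(tnth x i ^+ 2)%R]real_normK ?num_real// -[(tnth x j ^+ 2)%R]real_normK ?num_real//.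
    rewrite -subr_ge0 (_ : (_ - _ = (`|tnth x i| - `|tnth x j|) ^+ 2)%R) ?sqr_ge0//.
    by ring.
  under eq_bigr do rewrite -mulr_suml big_split/= sumr_const card_ord.
  rewrite -mulr_suml big_split/= sumr_const card_ord -sumrMnl -mulr_natl.
  by under eq_bigr do rewrite -mulr_natl; rewrite -mulr_sumr; lra.
rewrite ge0_integralZl_EFin//.
- by rewrite lte_mul_pinfty ?lee_fin ?mulr_ge0 ?sqr_ge0// std_gaussian_second_moment.
- by move=> x _; rewrite lee_fin sumr_ge0// => i _; exact: sqr_ge0.
- by apply/measurable_EFinP; exact: measurable_sqnorm.
- by rewrite mulr_ge0// sqr_ge0.
Qed.

Section fernique.
Variable b : R.
Hypothesis b0 : (0 < b)%R.
Hypothesis gb : (gamma_norm A <= b)%R.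

(* Chosen so that [3 * b + Num.sqrt 2 * fernique_level n <= fernique_level n.+1]
   and [fernique_level 0 = 3 * b]. *)
Definition fernique_level (n : nat) : R := (3 * b * (4 * Num.sqrt 2 ^+ n - 3))%R.

Lemma fernique_tail n :
  G [set x | (fernique_level n < q x)%R] <= (8^-1 ^+ (2 ^ n))%:E.
Proof.
have mgt := measurable_seminorm_gt.
pose S t := fine (G [set x | (t < q x)%R]).
have SE t : G [set x | (t < q x)%R] = (S t)%:E by rewrite fineK// fin_num_measure.
have S0 t : (0 <= S t)%R by apply: fine_ge0.
have cheb : (S (3 * b) <= 9^-1)%R.
  rewrite -lee_fin -SE.
  suff : (9 * b ^+ 2)%:E * G [set x | (3 * b < q x)%R] <= (b ^+ 2)%:E.
    rewrite SE -EFinM !lee_fin => h.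
    rewrite -(ler_pM2l (_ : 0 < 9 * b ^+ 2)%R) ?mulr_gt0 ?exprn_gt0//.
    by apply: le_trans h _; rewrite mulrAC mulfV// mul1r.
  apply: (@le_trans _ _ (\int[G]_x (q x ^+ 2)%:E)); last first.
    rewrite seminorm_second_moment lee_fin ler_sqr ?nnegrE// ?sqrtr_ge0//.
    exact: ltW.
  rewrite -[X in _ * G X]setIT -integral_indic// -ge0_integralZl_EFin//; last 2 first.
  - by apply/measurable_EFinP; exact: measurable_indic.
  - by rewrite mulr_ge0// sqr_ge0.
  apply: ge0_integral_mono => x.
    by rewrite mule_ge0 ?lee_fin// mulr_ge0// sqr_ge0.
  rewrite -EFinM lee_fin indicE.
  case: (boolP (x \in _)) => [|_]; rewrite ?mulr0 ?sqr_ge0//.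
  rewrite inE /= mulr1 => h.
  have -> : (9 * b ^+ 2 = (3 * b) ^+ 2)%R by ring.
  by rewrite ler_sqr ?nnegrE// ?ltW// mulr_gt0.
have Sle : (8 / 9)%:E <= G [set x | (q x <= 3 * b)%R].
  have -> : [set x | (q x <= 3 * b)%R] = ~` [set x | (3 * b < q x)%R].
    by apply/seteqP; split => x /=; rewrite leNgt => /negP.
  rewrite probability_setC// SE -EFinB lee_fin; lra.
have s20 : (0 < Num.sqrt (2 : R))%R by rewrite sqrtr_gt0.
have s2 : (Num.sqrt (2 : R) * Num.sqrt 2 = 2)%R by rewrite -expr2 sqr_sqrtr.
have Smono t u : (t <= u)%R -> (S u <= S t)%R.
  move=> tu; rewrite -lee_fin -!SE; apply: le_measure; rewrite ?inE//.
  by move=> x /=; exact: le_lt_trans.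
rewrite SE lee_fin.
(* The factor 8/9 is what the recursion 8/9 S_(n+1) <= S_n^2 preserves, and it starts with equality:
   Chebyshev's 1/9 is 8/9 * 1/8. *)
suff : (S (fernique_level n) <= 8 / 9 * 8^-1 ^+ (2 ^ n))%R.
  move/le_trans; apply; by rewrite ler_piMl//; lra.
elim: n => [|n IH].
  rewrite /fernique_level expr0 expn0 expr1 mulr1.
  by rewrite (_ : 4 - 3 = 1 :> R)%R ?mulr1 ?(le_trans cheb)//; lra.
have := fernique_step (3 * b)%R (fernique_level n.+1).
rewrite !SE => h1.
have {h1} : ((8 / 9)%:E * (S (fernique_level n.+1))%:E <=
    (S ((fernique_level n.+1 - 3 * b) / Num.sqrt 2))%:E ^+ 2).
  by apply: le_trans h1; rewrite lee_wpmul2r// lee_fin.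
rewrite expe2 -!EFinM lee_fin => h1.
have {}h1 : (8 / 9 * S (fernique_level n.+1) <= S (fernique_level n) ^+ 2)%R.
  apply: le_trans h1 _; rewrite expr2.
  have h : (S ((fernique_level n.+1 - 3 * b) / Num.sqrt 2) <= S (fernique_level n))%R.
    apply: Smono; rewrite ler_pdivlMr// /fernique_level exprS.
    set r := (Num.sqrt 2 ^+ n)%R; set s := Num.sqrt 2 in s20 s2 *.
    have s43 : (4 <= 3 * s)%R.
      rewrite -(ler_pM2r s20) -mulrA s2.
      rewrite leNgt; apply/negP => h; nra.
    rewrite -subr_ge0 (_ : _ - _ = 3 * b * (3 * s - 4))%R; last by ring.
    by rewrite !mulr_ge0// ?subr_ge0// ltW.
  exact: ler_pM.
have {}h1 : (8 / 9 * S (fernique_level n.+1) <= (8 / 9 * 8^-1 ^+ (2 ^ n)) ^+ 2)%R.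
  by apply: le_trans h1 _; rewrite ler_sqr ?nnegrE// mulr_ge0// exprn_ge0.
rewrite -(ler_pM2l (_ : 0 < 8 / 9)%R)//.
apply: le_trans h1 _; rewrite expnSr exprM; set e := (_ ^+ (2 ^ n))%R.
by rewrite (_ : (8 / 9 * e) ^+ 2 = 8 / 9 * (8 / 9 * e ^+ 2))%R; last ring.
Qed.

(** Layers between consecutive levels: [fernique_level k.+1] is at most 12 b sqrt 2^(k+1), so there
    the exponent is at most 2^k / 2 and the exponential at most 2^(2^k). This is where 24 = 2 * 12
    comes from. Against the tail 8^-(2^k) each layer contributes at most 2^-(k+1), in total 1; the
    region below 3 b contributes at most 2. *)
Lemma fernique : \int[G]_x (expR (q x ^+ 2 / (24 * b) ^+ 2))%:E <= 3%:E.
Proof.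
have mgt := measurable_seminorm_gt.
have bb : (0 < (24 * b) ^+ 2)%R by rewrite exprn_gt0// mulr_gt0.
have s20 : (0 < Num.sqrt (2 : R))%R by rewrite sqrtr_gt0.
have s2 : (Num.sqrt (2 : R) ^+ 2 = 2)%R by rewrite sqr_sqrtr.
have s1 : (1 <= Num.sqrt (2 : R))%R by rewrite -[X in (X <= _)%R]sqrtr1 ler_wsqrtr// ler1n.
pose f n x : \bar R := (2 ^+ (2 ^ n) * \1_[set x | (fernique_level n < q x)%R] x)%:E.
have f0 n x : 0 <= f n x by rewrite lee_fin mulr_ge0// exprn_ge0.
have mf n : measurable_fun setT (f n).
  by apply/measurable_EFinP/measurable_funM => //; exact: measurable_indic.
apply: (@le_trans _ _ (\int[G]_x (2%:E + \sum_(n <oo) f n x))).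
  apply: ge0_integral_mono => x; first by rewrite lee_fin expR_ge0.
  have [qb|bq] := leP (q x) (3 * b)%R.
    apply: (@le_trans _ _ 2%:E); last by rewrite leeDl// nneseries_ge0.
    rewrite lee_fin; apply: expR_le2.
    rewrite ler_pdivrMr//.
    apply: (@le_trans _ _ ((3 * b) ^+ 2)%R).
      by rewrite ler_sqr ?nnegrE// mulr_ge0// ltW.
    by have := sqr_ge0 b; rewrite !exprMn; lra.
  have exn : exists n, (fun n => q x <= fernique_level n)%R n.
    pose k := Num.bound (q x / (3 * b))%R.
    exists (2 * k)%N; rewrite /fernique_level exprM s2.
    have : (q x / (3 * b) <= k%:R)%R by apply/ltW/archi_boundP; rewrite divr_ge0// mulr_ge0// ltW.
    rewrite ler_pdivrMr ?mulr_gt0// => /le_trans; apply.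
    rewrite mulrC ler_wpM2l//; first by rewrite mulr_ge0// ltW.
    have : (k%:R + 1 <= 2 ^+ k :> R)%R.
      by rewrite natr1 -natrX ler_nat ltn_expl.
    have : (0 <= k%:R :> R)%R by [].
    lra.
  case: (ex_minnP exn) => -[|k] /= hk kmin.
    by exfalso; move: hk bq; rewrite /fernique_level expr0 mulr1; lra.
  have qk : (fernique_level k < q x)%R.
    by rewrite ltNge; apply/negP => /kmin; rewrite ltnn.
  apply: (@le_trans _ _ (f k x)).
    rewrite lee_fin indicE mem_set// mulr1.
    apply: (@le_trans _ _ (expR ((2 ^ k)%:R * 2^-1))); last first.
      by rewrite expRM_natl lerXn2r ?nnegrE ?expR_ge0//; exact: expR_le2.
    rewrite ler_expR ler_pdivrMr//.
    apply: (@le_trans _ _ ((12 * b * Num.sqrt 2 ^+ k.+1) ^+ 2)%R).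
      have r0 : (0 <= Num.sqrt (2 : R) ^+ k.+1)%R by rewrite exprn_ge0// ltW.
      have qr : (q x <= 12 * b * Num.sqrt 2 ^+ k.+1)%R.
        apply: le_trans hk _; rewrite /fernique_level.
        rewrite -subr_ge0 (_ : (_ - _ = 9 * b)%R); last by ring.
        by rewrite mulr_ge0// ltW.
      by rewrite ler_sqr ?nnegrE// (le_trans _ qr).
    rewrite natrX (_ : ((12 * b * Num.sqrt 2 ^+ k.+1) ^+ 2 =
      (12 * b) ^+ 2 * (Num.sqrt 2 ^+ 2) ^+ k.+1)%R); last by rewrite exprMn -!exprM mulnC.
    rewrite s2 (exprS 2%R k); move: (2 ^+ k)%R => r.
    by rewrite (_ : (_ * (2 * r) = r * 2^-1 * (24 * b) ^+ 2)%R); last by field.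
  have := @nneseries_lim_ge R (fun n => f n x) xpredT 0 k.+1 (fun n _ _ => f0 n x).
  rewrite big_nat_recr//= => h.
  apply: le_trans (lee_paddl _ _) => //; apply: le_trans h.
  by rewrite leeDr// sume_ge0.
rewrite ge0_integralD//; last 2 first.
- by move=> x _; exact: nneseries_ge0.
- exact: ge0_emeasurable_sum.
rewrite (_ : (fun=> 2%:E) = cst 2%:E)// integral_cst// [X in _ * X]probability_setT mule1.
rewrite integral_nneseries//.
rewrite (_ : 3%:E = 2%:E + 1%:E); last by rewrite -EFinD; congr EFin; ring.
rewrite leeD2l//.
have half := @cvg_geometric_eseries_half R 1%R 0.
have -> : 1%:E = \sum_(n <oo) (1 / (2 ^ (n + 1))%:R)%:E :> \bar R.
  by apply/esym/cvg_lim => //; move: half; rewrite expr0 divr1.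
apply: lee_nneseries => [n _ _|n _]; first by apply: integral_ge0.
rewrite /f; under eq_integral do rewrite EFinM.
rewrite ge0_integralZl_EFin//; last first.
  by apply/measurable_EFinP; exact: measurable_indic.
rewrite integral_indic// setIT.
apply: (@le_trans _ _ ((2 ^+ (2 ^ n))%:E * (8^-1 ^+ (2 ^ n))%:E)).
  by rewrite lee_wpmul2l ?lee_fin ?exprn_ge0//; exact: fernique_tail.
rewrite -EFinM lee_fin -exprMn.
apply: (@le_trans _ _ (2^-1 ^+ (2 ^ n))%R).
  by rewrite lerXn2r ?nnegrE//; lra.
rewrite div1r natrX -exprVn.
apply: ler_wiXn2l; rewrite ?invr_ge0 ?invf_le1 ?ler1n//.
by rewrite addn1 ltn_expl.
Qed.

End fernique.

End gaussian_seminorm.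

Ltac nneg := repeat first [done | assumption | exact: sqr_ge0 | apply: ltW; assumption
  | apply: mulr_ge0 | apply: addr_ge0 | apply: exprn_ge0 | apply: divr_ge0 | exact: expR_ge0].

(** * Elementary inequalities for the exponential *)

Section exp_inequalities.
Context (R : realType).
Implicit Types t z : R.

(** Convexity of exp between 0 and z. It lets Fernique's bound for one fixed exponent yield 1 + O(t)
    for t times that exponent. *)
Lemma expR_chord t z : 0 <= t <= 1 -> expR (t * z) <= 1 + t * (expR z - 1).
Proof.
move=> /andP[t0 t1].
have h1 : expR (t * z) * (1 + (1 - t) * z) <= expR z.
  rewrite [leRHS](_ : _ = expR (t * z) * expR ((1 - t) * z)); last first.
    by rewrite -expRD; congr expR; ring.
  by rewrite ler_wpM2l ?expR_ge0// expR_ge1Dx.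
have h2 : expR (t * z) * (1 - t * z) <= 1.
  by rewrite -[leRHS](expRxMexpNx_1 (t * z)) ler_wpM2l ?expR_ge0// expR_ge1Dx.
have e0 := expR_ge0 (t * z).
have := ler_wpM2l t0 h1; have := ler_wpM2l (_ : 0 <= 1 - t) h2.
rewrite subr_ge0 => /(_ t1).
move: (expR (t * z)) (expR z) => u v; lra.
Qed.

(** A subgaussian bound for cosh with a generous constant: for small z compare with 1 / (1 - z^2) <=
    1 + 2 z^2, for large z use [|z| <= 2 z^2]. *)
Lemma expRDexpRN_le_sqr z : expR z + expR (- z) <= 2 * expR (2 * z ^+ 2).
Proof.
have [z2|z2] := leP (z ^+ 2) 2^-1.
  apply: (@le_trans _ _ (2 * (1 + 2 * z ^+ 2))); last first.
    by rewrite ler_wpM2l// expR_ge1Dx.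
  have z1 : z ^+ 2 < 1 by lra.
  have zl : -1 < z < 1.
    by rewrite -ltr_norml -(@ltr_pXn2r _ 2)// ?nnegrE// expr1n real_normK ?num_real.
  have inv (u : R) : -1 < u < 1 -> expR u <= (1 - u)^-1.
    move=> /andP[u1 u2]; rewrite -[u in leLHS]opprK expRN lef_pV2 ?posrE ?expR_gt0// ?subr_gt0//.
    exact: expR_ge1Dx.
  have hz := inv _ zl.
  have hnz : expR (- z) <= (1 - - z)^-1 by apply: inv; rewrite ltrN2 ltrNl andbC.
  apply: le_trans (lerD hz hnz) _.
  rewrite opprK.
  have -> : (1 - z)^-1 + (1 + z)^-1 = 2 / (1 - z ^+ 2).
    by move/andP: zl => [? ?]; field; rewrite !gt_eqF//; lra.
  rewrite ler_wpM2l// -[leLHS]mul1r ler_pdivrMr; last by lra.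
  nra.
have hz : `|z| <= 2 * z ^+ 2.
  rewrite -real_normK ?num_real//.
  have : 2^-1 < `|z|.
    rewrite ltNge; apply/negP => h; move: z2.
    rewrite -real_normK ?num_real// ltNge => /negP; apply; have := normr_ge0 z; nra.
  nra.
have : expR z <= expR (2 * z ^+ 2) by rewrite ler_expR (le_trans (ler_norm _)).
have : expR (- z) <= expR (2 * z ^+ 2).
  by rewrite ler_expR (le_trans (ler_norm _))// normrN.
lra.
Qed.

Lemma expRDexpRN_le_norm z : expR z + expR (- z) <= 2 * expR `|z|.
Proof.
have : expR z <= expR `|z| by rewrite ler_expR ler_norm.
have : expR (- z) <= expR `|z| by rewrite ler_expR -normrN ler_norm.
lra.
Qed.

End exp_inequalities.

(** * Adding one Gaussian increment in a smooth space *)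

Section one_step.
Context (R : realType) (X : normedModType R) (D : R).
Hypotheses (D1 : 1 <= D) (XD : smooth2 X D).

(** With p, q the two norms, (p^2 - q^2)^2 = (p - q)^2 (p + q)^2, where (p + q)^2 <= 4 (|x|^2 + D^2
    |y|^2) by smoothness. The triangle inequality bounds (p - q)^2 both by 4 |y|^2, used against
    |x|^2, and by 4 |x|^2, used against D^2 |y|^2. This takes the place of a bound on the derivative
    of the squared norm. *)
Lemma smooth_sqr_diff (x y : X) :
  (`|x + y| ^+ 2 - `|x - y| ^+ 2) ^+ 2 <= 32 * D ^+ 2 * `|x| ^+ 2 * `|y| ^+ 2.
Proof.
have := XD x y.
have d1 : `|x + y| - `|x - y| <= 2 * `|y|.
  rewrite lerBlDl mulr_natl -normrMn; apply: le_trans (ler_normD _ _).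
  by rewrite mulr2n addrA subrK.
have d2 : `|x - y| - `|x + y| <= 2 * `|y|.
  rewrite lerBlDl mulr_natl -normrMn; apply: le_trans (ler_normB _ _).
  by rewrite mulr2n opprD addrA addrK.
have d3 : `|x + y| - `|x - y| <= 2 * `|x|.
  rewrite lerBlDr mulr_natl -normrMn; apply: le_trans (ler_normB _ _).
  by rewrite mulr2n opprB addrCA addrK addrC.
have d4 : `|x - y| - `|x + y| <= 2 * `|x|.
  rewrite lerBlDr mulr_natl -normrMn; apply: le_trans (ler_normB _ _).
  by rewrite mulr2n opprD addrA addrK.
have := normr_ge0 (x + y); have := normr_ge0 (x - y).
have := normr_ge0 x; have := normr_ge0 y.
move: `|x| `|y| `|x + y| `|x - y| d1 d2 d3 d4 => u v p q d1 d2 d3 d4 v0 u0 q0 p0 sm.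
have DD : 1 <= D ^+ 2 by exact: exprn_ege1.
have e1 : (p - q) ^+ 2 <= 4 * v ^+ 2.
  rewrite -[leLHS]real_normK ?num_real// -[4 * _](_ : (2 * v) ^+ 2 = _); last by ring.
  rewrite ler_sqr ?nnegrE ?mulr_ge0// ler_norml; apply/andP; split; lra.
have e2 : (p - q) ^+ 2 <= 4 * u ^+ 2.
  rewrite -[leLHS]real_normK ?num_real// -[4 * _](_ : (2 * u) ^+ 2 = _); last by ring.
  rewrite ler_sqr ?nnegrE ?mulr_ge0// ler_norml; apply/andP; split; lra.
have e3 : (p + q) ^+ 2 <= 4 * (u ^+ 2 + D ^+ 2 * v ^+ 2).
  have : 0 <= (p - q) ^+ 2 by exact: sqr_ge0.
  by rewrite !expr2 in sm *; lra.
have -> : (p ^+ 2 - q ^+ 2) ^+ 2 = (p - q) ^+ 2 * (p + q) ^+ 2 by ring.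
have s0 := sqr_ge0 (p - q).
apply: le_trans (ler_wpM2l s0 e3) _.
have f1 := ler_wpM2r (_ : 0 <= u ^+ 2) e1.
have f2 := ler_wpM2r (_ : 0 <= D ^+ 2 * v ^+ 2) e2.
have {}f1 := f1 (sqr_ge0 _); have {}f2 := f2 (mulr_ge0 (sqr_ge0 _) (sqr_ge0 _)).
have f3 : u ^+ 2 * v ^+ 2 <= D ^+ 2 * (u ^+ 2 * v ^+ 2).
  by rewrite ler_peMl// mulr_ge0 ?sqr_ge0.
move: (u ^+ 2) (v ^+ 2) (D ^+ 2) ((p - q) ^+ 2) f1 f2 f3 => a b c e f1 f2 f3.
by lra.
Qed.

(** The two exponents are written as mean plus or minus half-difference z; smoothness bounds the
    mean and [smooth_sqr_diff] gives z^2 <= L2 |y|^2. Two bounds are kept: the quadratic one is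
    integrable by Fernique only while L2 is small compared with 1 / (24 b)^2, the linear one serves
    the other case. *)
Lemma smooth_exp_pair (a : R) (x y : X) : 0 <= a ->
  let L2 := 8 * a ^+ 2 * D ^+ 2 * `|x| ^+ 2 in
  expR (a * `|x + y| ^+ 2) + expR (a * `|x - y| ^+ 2) <=
    2 * expR (a * `|x| ^+ 2 + (a * D ^+ 2 + 2 * L2) * `|y| ^+ 2) /\
  expR (a * `|x + y| ^+ 2) + expR (a * `|x - y| ^+ 2) <=
    2 * expR (a * `|x| ^+ 2 + a * D ^+ 2 * `|y| ^+ 2 + Num.sqrt L2 * `|y|).
Proof.
move=> a0 L2.
pose m := (`|x + y| ^+ 2 + `|x - y| ^+ 2) / 2.
pose z := a * (`|x + y| ^+ 2 - `|x - y| ^+ 2) / 2.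
have L20 : 0 <= L2 by rewrite /L2; nneg.
have hm : a * m <= a * `|x| ^+ 2 + a * D ^+ 2 * `|y| ^+ 2.
  rewrite -mulrA -mulrDr ler_wpM2l// /m; have := XD x y; lra.
have hz : z ^+ 2 <= L2 * `|y| ^+ 2.
  rewrite /z /L2 expr_div_n exprMn.
  have := ler_wpM2l (sqr_ge0 a) (smooth_sqr_diff x y); lra.
have -> : a * `|x + y| ^+ 2 = a * m + z by rewrite /m /z; lra.
have -> : a * `|x - y| ^+ 2 = a * m + - z by rewrite /m /z; lra.
have -> : expR (a * m + z) + expR (a * m + - z) = expR (a * m) * (expR z + expR (- z)).
  by rewrite !expRD mulrDr.
split.
- apply: le_trans (ler_wpM2l (expR_ge0 _) (expRDexpRN_le_sqr z)) _.
  rewrite mulrCA ler_wpM2l// -expRD ler_expR; lra.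
- apply: le_trans (ler_wpM2l (expR_ge0 _) (expRDexpRN_le_norm z)) _.
  rewrite mulrCA ler_wpM2l// -expRD ler_expR.
  have : `|z| <= Num.sqrt L2 * `|y|.
    rewrite -(@ler_pXn2r _ 2)// ?nnegrE ?mulr_ge0 ?sqrtr_ge0//.
    by rewrite exprMn sqr_sqrtr// real_normK ?num_real.
  lra.
Qed.

(** Symmetry of the Gaussian replaces the integrand by its average over y and -y, which removes the
    term of first order. With c = (24 b)^2, the case c L2 <= 1/8 has t <= 1/2, and the chord bound
    turns Fernique's 3 into 1 + 2 t. *)
Lemma smooth_gaussian_step m (A : {linear 'rV[R]_m -> X}) (a b : R) (x : X) :
  0 < b -> gamma_norm A <= b -> 0 <= a -> 4 * (a * D ^+ 2 * (24 * b) ^+ 2) <= 1 ->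
  (\int[std_gaussian R m]_y (expR (a * `|x + A (row_of_tuple y)| ^+ 2))%:E <=
   (expR (a * `|x| ^+ 2 + (24 * b) ^+ 2 *
     (2 * a * D ^+ 2 + 136 * a ^+ 2 * D ^+ 2 * `|x| ^+ 2)))%:E)%E.
Proof.
move=> b0 Ab a0 ab.
set G := std_gaussian R m.
pose f y := expR (a * `|x + A (row_of_tuple y)| ^+ 2).
have mf : measurable_fun setT (EFin \o f).
  apply/measurable_EFinP; apply: measurableT_comp => //; apply: measurable_funM => //.
  by apply: measurable_funX; exact: measurable_linear_norm.
have f0 y : (0 <= (f y)%:E)%E by rewrite lee_fin expR_ge0.
pose L2 := 8 * a ^+ 2 * D ^+ 2 * `|x| ^+ 2.
have L20 : 0 <= L2 by rewrite /L2; nneg.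
pose E y := expR (`|A (row_of_tuple y)| ^+ 2 / (24 * b) ^+ 2).
have mE : measurable_fun setT (EFin \o E).
  apply/measurable_EFinP; apply: measurableT_comp => //; apply: measurable_funM => //.
  by apply: measurable_funX; exact: measurable_seminorm.
have E3 : (\int[G]_y (E y)%:E <= 3%:E)%E by exact: fernique.
have : 0 < (24 * b) ^+ 2 by rewrite exprn_gt0// mulr_gt0.
move: ((24 * b) ^+ 2) @E mE E3 ab => c E mE E3 ab bb.
have sym (c0 c1 : R) : 0 <= c0 -> 0 <= c1 ->
    (forall y, f y + f (opp_tuple y) <= 2 * (c0 + c1 * E y)) ->
    (\int[G]_y (f y)%:E <= (c0 + c1 * 3)%:E)%E.
  move=> c00 c10 hc.
  have -> : (\int[G]_y (f y)%:E = (2^-1)%:E * \int[G]_y (f y + f (opp_tuple y))%:E)%E.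
    under [in RHS]eq_integral do rewrite EFinD.
    rewrite ge0_integralD//.
    - rewrite (std_gaussian_opp mf)//.
      by rewrite -[in RHS](mul1e (integral _ _ _)) -ge0_muleDl// muleA -EFinD -EFinM mulVf// mul1e.
    - exact: (measurableT_comp mf (@measurable_opp_tuple R m)).
  apply: (@le_trans _ _ ((2^-1)%:E * \int[G]_y (2%:E * (c0%:E + c1%:E * (E y)%:E)))%E).
    rewrite lee_wpmul2l// ?lee_fin//.
    apply: ge0_integral_mono => y; first by rewrite lee_fin addr_ge0 ?expR_ge0.
    by rewrite -EFinM lee_fin; exact: hc.
  have cE0 y : (0 <= c1%:E * (E y)%:E)%E by rewrite -EFinM lee_fin mulr_ge0 ?expR_ge0.
  rewrite ge0_integralZl_EFin//; last 2 first.
  - by move=> y _; rewrite adde_ge0// lee_fin.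
  - by apply: emeasurable_funD => //; exact: emeasurable_funM.
  rewrite muleA -EFinM mulVf// mul1e ge0_integralD//; last exact: emeasurable_funM.
  rewrite (_ : (fun=> c0%:E) = cst c0%:E)// integral_cst// [X in (_ * X)%E]probability_setT mule1.
  rewrite ge0_integralZl_EFin//; last by move=> y _; rewrite lee_fin expR_ge0.
  by rewrite EFinD leeD2l// EFinM lee_wpmul2l.
have fE y : f y + f (opp_tuple y) = expR (a * `|x + A (row_of_tuple y)| ^+ 2) +
    expR (a * `|x - A (row_of_tuple y)| ^+ 2).
  by rewrite /f linear_opp_tuple.
have [small|big] := leP (c * L2) 8^-1.
  pose t := c * (a * D ^+ 2 + 2 * L2).
  have t01 : 0 <= t <= 1.
    rewrite /t; apply/andP; split; last by lra.
    by nneg.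
  have /andP[t0 t1] := t01.
  apply: le_trans (sym (expR (a * `|x| ^+ 2) * (1 - t)) (expR (a * `|x| ^+ 2) * t) _ _ _) _.
  - by rewrite mulr_ge0 ?expR_ge0// subr_ge0.
  - by rewrite mulr_ge0 ?expR_ge0.
  - move=> y; rewrite fE.
    have [h _] := smooth_exp_pair x (A (row_of_tuple y)) a0.
    apply: le_trans h _; rewrite ler_wpM2l// expRD.
    rewrite (_ : _ + _ * E y = expR (a * `|x| ^+ 2) * (1 + t * (E y - 1))); last by ring.
    rewrite ler_wpM2l ?expR_ge0//.
    have := expR_chord (`|A (row_of_tuple y)| ^+ 2 / c) t01.
    have -> : t * (`|A (row_of_tuple y)| ^+ 2 / c) =
        (a * D ^+ 2 + 2 * L2) * `|A (row_of_tuple y)| ^+ 2.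
      by rewrite /t; field; rewrite gt_eqF.
    by [].
  rewrite lee_fin (_ : _ + _ * 3 = expR (a * `|x| ^+ 2) * (1 + 2 * t)); last by ring.
  rewrite expRD ler_wpM2l ?expR_ge0//.
  apply: (@le_trans _ _ (1 + 2 * t)); first by lra.
  apply: le_trans (expR_ge1Dx _) _; rewrite ler_expR /t /L2.
  have : 0 <= c * (a ^+ 2 * D ^+ 2 * `|x| ^+ 2).
    by nneg.
  lra.
apply: le_trans (sym 0 (expR (a * `|x| ^+ 2 + c * L2 / 2)) _ _ _) _ => //.
- move=> y; rewrite fE add0r.
  have [_ h] := smooth_exp_pair x (A (row_of_tuple y)) a0.
  apply: le_trans h _; rewrite ler_wpM2l// -expRD ler_expR.
  set v := `|A (row_of_tuple y)|.
  rewrite -!addrA lerD2l.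
  have am : Num.sqrt L2 * v <= c * L2 / 2 + v ^+ 2 / c / 2.
    rewrite -subr_ge0.
    have -> : c * L2 / 2 + v ^+ 2 / c / 2 - Num.sqrt L2 * v =
       (c * Num.sqrt L2 - v) ^+ 2 / c / 2.
      have := sqr_sqrtr L20; move: (Num.sqrt L2) => s ss; rewrite -ss; field.
      by rewrite gt_eqF.
    by rewrite !divr_ge0 ?sqr_ge0 ?(ltW bb).
  have al : a * D ^+ 2 * v ^+ 2 <= v ^+ 2 / c / 4.
    rewrite -[leRHS]mulrA -invfM [leRHS]mulrC ler_wpM2r ?sqr_ge0//.
    rewrite -[leRHS]mul1r ler_pdivlMr ?mulr_gt0//; lra.
  have v0 : 0 <= v ^+ 2 / c by rewrite divr_ge0 ?sqr_ge0 ?(ltW bb).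
  lra.
rewrite add0r lee_fin expRD -mulrA expRD ler_wpM2l ?expR_ge0//.
(* As c L2 > 1/8 here, Fernique's constant satisfies 3 <= 1 + 16 c L2. The total 16.5 c L2 equals
   132 c a^2 D^2 |x|^2, within the stated 136. *)
apply: (@le_trans _ _ (expR (c * L2 / 2) * expR (16 * (c * L2)))).
  rewrite ler_wpM2l ?expR_ge0//.
  by apply: le_trans (expR_ge1Dx _); lra.
rewrite -expRD ler_expR /L2.
have : 0 <= c * (a * D ^+ 2).
  by nneg.
have : 0 <= c * (a ^+ 2 * D ^+ 2 * `|x| ^+ 2).
  by nneg.
lra.
Qed.

End one_step.

(** * The exponential maximal inequality *)

Lemma measurable_fun_lt_rays d (T : measurableType d) (R : realType) (f : T -> R) :
  (forall r, measurable [set w | f w < r]) -> measurable_fun setT f.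
Proof.
move=> h; apply: (measurability _ (RGenInftyO.measurableE R)) => _ [_ [r ->] <-].
rewrite setTI.
have -> : f @^-1` `]-oo, r[ = [set w | f w < r].
  by apply/seteqP; split => w /=; rewrite in_itv.
exact: h.
Qed.

(** * Measurability of vector-valued maps and random operators *)

Section norm_measurable.
Context d (S : measurableType d) (R : realType) (X : normedModType R).
Implicit Types Y : S -> X.

(* For separable [X] this is Borel measurability, expressed through real-valued
   functions only. *)
Definition norm_measurable Y := forall x : X, measurable_fun setT (fun w => `|Y w - x|).

Lemma norm_measurable_normr Y : norm_measurable Y -> measurable_fun setT (fun w => `|Y w|).
Proof. by move=> /(_ 0); under eq_fun do rewrite subr0. Qed.

Lemma norm_measurable0 : norm_measurable (fun=> 0).
Proof. by move=> x; exact: measurable_cst. Qed.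

Lemma norm_measurableN Y : norm_measurable Y -> norm_measurable (fun w => - Y w).
Proof.
move=> mY x; rewrite (_ : (fun w => _) = (fun w => `|Y w - - x|)); first exact: mY.
by apply/funext => w; rewrite opprK -opprD normrN.
Qed.

Lemma norm_measurable_if Y (b : S -> bool) : measurable_fun setT b -> norm_measurable Y ->
  norm_measurable (fun w => if b w then Y w else 0).
Proof.
move=> mb mY x.
rewrite (_ : (fun w => _) = (fun w => if b w then `|Y w - x| else `|0 - x|)); last first.
  by apply/funext => w; case: ifP.
by apply: measurable_fun_ifT; [exact: mb|exact: mY|exact: measurable_cst].
Qed.

(** The norm of Y1 + Y2 - x is the infimum of |Y1 - s| + |Y2 - (x - s)| over s, attained at s = Y1;
    density lets s range over a countable set, so the strict sublevel set is a countable union. *)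
Lemma norm_measurableD Y1 Y2 : separable X -> norm_measurable Y1 -> norm_measurable Y2 ->
  norm_measurable (fun w => Y1 w + Y2 w).
Proof.
move=> [C cC dC] m1 m2 x; apply: measurable_fun_lt_rays => r.
have E w s : (Y1 w - s) + (Y2 w - (x - s)) = Y1 w + Y2 w - x by rewrite opprB addrACA addKr.
have -> : [set w | `|Y1 w + Y2 w - x| < r] =
    \bigcup_(s : C) [set w | `|Y1 w - val s| + `|Y2 w - (x - val s)| < r].
  apply/seteqP; split => w /=.
    move=> h; set e := r - `|Y1 w + Y2 w - x|.
    have e0 : 0 < e / 2 by rewrite divr_gt0// subr_gt0.
    have [|s [Bs Cs]] := dC (ball (Y1 w) (e / 2)) _ (ball_open _ _).
      by exists (Y1 w); exact: ballxx.
    exists (SigSub (mem_set Cs)) => //=.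
    move: Bs; rewrite -ball_normE /= => Bs.
    have -> : Y2 w - (x - s) = (Y1 w + Y2 w - x) - (Y1 w - s).
      by rewrite -(E w s) addrAC subrr add0r.
    apply: le_lt_trans (lerD (lexx _) (ler_normB _ _)) _.
    by rewrite /e in Bs; lra.
  move=> [s _] /=; apply: le_lt_trans.
  by rewrite -(E w (val s)); exact: ler_normD.
apply: countable_bigcupT_measurable => [|s].
  by rewrite (eq_countable (card_setT _)).
rewrite -[X in measurable X]setTI.
apply: (@measurable_fun_ltr _ _ _ setT (fun w => `|Y1 w - val s| + `|Y2 w - (x - val s)|) (cst r)) => //.
by apply: measurable_funD; [exact: m1|exact: m2].
Qed.

End norm_measurable.

Section random_operator.
Context d (S : measurableType d) (R : realType) (X : normedModType R) (m : nat).
Hypothesis sX : separable X.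
Implicit Types B : S -> {linear 'rV[R]_m -> X}.

Definition op_measurable B := forall v, norm_measurable (fun w => B w v).

Lemma op_measurable_sub B B' : op_measurable B -> op_measurable B' ->
  op_measurable (fun w => B w \- B' w).
Proof. by move=> mB mB' v; apply: norm_measurableD => //; exact: norm_measurableN. Qed.

Lemma op_measurable_if (b : S -> bool) B : measurable_fun setT b -> op_measurable B ->
  op_measurable (fun w => if b w then B w else (\0 : {linear 'rV[R]_m -> X})).
Proof.
move=> mb mB v.
rewrite (_ : (fun w => _) = (fun w => if b w then B w v else 0)); last first.
  by apply/funext => w; case: (b w).
exact: norm_measurable_if.
Qed.

Lemma measurable_op_norm (Y : S -> X) B : norm_measurable Y -> op_measurable B ->
  measurable_fun setT (fun z : S * m.-tuple R => `|Y z.1 + B z.1 (row_of_tuple z.2)|).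
Proof.
move=> mY mB; apply: measurable_fun_lipschitz => [x|w] /=.
  by apply: norm_measurable_normr; exact: norm_measurableD.
by have [K _ hK] := lipschitz_linear_norm (B w) (Y w); exists K; exact: hK.
Qed.

Lemma norm_measurable_op B (g : S -> m.-tuple R) : op_measurable B ->
  measurable_fun setT g -> norm_measurable (fun w => B w (row_of_tuple (g w))).
Proof.
move=> mB mg x.
have mx : norm_measurable (fun _ : S => - x) by move=> y; exact: measurable_cst.
have h := measurable_op_norm mx mB.
under eq_fun do rewrite addrC.
have mp : measurable_fun setT (fun w : S => (w, g w)) by exact: measurable_fun_pair.
exact: (measurableT_comp h mp).
Qed.

Lemma measurable_gamma_norm B : op_measurable B ->
  measurable_fun setT (fun w => gamma_norm (B w)).
Proof.
move=> mB.
have m2 : measurable_fun setT (fun z : S * m.-tuple R => (`|B z.1 (row_of_tuple z.2)| ^+ 2)%:E).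
  apply/measurable_EFinP; apply: measurable_funX.
  have := measurable_op_norm (@norm_measurable0 _ S R X) mB.
  by under eq_fun do rewrite add0r.
have := measurable_fun_fubini_tonelli_F (m2 := std_gaussian R m) _ m2
  (fun z => sqr_ge0 _ : (0 <= (_ ^+ 2)%:E)%E).
move=> mF.
have : measurable_fun setT (fun w => gamma_norm (B w) ^+ 2).
  rewrite (_ : (fun w => _) = fun w => fine (fubini_F (std_gaussian R m) (fun z : S * m.-tuple R => (`|B z.1 (row_of_tuple z.2)| ^+ 2)%:E) w)).
    exact: (measurableT_comp (@fine_measurable _ setT measurableT) mF).
  by apply/funext => w; rewrite /fubini_F /= seminorm_second_moment.
move=> mG.
rewrite (_ : (fun w => _) = Num.sqrt \o (fun w => gamma_norm (B w) ^+ 2)); last first.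
  by apply/funext => w /=; rewrite sqrtr_sqr ger0_norm// sqrtr_ge0.
apply: measurableT_comp mG; apply: continuous_measurable_fun; exact: sqrt_continuous.
Qed.

End random_operator.

Lemma measurable_subE (T : pointedType) (F : set (set T)) (A : set T) :
  sigma_algebra setT F -> measurable (A : set (g_sigma_algebraType F)) <-> F A.
Proof. by move=> sF; rewrite /measurable/= sigma_algebra_id. Qed.

(** * Conditioning on a sub-sigma-algebra *)

Section sub_sigma_algebra.
Context d (Omega : measurableType d) (R : realType).
Variables (F : set (set Omega)).
Hypothesis sF : sigma_algebra setT F.
Hypothesis Fm : F `<=` measurable.
Local Notation OF := (g_sigma_algebraType F).

(** The identity viewed as a map onto the coarser measurable space; its law under P is the
    restriction of P to [F]. *)
Definition to_sub : Omega -> OF := id.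

Lemma measurable_to_sub : measurable_fun setT to_sub.
Proof. by move=> _ A /(measurable_subE _ sF) FA; rewrite setTI; exact: Fm. Qed.

HB.instance Definition _ := isMeasurableFun.Build _ _ _ _ to_sub measurable_to_sub.

Lemma measurable_fun_sub d' (U : measurableType d') (f : Omega -> U) :
  measurable_fun setT (f : OF -> U) -> measurable_fun setT f.
Proof. by move=> mf; exact: (measurableT_comp mf measurable_to_sub). Qed.

(** Independence says that the law of (w, g w) on F times the Borel sets agrees with a product
    measure on rectangles, hence everywhere; Tonelli then replaces a conditional expectation given
    [F]. *)
Lemma integral_independent (P : probability Omega R) m (g : Omega -> m.-tuple R)
    (h : OF * m.-tuple R -> \bar R) :
  measurable_fun setT g -> std_gaussian_vector P g -> independent_of P F g ->
  measurable_fun setT h -> (forall z, 0 <= h z)%E ->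
  (\int[P]_w h (w, g w) = \int[P]_w \int[std_gaussian R m]_x h (w, x))%E.
Proof.
move=> mg gg ig mh h0.
pose J (w : Omega) : OF * m.-tuple R := (to_sub w, g w).
have mJ : measurable_fun setT J.
  by apply: measurable_fun_pair => //; exact: measurable_to_sub.
pose PF := distribution P to_sub.
transitivity (\int[pushforward P J]_z h z)%E.
  by rewrite ge0_integral_pushforward.
transitivity (\int[(PF \x std_gaussian R m)%E]_z h z)%E.
  apply: eq_measure_integral => A mA _; apply/esym.
  apply: product_measure_unique => // B C mB mC.
  rewrite /pushforward /= -(gg C mC) -ig//; exact/(measurable_subE _ sF).
rewrite fubini_tonelli1// ge0_integral_distribution//.
- exact: measurable_fun_fubini_tonelli_F.
- by move=> y; exact: integral_ge0.
Qed.

End sub_sigma_algebra.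

Section sub_sigma_algebra_mono.
Context d (Omega : measurableType d) (F F' : set (set Omega)).
Hypotheses (sF : sigma_algebra setT F) (sF' : sigma_algebra setT F') (FF' : F `<=` F').

Lemma measurable_fun_subS d' (U : measurableType d') (f : Omega -> U) :
  measurable_fun setT (f : g_sigma_algebraType F -> U) ->
  measurable_fun setT (f : g_sigma_algebraType F' -> U).
Proof.
move=> mf _ A mA; have := mf measurableT A mA.
by rewrite !setTI => /(measurable_subE _ sF) FA; apply/(measurable_subE _ sF'); exact: FF'.
Qed.

End sub_sigma_algebra_mono.

Lemma adapted_op_measurable (Omega : pointedType) (R : realType) (X : normedModType R)
    (F : set (set Omega)) m (A : Omega -> {linear 'rV[R]_m -> X}) :
  sigma_algebra setT F -> adapted_operator F A ->
  op_measurable (A : g_sigma_algebraType F -> _).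
Proof.
move=> sF aA v x; apply: measurable_fun_lt_rays => r.
apply/(measurable_subE _ sF).
suff bB : borel [set y : X | `|y - x| < r] by exact: (aA v _ bB).
apply: sub_sigma_algebra.
rewrite (_ : [set y | _] = ball x r); first exact: ball_open.
by apply/seteqP; split => y /=; rewrite -ball_normE /= distrC.
Qed.

Section one_step_degenerate.
Context (R : realType) (X : normedModType R) (D : R).
Hypotheses (D1 : 1 <= D) (XD : smooth2 X D).

(** The one-step bound takes a positive b above the gamma norm. When that norm is 0, the bound holds
    for every small b, and the claim is its limit as t = (24 b)^2 tends to 0. *)
Lemma smooth_gaussian_step_gamma m (A : {linear 'rV[R]_m -> X}) (a : R) (x : X) :
  0 <= a -> 4 * (a * D ^+ 2 * (24 * gamma_norm A) ^+ 2) <= 1 ->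
  (\int[std_gaussian R m]_y (expR (a * `|x + A (row_of_tuple y)| ^+ 2))%:E <=
   (expR (a * `|x| ^+ 2 + (24 * gamma_norm A) ^+ 2 *
     (2 * a * D ^+ 2 + 136 * a ^+ 2 * D ^+ 2 * `|x| ^+ 2)))%:E)%E.
Proof.
move=> a0 ab.
have g0 : 0 <= gamma_norm A by exact: sqrtr_ge0.
have [gt0|] := ltP 0 (gamma_norm A); first exact: smooth_gaussian_step.
move=> gle; have gE : gamma_norm A = 0 by apply/eqP; rewrite eq_le gle g0.
rewrite gE mulr0 expr0n /= mul0r addr0.
set I := integral _ _ _; set u := a * _; set k := 2 * a * D ^+ 2 + 136 * a ^+ 2 * D ^+ 2 * `|x| ^+ 2.
have aD2 : 0 <= a * D ^+ 2 by rewrite mulr_ge0// sqr_ge0.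
have k0 : 0 <= k.
  rewrite /k (_ : _ + _ = 2 * (a * D ^+ 2) + 136 * (a * D ^+ 2 * a * `|x| ^+ 2)); last by ring.
  apply: addr_ge0; apply: mulr_ge0 => //; apply: mulr_ge0; last exact: sqr_ge0.
  exact: mulr_ge0.
have aD : 0 <= 4 * (a * D ^+ 2) by rewrite mulr_ge0.
have H t : 0 < t -> t * (4 * (a * D ^+ 2)) <= 1 -> (I <= (expR (u + t * k))%:E)%E.
  move=> t0 ht.
  have -> : t = (24 * (Num.sqrt t / 24)) ^+ 2.
    by rewrite mulrC divfK// sqr_sqrtr// ltW.
  apply: smooth_gaussian_step => //.
  - by rewrite divr_gt0// sqrtr_gt0.
  - by rewrite gE divr_ge0// sqrtr_ge0.
  - by rewrite [24 * _]mulrC divfK// sqr_sqrtr ?(ltW t0)//; lra.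
move: (4 * (a * D ^+ 2)) aD H => q q0 H.
have q1 : 0 < 1 + q by rewrite ltr_wpDr.
have qV : (1 + q)^-1 * q <= 1 by rewrite mulrC ler_pdivrMr// mul1r lerDr.
have I0 : (0 <= I)%E by apply: integral_ge0 => y _; rewrite lee_fin expR_ge0.
have If : I \is a fin_num.
  rewrite ge0_fin_numE//; apply: (le_lt_trans (H (1 + q)^-1 _ _)) => //.
  - by rewrite invr_gt0.
  - exact: ltry.
rewrite -(fineK If) in H *; set r := fine I in H *.
rewrite lee_fin leNgt; apply/negP => ur.
have r0 : 0 < r by exact: lt_trans (expR_gt0 _) ur.
have du : 0 < ln r - u by rewrite subr_gt0 -ltr_expR lnK.
(* The first bound meets the smallness condition of the step; the second keeps u + t k strictly
   below ln r, contradicting r <= exp (u + t k). *)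
pose t := Num.min (1 + q)^-1 ((ln r - u) / (2 * (k + 1))).
have t0 : 0 < t by rewrite lt_min invr_gt0 q1 divr_gt0//; lra.
have tk : t * k < ln r - u.
  apply: (@le_lt_trans _ _ ((ln r - u) / (2 * (k + 1)) * k)).
    by rewrite ler_wpM2r// ge_min lexx orbT.
  rewrite mulrAC ltr_pdivrMr; last by lra.
  by rewrite ltr_pM2l//; lra.
have tq : t * q <= 1.
  by apply: le_trans qV; rewrite ler_wpM2r// ge_min lexx.
have := H t t0 tq; rewrite lee_fin.
apply/negP; rewrite -ltNge -[ltRHS](lnK r0) ltr_expR; lra.
Qed.

End one_step_degenerate.

(** * The supermartingale and its maximal inequality *)

Section exponential_supermartingale.
Context (R : realType) (X : normedModType R) (D : R).
Hypotheses (D1 : 1 <= D) (XD : smooth2 X D) (sX : separable X).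
Context d (Omega : measurableType d) (P : probability Omega R) (N : nat)
  (F : nat -> set (set Omega)) (m : nat -> nat)
  (g : forall i, Omega -> (m i).-tuple R)
  (B : forall i, Omega -> {linear 'rV[R]_(m i) -> X}) (s : R).
Hypothesis filF : is_filtration N F.
Hypothesis hg : forall i, (1 <= i <= N)%N ->
  [/\ std_gaussian_vector P (g i), independent_of P (F i.-1) (g i) &
      adapted_vector (F i) (g i)].
Hypothesis hB : forall i, (1 <= i <= N)%N ->
  op_measurable (B i : g_sigma_algebraType (F i.-1) -> _).
Hypothesis s0 : 0 < s.
Hypothesis hV : forall w, \sum_(1 <= i < N.+1) gamma_norm (B i w) ^+ 2 <= s ^+ 2.

Let M (j : nat) (w : Omega) : X := \sum_(1 <= i < j.+1) B i w (row_of_tuple (g i w)).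
Let c (i : nat) (w : Omega) : R := (24 * gamma_norm (B i w)) ^+ 2.
Let C (j : nat) (w : Omega) : R := \sum_(1 <= i < j.+1) c i w.
Let sg : R := (24 * s) ^+ 2.
Let h (j : nat) (w : Omega) : R := 136 * D ^+ 2 * (sg + C j w).
(* Conditioning on F_j multiplies |M_j|^2 / h_(j+1) by 1 + O(D^2 c / h) and adds
   O(D^2 c / h): the growth of [h] absorbs the former and the drift [C] the latter,
   so that [Z] is a supermartingale. *)
Let Z (j : nat) (w : Omega) : R := expR (`|M j w| ^+ 2 / h j w - C j w / (68 * sg)).
(** The value 1 at index 0 is that of [Z 0], and it keeps the running maximum away from 0. *)
Fixpoint running_max (f : nat -> Omega -> R) (j : nat) (w : Omega) : R :=
  if j is k.+1 then Num.max (running_max f k w) (f k.+1 w) else 1.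
Let ZS := running_max Z.
(* A pathwise Doob inequality: [Q] inherits the supermartingale property of [Z]
   because [a + z / a >= 2 sqrt z], so its mean stays below [Q 0 = 2]. *)
Let Q (j : nat) (w : Omega) : R := Num.sqrt (ZS j w) + Z j w / Num.sqrt (ZS j w).

Let sF j : (j <= N)%N -> sigma_algebra setT (F j). Proof. by case: filF => h1 _ _; exact: h1. Qed.
Let Fm j : (j <= N)%N -> F j `<=` measurable. Proof. by case: filF => _ h1 _; exact: h1. Qed.
Let FS j : (j < N)%N -> F j `<=` F j.+1.
Proof. by case: filF => _ _ h1 jN; apply: h1; rewrite leqnSn. Qed.

Let M0 w : M 0 w = 0. Proof. by rewrite /M big_geq. Qed.
Let MS j w : M j.+1 w = M j w + B j.+1 w (row_of_tuple (g j.+1 w)).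
Proof. by rewrite /M big_nat_recr. Qed.
Let C0 w : C 0 w = 0. Proof. by rewrite /C big_geq. Qed.
Let CS j w : C j.+1 w = C j w + c j.+1 w. Proof. by rewrite /C big_nat_recr. Qed.
Let c_ge0 i w : 0 <= c i w. Proof. exact: sqr_ge0. Qed.
Let C_ge0 j w : 0 <= C j w. Proof. by apply: sumr_ge0 => i _. Qed.
Let sg_gt0 : 0 < sg. Proof. by rewrite exprn_gt0// mulr_gt0. Qed.
Let DD : 1 <= D ^+ 2. Proof. exact: exprn_ege1. Qed.
Let h_gt0 j w : 0 < h j w.
Proof.
apply: mulr_gt0; first by have := DD; lra.
by have := sg_gt0; have := C_ge0 j w; lra.
Qed.
Let ZS_ge1 j w : 1 <= ZS j w.
Proof. by elim: j => //= j IH; rewrite le_max IH. Qed.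
Let sZS_ge1 j w : 1 <= Num.sqrt (ZS j w).
Proof. by rewrite -[leLHS]sqrtr1 ler_wsqrtr. Qed.

Let mg j : (j < N)%N -> measurable_fun setT (g j.+1 : g_sigma_algebraType (F j.+1) -> _).
Proof.
move=> jN _ A mA; rewrite setTI; apply/(measurable_subE _ (sF jN)).
by have [_ _ h1] := hg (i := j.+1) jN; exact: h1.
Qed.

Let mM j : (j <= N)%N -> norm_measurable (M j : g_sigma_algebraType (F j) -> X).
Proof.
elim: j => [|j IH] jN.
  by move=> x; under eq_fun do rewrite M0; exact: measurable_cst.
rewrite (_ : M j.+1 = fun w => M j w + B j.+1 w (row_of_tuple (g j.+1 w))); last first.
  by apply/funext => w; rewrite MS.
apply: norm_measurableD => //.
  move=> x; apply: (measurable_fun_subS (sF (ltnW jN)) (sF jN) (FS jN)).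
  exact: IH (ltnW jN) x.
apply: norm_measurable_op => //; last exact: mg.
move=> v x; apply: (measurable_fun_subS (sF (ltnW jN)) (sF jN) (FS jN)).
exact: (hB (i := j.+1) jN).
Qed.

Let mc j : (j < N)%N -> measurable_fun setT (c j.+1 : g_sigma_algebraType (F j) -> R).
Proof.
move=> jN; apply: measurable_funX; apply: measurable_funM => //.
by apply: measurable_gamma_norm => //; exact: (hB (i := j.+1) jN).
Qed.

Let mC j : (j < N)%N -> measurable_fun setT (C j.+1 : g_sigma_algebraType (F j) -> R).
Proof.
elim: j => [|j IH] jN.
  rewrite (_ : C 1 = c 1%N); first exact: mc.
  by apply/funext => w; rewrite CS C0 add0r.
rewrite (_ : C j.+2 = fun w => C j.+1 w + c j.+2 w); last by apply/funext => w; rewrite CS.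
apply: measurable_funD; last exact: mc.
apply: (measurable_fun_subS (sF (ltnW (ltnW jN))) (sF (ltnW jN)) (FS (ltnW jN))).
exact: IH (ltnW jN).
Qed.

Let mC' j : (j <= N)%N -> measurable_fun setT (C j : g_sigma_algebraType (F j) -> R).
Proof.
case: j => [|j] jN.
  by rewrite (_ : C 0 = cst 0)//; apply/funext => w; rewrite C0.
exact: (measurable_fun_subS (sF (ltnW jN)) (sF jN) (FS jN) (mC jN)).
Qed.

Lemma measurable_funV d' (T : measurableType d') (f : T -> R) :
  measurable_fun setT f -> (forall w, 0 < f w) -> measurable_fun setT (fun w => (f w)^-1).
Proof.
move=> mf f0; rewrite (_ : (fun w => _) = (fun w => f w `^ (-1))).
  exact: (measurableT_comp (measurable_powR (-1)) mf).
by apply/funext => w; rewrite powR_inv1// ltW.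
Qed.

Let mZ j : (j <= N)%N -> measurable_fun setT (Z j : g_sigma_algebraType (F j) -> R).
Proof.
move=> jN; apply: measurableT_comp => //; apply: measurable_funB; apply: measurable_funM => //.
- by apply: measurable_funX; apply: norm_measurable_normr; exact: mM.
- apply: measurable_funV => //; apply: measurable_funM => //; apply: measurable_funD => //.
  exact: mC'.
- exact: mC'.
Qed.

Let mZS j : (j <= N)%N -> measurable_fun setT (ZS j : g_sigma_algebraType (F j) -> R).
Proof.
elim: j => [|j IH] jN; first exact: measurable_cst.
apply: measurable_maxr; last exact: mZ.
exact: (measurable_fun_subS (sF (ltnW jN)) (sF jN) (FS jN) (IH (ltnW jN))).
Qed.

Let msZS j : (j <= N)%N ->
  measurable_fun setT (fun w : g_sigma_algebraType (F j) => Num.sqrt (ZS j w)).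
Proof.
move=> jN; apply: measurableT_comp (mZS jN).
apply: continuous_measurable_fun; exact: sqrt_continuous.
Qed.

Let mQ j : (j <= N)%N -> measurable_fun setT (Q j : g_sigma_algebraType (F j) -> R).
Proof.
move=> jN; apply: measurable_funD; first exact: msZS.
apply: measurable_funM; first exact: mZ.
apply: measurable_funV; first exact: msZS.
by move=> w; exact: lt_le_trans (sZS_ge1 _ _).
Qed.

Let Q_ge0 j w : 0 <= Q j w.
Proof. by rewrite addr_ge0 ?sqrtr_ge0// divr_ge0 ?sqrtr_ge0// expR_ge0. Qed.

Let Q_step j w : Q j.+1 w <= Num.sqrt (ZS j w) + Z j.+1 w / Num.sqrt (ZS j w).
Proof.
rewrite /Q /ZS /= -/(ZS j w) /Order.max; case: ifPn => // lt.
have z0 : 0 < Z j.+1 w by exact: expR_gt0.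
have S1 := sZS_ge1 j w; set a := Num.sqrt (ZS j w) in S1 *.
have sz : Num.sqrt (Z j.+1 w) ^+ 2 = Z j.+1 w by rewrite sqr_sqrtr// ltW.
have sz0 : 0 < Num.sqrt (Z j.+1 w) by rewrite sqrtr_gt0.
rewrite -[in Z j.+1 w / a]sz -[X in _ + X / _ <= _]sz.
move: (Num.sqrt (Z j.+1 w)) sz0 => b b0.
rewrite expr2 mulfK ?gt_eqF//.
rewrite -subr_ge0 (_ : _ - _ = (a - b) ^+ 2 / a); last by field; rewrite gt_eqF//; lra.
by rewrite divr_ge0 ?sqr_ge0//; lra.
Qed.

(** The constant in [h] is the one of the one-step bound, so that 136 D^2 c is exactly h_(j+1) - h_j
    and the main term reads 1/h_(j+1) + (h_(j+1) - h_j) / h_(j+1)^2 <= 1/h_j. The rest, 2 D^2 c /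
    h_(j+1), is at most c / (68 sg) because h_(j+1) >= 136 D^2 sg. *)
Let exponent_step j w :
  (h j.+1 w)^-1 * `|M j w| ^+ 2 + c j.+1 w * (2 * (h j.+1 w)^-1 * D ^+ 2 +
    136 * (h j.+1 w)^-1 ^+ 2 * D ^+ 2 * `|M j w| ^+ 2) - C j.+1 w / (68 * sg) <=
  `|M j w| ^+ 2 / h j w - C j w / (68 * sg).
Proof.
have hS : h j.+1 w = h j w + 136 * D ^+ 2 * c j.+1 w.
  by rewrite /h CS; ring.
have hp := h_gt0 j w; have hp1 := h_gt0 j.+1 w.
have h136 : 136 * D ^+ 2 * sg <= h j.+1 w.
  by rewrite /h ler_wpM2l ?lerDl//; have := DD; lra.
rewrite CS; have cg := c_ge0 j.+1 w; have x0 : 0 <= `|M j w| ^+ 2 by exact: sqr_ge0.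
move: (`|M j w| ^+ 2) (C j w) (c j.+1 w) (h j w) (h j.+1 w) hS hp hp1 h136 cg x0 => x C' c' h1 h2.
move=> hS hp hp1 h136 cg x0.
have D0 : D != 0 by rewrite gt_eqF//; apply: lt_le_trans D1.
have e1 : h2^-1 * x + c' * (136 * h2^-1 ^+ 2 * D ^+ 2 * x) <= x / h1.
  rewrite -subr_ge0.
  have -> : x / h1 - (h2^-1 * x + c' * (136 * h2^-1 ^+ 2 * D ^+ 2 * x)) =
     x * (h2 - h1) ^+ 2 / (h1 * h2 ^+ 2).
    have -> : c' = (h2 - h1) / (136 * D ^+ 2) by rewrite hS; field.
    by field; rewrite D0 !gt_eqF.
  by apply: divr_ge0; apply: mulr_ge0 => //; first [exact: sqr_ge0|exact: ltW].
have e2 : c' * (2 * h2^-1 * D ^+ 2) <= c' / (68 * sg).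
  rewrite ler_wpM2l//.
  rewrite (_ : 2 * h2^-1 * D ^+ 2 = (2 * D ^+ 2) / h2); last by ring.
  rewrite ler_pdivrMr// [leRHS]mulrC ler_pdivlMr ?mulr_gt0//.
  by apply: le_trans h136; lra.
by rewrite [c' * (_ + _)]mulrDr [(C' + c') / _]mulrDl; lra.
Qed.

(** Given F_j, everything in the bound of [Q_step] except the Gaussian g_(j+1) is frozen, including
    h_(j+1) and C_(j+1), since the operator B_(j+1) is predictable. *)
Let integral_Q_step j : (j < N)%N -> (\int[P]_w (Q j.+1 w)%:E <= \int[P]_w (Q j w)%:E)%E.
Proof.
move=> jN.
have [gg ig ag] := hg (i := j.+1) jN.
pose E (z : g_sigma_algebraType (F j) * (m j.+1).-tuple R) : R :=
  expR ((h j.+1 z.1)^-1 * `|M j z.1 + B j.+1 z.1 (row_of_tuple z.2)| ^+ 2).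
pose K (w : g_sigma_algebraType (F j)) : R :=
  expR (- (C j.+1 w / (68 * sg))) / Num.sqrt (ZS j w).
pose H (z : g_sigma_algebraType (F j) * (m j.+1).-tuple R) : \bar R :=
  (Num.sqrt (ZS j z.1) + K z.1 * E z)%:E.
have K0 w : 0 <= K w by rewrite divr_ge0 ?expR_ge0 ?sqrtr_ge0.
have mh : measurable_fun setT (fun w : g_sigma_algebraType (F j) => (h j.+1 w)^-1).
  apply: measurable_funV => //; apply: measurable_funM => //; apply: measurable_funD => //.
  exact: mC.
have mE : measurable_fun setT E.
  apply: measurableT_comp => //; apply: measurable_funM.
    exact: (measurableT_comp mh measurable_fst).
  apply: measurable_funX; apply: measurable_op_norm => //; first exact: mM (ltnW jN).
  exact: (hB (i := j.+1) jN).
have mK : measurable_fun setT K.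
  apply: measurable_funM.
    apply: measurableT_comp => //; apply: measurable_funN; apply: measurable_funM => //.
    exact: mC.
  apply: measurable_funV; first exact: msZS (ltnW jN).
  by move=> w; exact: lt_le_trans (sZS_ge1 _ _).
have mH : measurable_fun setT H.
  apply/measurable_EFinP; apply: measurable_funD.
    exact: (measurableT_comp (msZS (ltnW jN)) measurable_fst).
  apply: measurable_funM => //; exact: (measurableT_comp mK measurable_fst).
have H0 z : (0 <= H z)%E by rewrite lee_fin addr_ge0 ?sqrtr_ge0// mulr_ge0// expR_ge0.
apply: (@le_trans _ _ (\int[P]_w H (w, g j.+1 w))%E).
  apply: ge0_integral_mono => w; rewrite lee_fin//.
  apply: le_trans (Q_step _ _) _; rewrite lerD2l /K /E /Z MS /=.
  rewrite [leRHS]mulrAC -expRD.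
  by rewrite [X in _ <= expR X / _](_ : _ = `|M j w + B j.+1 w (row_of_tuple (g j.+1 w))| ^+ 2 / h j.+1 w - C j.+1 w / (68 * sg)); last by ring.
have mgj : measurable_fun setT (g j.+1).
  by apply: (measurable_fun_sub (sF jN) (Fm jN)); exact: mg.
rewrite (integral_independent (sF (ltnW jN)) (Fm (ltnW jN)) mgj gg ig mH H0).
apply: ge0_integral_mono => w; first by apply: integral_ge0 => x _; exact: H0.
rewrite /H /=.
have mEw : measurable_fun setT (fun x => (E (w, x))%:E).
  by apply/measurable_EFinP; apply: (measurableT_comp mE); exact: measurable_pair1.
have Ew0 x : (0 <= (E (w, x))%:E)%E by rewrite lee_fin expR_ge0.
under eq_integral do rewrite EFinD EFinM.
rewrite ge0_integralD//; last 2 first.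
- by move=> x _; rewrite mule_ge0// lee_fin.
- exact: emeasurable_funM.
rewrite (_ : (fun=> (Num.sqrt (ZS j w))%:E) = cst (Num.sqrt (ZS j w))%:E)//.
rewrite integral_cst// [X in (_ * X)%E]probability_setT mule1.
rewrite ge0_integralZl_EFin// EFinD leeD2l//.
have step := @smooth_gaussian_step_gamma R X D D1 XD _ (B j.+1 w) (h j.+1 w)^-1 (M j w).
apply: (@le_trans _ _ ((K w)%:E * (expR ((h j.+1 w)^-1 * `|M j w| ^+ 2 + c j.+1 w *
   (2 * (h j.+1 w)^-1 * D ^+ 2 + 136 * (h j.+1 w)^-1 ^+ 2 * D ^+ 2 * `|M j w| ^+ 2)))%:E)%E).
  rewrite lee_wpmul2l ?lee_fin//; apply: step; first by rewrite invr_ge0 ltW.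
  (* The smallness condition holds with room to spare: h_(j+1) already contains 136 D^2 c_(j+1). *)
  rewrite -/(c j.+1 w) [_^-1 * _]mulrC -mulrA [_^-1 * _]mulrC mulrA mulrA ler_pdivrMr// mul1r.
  rewrite /h CS.
  have := mulr_ge0 (le_trans ler01 DD) (c_ge0 j.+1 w).
  have := mulr_ge0 (le_trans ler01 DD) (C_ge0 j w).
  have := mulr_ge0 (le_trans ler01 DD) (ltW sg_gt0).
  lra.
rewrite -EFinM lee_fin /K mulrAC -expRD ler_wpM2r ?invr_ge0 ?sqrtr_ge0//.
by rewrite ler_expR addrC; exact: exponent_step.
Qed.

(** The event [G] yields the factor P G, without which the sum over levels would diverge. The
    exponent is read off from sqrt Z, because [Q] dominates the root of the running maximum: 544 = 2
    * 272 joins the halving of the exponent with h <= 136 D^2 * 2 sg. *)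
Lemma exponential_maximal_inequality (G : set Omega) : measurable G ->
  (forall i w, (1 <= i <= N)%N -> ~ G w -> forall v, B i w v = 0) ->
  (\int[P]_w (\1_G w * expR ((\big[Num.max/0]_(0 <= j < N.+1)
     `|\sum_(1 <= i < j.+1) B i w (row_of_tuple (g i w))|) ^+ 2 /
       (544 * D ^+ 2 * (24 * s) ^+ 2)))%:E <= 4%:E * P G)%E.
Proof.
move=> mG BG.
have [K KE] : exists K, K = 544 * D ^+ 2 * (24 * s) ^+ 2 by eexists.
rewrite -KE.
have Ksg : 0 < K.
  by rewrite KE; apply: mulr_gt0; last exact: sg_gt0; have := DD; lra.
have hK j w : C j w <= sg -> 2 * h j w <= K.
  move=> Csg; rewrite KE /h -/sg (_ : 544 * D ^+ 2 * sg = 2 * (136 * D ^+ 2 * (sg + sg))); last by ring.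
  by rewrite ler_wpM2l// ler_wpM2l ?lerD2l//; have := DD; lra.
clear KE.
have Qle j : (j <= N)%N -> (\int[P]_w (Q j w)%:E <= 2%:E)%E.
  elim: j => [|j IH] jN; last by apply: le_trans (integral_Q_step jN) (IH (ltnW jN)).
  rewrite (_ : (fun w => _) = cst 2%:E); last first.
    apply/funext => w; rewrite /Q /ZS /Z /= M0 C0 normr0 expr0n /= !mul0r subr0 expR0 sqrtr1 divr1.
    by congr EFin; ring.
  by rewrite integral_cst// [X in (_ * X)%E]probability_setT mule1.
(* Outside [G] nothing moves and [Q] keeps its initial value 2, so subtracting this part from E Q <=
   2 leaves 2 P G for the integral over [G]. *)
have QG w : ~ G w -> Q N w = 2.
  move=> Gw.
  have gB i : (1 <= i <= N)%N -> gamma_norm (B i w) = 0.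
    move=> iN; apply/eqP; rewrite -sqrf_eq0 -eqe -seminorm_second_moment.
    rewrite integral0_eq// => x _; rewrite (BG i w iN Gw) normr0 expr0n//.
  have Z1 j : (j <= N)%N -> Z j w = 1.
    move=> jN; rewrite /Z.
    have -> : M j w = 0.
      rewrite /M big_nat_cond big1// => i /andP[/andP[i1 ij] _].
      by apply: BG => //; rewrite i1 (leq_trans _ jN).
    have -> : C j w = 0.
      rewrite /C big_nat_cond big1// => i /andP[/andP[i1 ij] _].
      by rewrite /c gB ?mulr0 ?expr0n// i1 (leq_trans _ jN).
    by rewrite normr0 expr0n /= !mul0r subr0 expR0.
  have ZS1 j : (j <= N)%N -> ZS j w = 1.
    elim: j => // j IH jN; rewrite /ZS /= -/(ZS j w) IH ?(ltnW jN)// Z1//.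
    by rewrite maxxx.
  by rewrite /Q ZS1// Z1// sqrtr1 divr1; ring.
have Qm : measurable_fun setT (fun w => (Q N w)%:E).
  by apply/measurable_EFinP; apply: (measurable_fun_sub (sF (leqnn N)) (Fm (leqnn N))); exact: mQ.
have mi : measurable_fun setT (fun w => (\1_G w * Q N w)%:E).
  apply/measurable_EFinP; apply: measurable_funM; first exact: measurable_indic.
  by apply/measurable_EFinP.
have QG2 : (\int[P]_w (\1_G w * Q N w)%:E <= 2%:E * P G)%E.
  have := Qle N (leqnn N).
  rewrite (_ : (fun w => (Q N w)%:E) =
      fun w => ((\1_G w * Q N w)%:E + (2%:E * (\1_(~` G) w)%:E))%E); last first.
    apply/funext => w; rewrite !indicE in_setC.
    case: (boolP (w \in G)) => wG /=; first by rewrite mul1r mule0 adde0.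
    by rewrite mul0r mule1 add0e QG//; move/negP: wG; apply: contra_not => /mem_set.
  rewrite ge0_integralD//; last 2 first.
  - by move=> w _; rewrite lee_fin mulr_ge0.
  - by apply: emeasurable_funM => //; apply/measurable_EFinP; exact: measurable_indic (measurableC mG).
  rewrite ge0_integralZl_EFin//; last first.
    by apply/measurable_EFinP; exact: measurable_indic (measurableC mG).
  rewrite integral_indic//; last exact: measurableC.
  have PC : (P (~` G) = 1 - P G)%E by exact: probability_setC.
  rewrite setIT [X in (_ + _ * X)%E]PC.
  have [pG pGE] : exists p, P G = p%:E by exists (fine (P G)); rewrite fineK// fin_num_measure.
  rewrite pGE -EFinB -!EFinM.
  case: (integral _ _ _) => [r| |].
  - by rewrite -EFinD !lee_fin; lra.
  - by rewrite addye// leye_eq.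
  - by move=> _; rewrite leNye.
apply: (@le_trans _ _ (2%:E * \int[P]_w (\1_G w * Q N w)%:E)%E); last first.
  rewrite (_ : 4%:E = 2%:E * 2%:E)%E -?muleA; last by rewrite -EFinM; congr EFin; ring.
  exact: lee_wpmul2l.
rewrite -ge0_integralZl_EFin//; last by move=> w _; rewrite lee_fin mulr_ge0.
apply: ge0_integral_mono => w; first by rewrite lee_fin mulr_ge0// expR_ge0.
rewrite -EFinM lee_fin [leRHS]mulrCA ler_wpM2l//.
have S1 := sZS_ge1 N w.
apply: (@le_trans _ _ (2 * Num.sqrt (ZS N w))); last first.
  by rewrite ler_wpM2l// lerDl divr_ge0 ?sqrtr_ge0// expR_ge0.
have S2 : 0 < 2 * Num.sqrt (ZS N w) by lra.
suff mx : \big[Num.max/0]_(0 <= j < N.+1) `|M j w| <= Num.sqrt (K * ln (2 * Num.sqrt (ZS N w))).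
  rewrite -[leRHS]lnK// ler_expR ler_pdivrMr// [leRHS]mulrC.
  rewrite -[leRHS]sqr_sqrtr; last by rewrite mulr_ge0 ?(ltW Ksg)// ln_ge0; lra.
  rewrite ler_sqr ?nnegrE ?sqrtr_ge0//.
  by apply: bigmax_ge_id.
rewrite big_mkord; apply: bigmax_le; first exact: sqrtr_ge0.
move=> [j /= jN'] _; have jN : (j <= N)%N by [].
rewrite -[leLHS]ger0_norm// -sqrtr_sqr ler_wsqrtr// mulrC -ler_pdivrMr// -ler_expR lnK//.
have ZZ : Z j w <= ZS N w.
  elim: {Qm mi QG2 Qle QG S1 S2 jN'} N jN => [|n IH]; first by rewrite leqn0 => /eqP ->; rewrite /Z /= M0 C0 normr0 expr0n /= !mul0r subr0 expR0.
  rewrite leq_eqVlt => /orP[/eqP ->|]; first by rewrite /ZS /= le_max lexx orbT.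
  by rewrite ltnS => /IH h1; rewrite /ZS /= le_max h1.
apply: (@le_trans _ _ (2 * Num.sqrt (Z j w))); last by rewrite ler_wpM2l// ler_wsqrtr.
have Csg : C j w <= sg.
  rewrite /sg exprMn; apply: le_trans (ler_wpM2l (sqr_ge0 _) (hV w)).
  rewrite mulr_sumr /C (@big_cat_nat _ _ _ j.+1 1 N.+1)//=.
  under eq_bigr do rewrite /c exprMn.
  by rewrite lerDl sumr_ge0// => i _; rewrite mulr_ge0 ?sqr_ge0.
have hle := hK j w Csg.
have hp := h_gt0 j w.
have -> : Num.sqrt (Z j w) = expR (`|M j w| ^+ 2 / (2 * h j w) - C j w / (136 * sg)).
  rewrite -[RHS]ger0_norm ?expR_ge0// -sqrtr_sqr; congr Num.sqrt.
  rewrite /Z -expRM_natl; congr expR.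
  by field; rewrite !gt_eqF.
(* Since C <= sg, the drift under the root is at most 1/136; restoring it costs no more than the
   spare factor 2. *)
apply: (@le_trans _ _ (expR (C j w / (136 * sg)) * expR (`|M j w| ^+ 2 / (2 * h j w) - C j w / (136 * sg)))).
  rewrite -expRD ler_expR addrC subrK.
  by rewrite ler_wpM2l ?sqr_ge0// lef_pV2 ?posrE// mulr_gt0.
rewrite ler_wpM2r ?expR_ge0//; apply: expR_le2.
by rewrite ler_pdivrMr ?mulr_gt0//; have := sg_gt0; lra.
Qed.

End exponential_supermartingale.

(** * Chaining *)

Lemma ler_addgt0_inv (R : realType) (x b c : R) :
  (forall n, x <= b + c / n.+1%:R) -> x <= b.
Proof.
move=> h; rewrite leNgt; apply/negP => bx.
have e0 : 0 < x - b by rewrite subr_gt0.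
pose n := Num.bound (`|c| / (x - b)).
have := archi_boundP (_ : 0 <= `|c| / (x - b)); rewrite -/n => /(_ _)/wrap[].
  by rewrite divr_ge0// ltW.
rewrite ltr_pdivrMr// => cn.
have n0 : (0 : R) < n.+1%:R by rewrite ltr0n.
have := h n; rewrite -lerBlDl ler_pdivlMr// => h1.
have := ler_norm c.
have : n%:R * (x - b) <= n.+1%:R * (x - b) by rewrite ler_wpM2r ?ler_nat// ltW.
lra.
Qed.

Lemma exp2_ge_sqr n : (n.+1 ^ 2 <= 4 * 2 ^ n)%N.
Proof.
elim: n => // -[|[|n]] IH //; rewrite (expnS 2 n.+2).
apply: (@leq_trans (2 * n.+3 ^ 2)); last by rewrite mulnCA leq_mul2l IH orbT.
rewrite -!mulnn !mulSn !mulnS; lia.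
Qed.

Section chaining.
Context (R : realType) (X : normedModType R) (T : finType) (mu : T -> R).
Hypothesis mu0 : forall t, 0 < mu t.

Definition average (A : pred T) (f : T -> X) : X :=
  (\sum_(u | A u) mu u)^-1 *: \sum_(u | A u) mu u *: f u.

(* Jensen's inequality for [exp (y^2)], by the tangent line of [exp] at [l^2]
   and AM-GM. *)
Lemma average_dist (A B : pred T) (f : T -> X) (c l : R) :
  0 < c -> 0 < l -> 0 < \sum_(u | A u) mu u -> 0 < \sum_(v | B v) mu v ->
  \sum_(u | A u) \sum_(v | B v) mu u * mu v * expR ((`|f u - f v| / c) ^+ 2) <=
    (\sum_(u | A u) mu u) * (\sum_(v | B v) mu v) * expR (l ^+ 2) ->
  `|average A f - average B f| <= c * l.
Proof.
move=> c0 l0; set a := \sum_(u | A u) mu u; set b := \sum_(v | B v) mu v => a0 b0 hE.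
have ab0 : 0 < a * b by rewrite mulr_gt0.
have mm u v : 0 <= mu u * mu v by rewrite mulr_ge0// ltW.
pose y u v := `|f u - f v| / c.
have y0 u v : 0 <= y u v by rewrite divr_ge0// ltW.
have abE : \sum_(u | A u) \sum_(v | B v) mu u * mu v = a * b.
  by rewrite mulr_suml; apply: eq_bigr => u _; rewrite mulr_sumr.
have hsq : \sum_(u | A u) \sum_(v | B v) mu u * mu v * (y u v) ^+ 2 <= a * b * l ^+ 2.
  have : \sum_(u | A u) \sum_(v | B v) mu u * mu v * (1 + (y u v ^+ 2 - l ^+ 2)) <= a * b.
    rewrite -(ler_pM2r (expR_gt0 (l ^+ 2))); apply: le_trans hE.
    rewrite mulr_suml; apply: ler_sum => u _; rewrite mulr_suml; apply: ler_sum => v _.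
    rewrite -[leLHS]mulrA; apply: (ler_wpM2l (mm u v)).
    apply: le_trans (ler_wpM2r (expR_ge0 _) (expR_ge1Dx _)) _.
    by rewrite -expRD subrK.
  have -> : \sum_(u | A u) \sum_(v | B v) mu u * mu v * (1 + (y u v ^+ 2 - l ^+ 2)) =
      a * b * (1 - l ^+ 2) + \sum_(u | A u) \sum_(v | B v) mu u * mu v * (y u v) ^+ 2.
    rewrite -abE mulr_suml -big_split/=; apply: eq_bigr => u _.
    by rewrite mulr_suml -big_split/=; apply: eq_bigr => v _; ring.
  lra.
have hy : \sum_(u | A u) \sum_(v | B v) mu u * mu v * y u v <= a * b * l.
  apply: (@le_trans _ _ (\sum_(u | A u) \sum_(v | B v)
     (mu u * mu v * y u v ^+ 2 * (2 * l)^-1 + mu u * mu v * (l / 2)))).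
    apply: ler_sum => u _; apply: ler_sum => v _.
    rewrite -[_ * _ ^+ 2 * _]mulrA -mulrDr; apply: (ler_wpM2l (mm u v)).
    rewrite -subr_ge0 (_ : _ - _ = (y u v - l) ^+ 2 / (2 * l)); last by field; rewrite gt_eqF.
    by rewrite divr_ge0 ?sqr_ge0// mulr_ge0// ltW.
  under eq_bigr do rewrite big_split/= -!mulr_suml.
  rewrite big_split/= -!mulr_suml abE.
  have := ler_wpM2r (_ : 0 <= (2 * l)^-1) hsq; rewrite invr_ge0 mulr_ge0 ?(ltW l0)// => /(_ isT) h.
  apply: le_trans (lerD h (lexx _)) _.
  by rewrite le_eqVlt; apply/orP; left; apply/eqP; field; rewrite gt_eqF.
have -> : average A f - average B f =
    (a * b)^-1 *: \sum_(u | A u) \sum_(v | B v) (mu u * mu v) *: (f u - f v).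
  have -> : \sum_(u | A u) \sum_(v | B v) (mu u * mu v) *: (f u - f v) =
      b *: (\sum_(u | A u) mu u *: f u) - a *: (\sum_(v | B v) mu v *: f v).
    rewrite (_ : a *: _ = \sum_(u | A u) \sum_(v | B v) (mu u * mu v) *: f v); last first.
      rewrite scaler_suml; apply: eq_bigr => u _; rewrite scaler_sumr.
      by apply: eq_bigr => v _; rewrite scalerA.
    rewrite scaler_sumr -sumrB; apply: eq_bigr => u _.
    rewrite scalerA [b * _]mulrC mulr_sumr scaler_suml -sumrB.
    by apply: eq_bigr => v _; rewrite scalerBr.
  rewrite scalerBr !scalerA /average -/a -/b; congr (_ *: _ - _ *: _); field;
    by rewrite !gt_eqF.
rewrite normrZ ger0_norm ?invr_ge0 ?(ltW ab0)//.
rewrite mulrC ler_pdivrMr//.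
apply: le_trans (ler_norm_sum _ _ _) _.
apply: (@le_trans _ _ (c * (a * b * l))); last by rewrite le_eqVlt; apply/orP; left; apply/eqP; ring.
apply: le_trans (ler_wpM2l (ltW c0) hy).
rewrite mulr_sumr; apply: ler_sum => u _; apply: le_trans (ler_norm_sum _ _ _) _.
rewrite mulr_sumr; apply: ler_sum => v _.
rewrite normrZ ger0_norm// /y.
by rewrite le_eqVlt; apply/orP; left; apply/eqP; field; rewrite gt_eqF.
Qed.

Variables (d : T -> T -> R) (f : T -> X) (r0 lam Q S : R).
Hypothesis dxx : forall t, d t t <= 0.
Hypothesis dtri : forall t u v r, d t u <= r -> d t v <= r -> d u v <= 2 * r.
Hypothesis mu1 : \sum_t mu t = 1.
Hypothesis r00 : 0 < r0.
Hypothesis diam_le : forall t u, d t u <= r0.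
Hypothesis lam0 : 0 < lam.
Hypothesis Q1 : 1 <= Q.
Let rad (k : nat) : R := r0 / 2 ^+ k.
Hypothesis hQ : forall k,
  \sum_u \sum_(v | d u v <= 2 * rad k)
    mu u * mu v * expR ((`|f u - f v| / (lam * rad k)) ^+ 2) <= 2 ^+ k.+1 * Q.

Let rad_gt0 k : 0 < rad k. Proof. by rewrite divr_gt0// exprn_gt0. Qed.
Let radS k : rad k = 2 * rad k.+1.
Proof. by rewrite /rad exprS; field; rewrite expf_neq0. Qed.

Let mass_ge t k : mu t <= ball_mass mu d t (rad k).
Proof.
rewrite /ball_mass (bigD1 t)/=; last by apply: le_trans (dxx _) (ltW _).
by rewrite lerDl sumr_ge0// => u _; exact: ltW.
Qed.

Let mass_gt0 t k : 0 < ball_mass mu d t (rad k).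
Proof. exact: lt_le_trans (mass_ge t k). Qed.

Let mass_mono t k : ball_mass mu d t (rad k.+1) <= ball_mass mu d t (rad k).
Proof.
rewrite /ball_mass big_mkcond [leRHS]big_mkcond; apply: ler_sum => u _.
have rr : rad k.+1 <= rad k by rewrite [leRHS]radS; have := rad_gt0 k.+1; lra.
case: ifPn => h1; case: ifPn => // h2; last exact: ltW.
by move: h2; rewrite (le_trans h1).
Qed.

Let mass_le1 t k : ball_mass mu d t (rad k) <= 1.
Proof.
rewrite -mu1 /ball_mass big_mkcond; apply: ler_sum => u _.
by case: ifPn => // _; exact: ltW.
Qed.

Let Phi t k : R := Num.sqrt (ln (expR 1 / ball_mass mu d t (rad k))).

Hypothesis hS : forall t K, \sum_(k < K) rad k * Phi t k.+1 <= S.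

Lemma ln_expR1_div (y : R) : 0 < y -> ln (expR 1 / y) = 1 - ln y.
Proof. by move=> y0; rewrite ln_div ?posrE ?expR_gt0// expRK. Qed.

(** This fixes the length of a chaining step. The square of sqrt (ln Q) + (k+1) + 2 sqrt (1 - ln y)
    dominates ln Q + (k+1) - 2 ln y, whose exponential pays for Q, for 2^(k+1) and for the masses of
    both balls, each at least y. *)
Lemma exp_level_le (k : nat) (y z : R) : 0 < y -> y <= z -> y <= 1 ->
  2 ^+ k.+1 * Q <= z * y * expR ((Num.sqrt (ln Q) + k.+1%:R +
    2 * Num.sqrt (ln (expR 1 / y))) ^+ 2).
Proof.
move=> y0 yz y1.
have lQ : 0 <= ln Q by exact: ln_ge0.
have ly : ln y <= 0 by exact: ln_le0.
set p := Num.sqrt (ln Q); set q := Num.sqrt (ln (expR 1 / y)).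
have p2 : p ^+ 2 = ln Q by rewrite sqr_sqrtr.
have q2 : q ^+ 2 = 1 - ln y.
  by rewrite sqr_sqrtr ln_expR1_div//; lra.
have p0 : 0 <= p by exact: sqrtr_ge0.
have q0 : 0 <= q by exact: sqrtr_ge0.
have k0 : 1 <= k.+1%:R :> R by rewrite ler1n.
apply: (@le_trans _ _ (y * y * expR (k.+1%:R + ln Q - ln y - ln y))).
  have Q0 : 0 < Q by exact: lt_le_trans Q1.
  rewrite !expRD !expRN !lnK ?posrE//.
  rewrite (_ : y * y * _ = expR k.+1%:R * Q); last by field; rewrite gt_eqF.
  rewrite ler_wpM2r//; first by lra.
  rewrite -[X in expR X]mulr1 expRM_natl lerXn2r ?nnegrE ?expR_ge0//.
  by apply: le_trans (expR_ge1Dx _); lra.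
apply: ler_pM; rewrite ?mulr_ge0 ?expR_ge0 ?(ltW y0)//.
  by rewrite ler_wpM2r// ltW.
rewrite ler_expR; move: (k.+1%:R) k0 => n k0.
have pn : 0 <= p * n by rewrite mulr_ge0//; lra.
have pq : 0 <= p * q by rewrite mulr_ge0.
have nq : 0 <= n * q by rewrite mulr_ge0//; lra.
nra.
Qed.

(** Averages over shrinking balls around t are telescoped, starting from all of T, which is the ball
    of radius r0. Since [hQ] is a single integral over all pairs, it serves every t at once and
    stands in for a union bound. The coefficients come from the sums of rad k and (k+1) rad k, at
    most 2 r0 and 4 r0. *)
Lemma chaining_bound t : `|f t - average predT f| <=
  lam * (2 * r0 * Num.sqrt (ln Q) + 4 * r0 + 2 * S).
Proof.
pose p := Num.sqrt (ln Q).
have p0 : 0 <= p by exact: sqrtr_ge0.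
have Phi0 k : 0 <= Phi t k by exact: sqrtr_ge0.
pose av k := average (fun u => d t u <= rad k) f.
have step k : `|av k.+1 - av k| <= lam * rad k * (p + k.+1%:R + 2 * Phi t k.+1).
  apply: average_dist; rewrite ?mulr_gt0 ?mass_gt0//.
  - by rewrite ltr_pwDl// ?mulr_ge0// ltr_wpDl// ltr0n.
  - apply: le_trans (_ : 2 ^+ k.+1 * Q <= _); last first.
      rewrite [X in _ <= X * _]mulrC.
      by apply: exp_level_le; [exact: mass_gt0|exact: mass_mono|exact: mass_le1].
    apply: le_trans (hQ k).
    rewrite big_mkcond; apply: ler_sum => u _.
    case: ifPn => [du|_]; last first.
      by apply: sumr_ge0 => v _; rewrite !mulr_ge0 ?expR_ge0 ?(ltW (mu0 _)).
    rewrite big_mkcond [leRHS]big_mkcond; apply: ler_sum => v _.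
    case: ifPn => dv.
      rewrite ifT//; apply: (dtri _ dv); apply: le_trans du _.
      by rewrite [leRHS]radS; have := rad_gt0 k.+1; lra.
    by case: ifP => // _; rewrite !mulr_ge0 ?expR_ge0 ?(ltW (mu0 _)).
pose q := Num.sqrt (ln (expR 1 / mu t)).
have q0 : 0 <= q by exact: sqrtr_ge0.
have mut1 : mu t <= 1 by apply: le_trans (mass_ge t 0) (mass_le1 _ _).
(* A point is an average over a singleton of fixed positive mass mu t, so this link is rad k times a
   quantity linear in k and disappears in the limit. *)
have last_step k : `|f t - av k| <= lam * rad k * (p + k.+1%:R + 2 * q).
  have -> : f t = average (pred1 t) f.
    by rewrite /average !big_pred1_eq scalerA mulVf ?scale1r// gt_eqF.
  apply: average_dist; rewrite ?mulr_gt0 ?mass_gt0 ?big_pred1_eq//.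
  - by rewrite ltr_pwDl// ?mulr_ge0// ltr_wpDl// ltr0n.
  - apply: le_trans (_ : 2 ^+ k.+1 * Q <= _); last first.
      by rewrite [X in _ <= X * _]mulrC; apply: exp_level_le => //; exact: mass_ge.
    apply: le_trans (hQ k).
    rewrite [leRHS](bigD1 t)//=.
    apply: le_trans (_ : _ <= \sum_(v | d t v <= 2 * rad k) mu t * mu v * expR ((`|f t - f v| / (lam * rad k)) ^+ 2)) _; last first.
      rewrite lerDl; apply: sumr_ge0 => u _; apply: sumr_ge0 => v _.
      by rewrite !mulr_ge0 ?expR_ge0 ?(ltW (mu0 _)).
    rewrite big_mkcond [leRHS]big_mkcond; apply: ler_sum => v _.
    case: ifPn => dv.
      by rewrite ifT//; apply: le_trans dv _; have := rad_gt0 k; lra.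
    by case: ifP => // _; rewrite !mulr_ge0 ?expR_ge0 ?(ltW (mu0 _)).
have av0 : average predT f = av 0%N.
  rewrite /av /average; congr (_^-1 *: _); apply: eq_bigl => u;
    by rewrite /rad expr0 divr1 diam_le.
have tel K : `|f t - av 0%N| <= \sum_(k < K) (lam * rad k * (p + k.+1%:R + 2 * Phi t k.+1)) +
    lam * rad K * (p + K.+1%:R + 2 * q).
  apply: le_trans (_ : `|f t - av K| + `|av K - av 0%N| <= _).
    by rewrite -[X in `|X|](subrKA (av K)) ler_normD.
  rewrite addrC lerD//.
  elim: K => [|K IH]; first by rewrite subrr normr0 big_ord0.
  rewrite big_ord_recr/= -[X in `|X|](subrKA (av K)).
  by apply: le_trans (ler_normD _ _) _; rewrite addrC lerD.
rewrite av0; apply: (@ler_addgt0_inv _ _ _ (lam * (r0 * 4 * (p + 1 + 2 * q)))) => K.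
apply: le_trans (tel K) _; apply: lerD.
- have s1 : \sum_(k < K) rad k <= 2 * r0.
    have -> : \sum_(k < K) rad k = 2 * r0 - 2 * rad K.
      elim: K => [|K IH]; first by rewrite big_ord0 /rad expr0 divr1 subrr.
      by rewrite big_ord_recr/= IH [in LHS]radS; ring.
    by have := rad_gt0 K; lra.
  have s2 : \sum_(k < K) rad k * k.+1%:R <= 4 * r0.
    have -> : \sum_(k < K) rad k * k.+1%:R = 4 * r0 - (2 * K%:R + 4) * rad K.
      elim: {s1} K => [|K IH]; first by rewrite big_ord0 /rad expr0 divr1; ring.
      by rewrite big_ord_recr/= IH [in LHS]radS -natr1; ring.
    have : 0 <= (2 * K%:R + 4) * rad K by rewrite mulr_ge0 ?(ltW (rad_gt0 _))// addr_ge0// mulr_ge0.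
    lra.
  have s3 := hS t K.
  have -> : \sum_(k < K) lam * rad k * (p + k.+1%:R + 2 * Phi t k.+1) =
     lam * ((\sum_(k < K) rad k) * p + \sum_(k < K) rad k * k.+1%:R + 2 * \sum_(k < K) rad k * Phi t k.+1).
    rewrite mulr_suml mulr_sumr -!big_split/= mulr_sumr; apply: eq_bigr => k _; ring.
  rewrite ler_wpM2l ?(ltW lam0)//.
  have := ler_wpM2r p0 s1; rewrite -/p; lra.
- rewrite -mulrA -mulrA ler_wpM2l ?(ltW lam0)// /rad.
  (* 2^K beats (K+1)^2 up to the factor 4, which leaves a multiple of 1 / (K+1), the error that
     [ler_addgt0_inv] removes. *)
  have kk := exp2_ge_sqr K; rewrite -(ler_nat R) natrX natrM natrX in kk.
  have K0 : (0 : R) < K.+1%:R by rewrite ltr0n.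
  have e0 : (0 : R) < 2 ^+ K by rewrite exprn_gt0.
  apply: (@le_trans _ _ (r0 / 2 ^+ K * (K.+1%:R * (p + 1 + 2 * q)))).
    rewrite ler_wpM2l ?divr_ge0 ?(ltW e0) ?(ltW r00)//.
    have K1 : 1 <= K.+1%:R :> R by rewrite ler1n.
    have := ler_wpM2r p0 K1; have := ler_wpM2r q0 K1; rewrite !mul1r; lra.
  rewrite ler_pdivlMr//.
  move: (K.+1%:R) (2 ^+ K) kk K0 e0 => n e kk K0 e0.
  rewrite (_ : r0 / e * _ * n = (r0 * (p + 1 + 2 * q)) * (n ^+ 2 / e)); last by ring.
  rewrite (_ : r0 * 4 * _ = (r0 * (p + 1 + 2 * q)) * 4); last by ring.
  rewrite ler_wpM2l//; first by rewrite mulr_ge0 ?(ltW r00)//; lra.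
  by rewrite ler_pdivrMr.
Qed.

End chaining.

(** * The ball-mass functional *)

Section ball_mass.
Context (R : realType) (T : finType) (mu : T -> R).
Hypotheses (mu0 : forall t, 0 < mu t) (mu1 : \sum_t mu t = 1).
Implicit Types d : T -> T -> R.

Definition entropy d t r : R := Num.sqrt (ln (expR 1 / ball_mass mu d t r)).
(** Extension by 0 moves the random upper limit of integration into the integrand, so that Tonelli
    gives measurability of the functional of a random pseudometric. *)
Definition truncated_entropy d t r : R := if 0 <= r <= diam d then entropy d t r else 0.

Lemma entropy_ge0 d t r : 0 <= entropy d t r. Proof. exact: sqrtr_ge0. Qed.

Lemma truncated_entropy_ge0 d t r : 0 <= truncated_entropy d t r.
Proof. by rewrite /truncated_entropy; case: ifP => // _; exact: entropy_ge0. Qed.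

Lemma diam_ge0 d : 0 <= diam d.
Proof. by rewrite /diam; apply: bigmax_ge_id. Qed.

Lemma le_diam d t u : d t u <= diam d.
Proof.
rewrite /diam; apply: le_trans (le_bigmax _ _ t).
exact: (le_bigmax _ (d t)).
Qed.

Lemma diam_le d (x : R) : 0 <= x -> (forall t u, d t u <= x) -> diam d <= x.
Proof. by move=> x0 h; apply: bigmax_le => // t _; apply: bigmax_le => // u _. Qed.

Lemma ball_massE d t r : ball_mass mu d t r = \sum_u (if d t u <= r then mu u else 0).
Proof. by rewrite /ball_mass big_mkcond. Qed.

Lemma ball_mass_ge0 d t r : 0 <= ball_mass mu d t r.
Proof. by apply: sumr_ge0 => u _; exact: ltW. Qed.

Lemma ball_mass_le1 d t r : ball_mass mu d t r <= 1.
Proof.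
by rewrite ball_massE -mu1; apply: ler_sum => u _; case: ifP => // _; exact: ltW.
Qed.

Lemma ball_mass_ge d t r : d t t <= r -> mu t <= ball_mass mu d t r.
Proof.
move=> dr; rewrite /ball_mass (bigD1 t)//=.
by rewrite lerDl sumr_ge0// => u _; exact: ltW.
Qed.

Lemma entropy_anti d d' t r r' : d' t t <= r' ->
  (forall u, d' t u <= r' -> d t u <= r) -> entropy d t r <= entropy d' t r'.
Proof.
move=> h0 h; have p := lt_le_trans (mu0 t) (ball_mass_ge h0).
have le : ball_mass mu d' t r' <= ball_mass mu d t r.
  rewrite !ball_massE; apply: ler_sum => u _; case: ifP => [/h ->//|_].
  by case: ifP => // _; exact: ltW.
have p' := lt_le_trans p le.
apply: ler_wsqrtr; rewrite ler_ln ?posrE ?divr_gt0 ?expR_gt0//.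
by rewrite ler_pM2l ?expR_gt0// lef_pV2 ?posrE.
Qed.

Lemma entropy_ge1 d t r : d t t <= r -> 1 <= entropy d t r.
Proof.
move=> h0; have p := lt_le_trans (mu0 t) (ball_mass_ge h0).
rewrite -[leLHS]sqrtr1; apply: ler_wsqrtr; rewrite ln_expR1_div//.
have := ln_le0 (ball_mass_le1 d t r); lra.
Qed.

Lemma entropy_le d t r : d t t <= r -> entropy d t r <= Num.sqrt (ln (expR 1 / mu t)).
Proof.
move=> h0; have h := ball_mass_ge h0; have p := lt_le_trans (mu0 t) h.
apply: ler_wsqrtr; rewrite ler_ln ?posrE ?divr_gt0 ?expR_gt0//.
by rewrite ler_pM2l ?expR_gt0// lef_pV2 ?posrE.
Qed.

Section measurability.
Context dS (S : measurableType dS) (dd : S -> T -> T -> R).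
Hypothesis mdd : forall t u, measurable_fun setT (fun w => dd w t u).

Lemma measurable_diam : measurable_fun setT (fun w => diam (dd w)).
Proof.
have mx (I : finType) (f : I -> S -> R) : (forall i, measurable_fun setT (f i)) ->
    measurable_fun setT (fun w => \big[Num.max/0]_(i : I) f i w).
  move=> mf; rewrite unlock; elim: (index_enum _) => [|i s IH] /=; first exact: measurable_cst.
  exact: measurable_maxr.
by apply: (mx) => t; apply: (mx) => u.
Qed.

Lemma measurable_truncated_entropy t :
  measurable_fun setT (fun z : S * measurableTypeR R => truncated_entropy (dd z.1) t z.2).
Proof.
have m1 (f : S -> R) : measurable_fun setT f ->
    measurable_fun setT (fun z : S * measurableTypeR R => f z.1).
  by move=> mf; exact: (measurableT_comp mf measurable_fst).
have m2 : measurable_fun setT (fun z : S * measurableTypeR R => z.2 : R) by exact: measurable_snd.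
apply: measurable_fun_ifT => //.
  apply: measurable_and.
    exact: measurable_fun_ler.
  by apply: measurable_fun_ler => //; apply: (m1 (fun w => diam (dd w))); exact: measurable_diam.
have mB : measurable_fun setT (fun z : S * measurableTypeR R => ball_mass mu (dd z.1) t z.2).
  under eq_fun do rewrite ball_massE.
  apply: measurable_sum => u; apply: measurable_fun_ifT => //.
  by apply: measurable_fun_ler => //; exact: (m1 (fun w => dd w t u)).
apply: measurableT_comp.
  by apply: continuous_measurable_fun; exact: sqrt_continuous.
rewrite (_ : (fun z => _) = (fun z : S * measurableTypeR R => ln (expR 1 * ball_mass mu (dd z.1) t z.2 `^ (-1)))); last first.
  by apply/funext => z; rewrite powR_inv1// ball_mass_ge0.
apply: measurableT_comp; first exact: measurable_ln.
apply: measurable_funM => //.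
exact: (measurableT_comp (measurable_powR (-1)) mB).
Qed.

End measurability.

Lemma measurable_truncated_entropy_r d t :
  measurable_fun setT (fun r : measurableTypeR R => truncated_entropy d t r).
Proof.
have := @measurable_truncated_entropy _ unit (fun=> d) (fun t u => measurable_cst _) t.
move=> h; exact: (measurableT_comp h (@measurable_pair1 _ _ unit (measurableTypeR R) tt)).
Qed.

Local Open Scope ereal_scope.
Local Notation Leb := (@lebesgue_measure R).

Definition entropy_integral d t : \bar R := \int[Leb]_r (truncated_entropy d t r)%:E.

Lemma ball_mass_functionalE d :
  ball_mass_functional mu d = ereal_sup (range (entropy_integral d)).
Proof.
rewrite /ball_mass_functional (_ : (fun t : T => _) = entropy_integral d)//; apply/funext => t.
rewrite [LHS]integral_mkcond /entropy_integral; apply: eq_integral => r _.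
rewrite patchE /truncated_entropy mem_setE in_itv/=.
by case: ifP.
Qed.

Lemma entropy_integral_ge0 d t : 0 <= entropy_integral d t.
Proof. by apply: integral_ge0 => r _; rewrite lee_fin truncated_entropy_ge0. Qed.

Lemma entropy_integral_le d t : entropy_integral d t <= ball_mass_functional mu d.
Proof. by rewrite ball_mass_functionalE; apply: ereal_sup_ubound; exists t. Qed.

Lemma ball_mass_functional_ge0 d (t : T) : 0 <= ball_mass_functional mu d.
Proof. exact: le_trans (entropy_integral_ge0 d t) (entropy_integral_le d t). Qed.

Lemma integral_truncated_cst d (k : R) : (0 <= k)%R ->
  \int[Leb]_r (if 0 <= r <= diam d then k else 0)%:E = (k * diam d)%:E.
Proof.
move=> k0.
transitivity (\int[Leb]_(r in `[0%R, diam d]) k%:E).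
  rewrite [RHS]integral_mkcond; apply: eq_integral => r _.
  by rewrite patchE mem_setE in_itv/=; case: ifP.
rewrite integral_cst//= lebesgue_measure_itv/= lte_fin.
case: ltP => [_|h]; first by rewrite oppr0 adde0 EFinM.
by have -> : diam d = 0%R by apply/eqP; rewrite eq_le h diam_ge0.
Qed.

Lemma ball_mass_functional_le_diam d : (forall t, d t t = 0)%R ->
  ball_mass_functional mu d <= (\sum_t Num.sqrt (ln (expR 1 / mu t)) * diam d)%:E.
Proof.
move=> d0; rewrite ball_mass_functionalE -mulr_suml.
set k := (\sum_t Num.sqrt (ln (expR 1 / mu t)))%R.
have k0 : (0 <= k)%R by apply: sumr_ge0 => t _; exact: sqrtr_ge0.
apply: ge_ereal_sup => _ [t _ <-]; rewrite -integral_truncated_cst//.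
apply: ge0_integral_mono => r; first by rewrite lee_fin truncated_entropy_ge0.
rewrite lee_fin /truncated_entropy; case: ifP => // /andP[r0 _].
apply: le_trans (entropy_le (_ : d t t <= r)%R) _; first by rewrite d0.
by rewrite /k (bigD1 t)//= lerDl sumr_ge0// => u _; exact: sqrtr_ge0.
Qed.

Lemma ball_mass_functional_lty d : (forall t, d t t = 0)%R ->
  ball_mass_functional mu d < +oo.
Proof. by move=> d0; apply: le_lt_trans (ball_mass_functional_le_diam d0) (ltry _). Qed.

Lemma ball_mass_functional_fin d (t : T) : (forall t, d t t = 0)%R ->
  ball_mass_functional mu d \is a fin_num.
Proof.
by move=> d0; rewrite ge0_fin_numE ?ball_mass_functional_lty// ball_mass_functional_ge0.
Qed.

Lemma le_diam_mono d d' : (forall t u, d t u <= d' t u)%R -> (diam d <= diam d')%R.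
Proof.
by move=> dd; apply: diam_le (diam_ge0 _) _ => t u; apply: le_trans (dd _ _) (le_diam _ _ _).
Qed.

Lemma le_ball_mass_functional d d' : (forall t, d' t t = 0)%R ->
  (forall t u, d t u <= d' t u)%R ->
  ball_mass_functional mu d <= ball_mass_functional mu d'.
Proof.
move=> d0 dd; rewrite [leLHS]ball_mass_functionalE.
apply: ge_ereal_sup => _ [t _ <-]; apply: le_trans (entropy_integral_le d' t).
apply: ge0_integral_mono => r; first by rewrite lee_fin truncated_entropy_ge0.
rewrite lee_fin /truncated_entropy; case: ifP => [/andP[r0 rd]|_]; last first.
  by case: ifP => // _; exact: entropy_ge0.
rewrite r0 (le_trans rd (le_diam_mono dd))/=.
apply: entropy_anti; first by rewrite d0.
by move=> u; apply: le_trans.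
Qed.

(** The e under the logarithm makes the integrand at least 1 on the whole interval. This is what
    later absorbs the diameter term in the bound for the expectation. *)
Lemma diam_le_ball_mass_functional d (t : T) : (forall t, d t t = 0)%R ->
  (diam d)%:E <= ball_mass_functional mu d.
Proof.
move=> d0; apply: le_trans (entropy_integral_le d t).
rewrite -[leLHS]mul1e -EFinM -integral_truncated_cst//.
apply: ge0_integral_mono => r; first by rewrite lee_fin; case: ifP.
rewrite lee_fin /truncated_entropy; case: ifP => // /andP[r0 _].
by apply: entropy_ge1; rewrite d0.
Qed.

Lemma measurable_ball_mass_functional dS (S : measurableType dS) (dd : S -> T -> T -> R) (t : T) :
  (forall t u, measurable_fun setT (fun w => dd w t u)) ->
  measurable_fun setT (fun w => ball_mass_functional mu (dd w)).
Proof.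
move=> mdd.
have mI u : measurable_fun setT (fun w => entropy_integral (dd w) u).
  have mf : measurable_fun setT (fun z : S * measurableTypeR R => (truncated_entropy (dd z.1) u z.2)%:E).
    by apply/measurable_EFinP; exact: measurable_truncated_entropy.
  apply: (measurable_fun_fubini_tonelli_F (m2 := Leb) _ mf).
  by move=> z; rewrite lee_fin truncated_entropy_ge0.
rewrite (_ : (fun w => _) = (fun w => \big[maxe/0]_(u : T) entropy_integral (dd w) u)).
  rewrite unlock; elim: (index_enum _) => [|i s IH] /=; first exact: measurable_cst.
  exact: measurable_maxe.
apply/funext => w; rewrite ball_mass_functionalE; apply/eqP; rewrite eq_le; apply/andP; split.
  by apply: ge_ereal_sup => _ [u _ <-]; exact: le_bigmax.
apply: bigmax_le => [|u _]; last by apply: ereal_sup_ubound; exists u.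
by apply: le_trans (entropy_integral_ge0 (dd w) t) _; apply: ereal_sup_ubound; exists t.
Qed.

(* The integral over ]0, rho] dominates the lower Darboux sums along the dyadic partition. *)
Lemma dyadic_sum_le d t (rho : R) K : (0 < rho)%R -> (forall t, d t t = 0)%R ->
  (\sum_(k < K) (rho / 2 ^+ k / 2 * truncated_entropy d t (rho / 2 ^+ k)))%:E <=
  \int[Leb]_(r in `]0%R, rho]) (truncated_entropy d t r)%:E.
Proof.
move=> rho0 d0; elim: K rho rho0 => [|K IH] rho rho0.
  rewrite big_ord0; apply: integral_ge0 => r _; rewrite lee_fin truncated_entropy_ge0//.
have rho2 : (0 < rho / 2)%R by rewrite divr_gt0.
have lt2 : (rho / 2 < rho)%R by lra.
have mtr (D : set (measurableTypeR R)) : measurable D ->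
    measurable_fun D (fun r : measurableTypeR R => (truncated_entropy d t r)%:E).
  move=> mD; apply/measurable_EFinP; apply: measurable_funTS.
  exact: measurable_truncated_entropy_r.
rewrite (@itv_bndbnd_setU _ _ _ (BRight (rho / 2)%R)) ?bnd_simp ?(ltW rho2) ?(ltW lt2)//.
rewrite ge0_integral_setU//=; last 3 first.
- by apply: mtr; exact: measurableU.
- by move=> r _; rewrite lee_fin truncated_entropy_ge0.
- rewrite disj_set2E; apply/eqP; rewrite -subset0 => r [] /=; rewrite !in_itv/=.
  by move=> /andP[_ h1] /andP[h2 _]; move: h2; rewrite ltNge h1.
rewrite big_ord_recl /= expr0 divr1 EFinD [leRHS]addeC; apply: leeD; last first.
  apply: le_trans (IH _ rho2); rewrite lee_fin le_eqVlt; apply/orP; left; apply/eqP.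
  apply: eq_bigr => k _; rewrite /bump/= add1n exprS invfM.
  by rewrite (_ : rho * (2^-1 / 2 ^+ k) = rho / 2 / 2 ^+ k)%R//; ring.
apply: (@le_trans _ _ (\int[Leb]_(r in `](rho / 2)%R, rho]) (truncated_entropy d t rho)%:E)).
  rewrite integral_cst//= lebesgue_measure_itv/= lte_fin lt2 -EFinB -EFinM lee_fin.
  move: (truncated_entropy d t rho) => x.
  by rewrite (_ : (x * (rho - rho / 2) = rho / 2 * x)%R)//; field.
apply: ge0_le_integral => //=.
- by move=> r _; rewrite lee_fin truncated_entropy_ge0.
- exact: mtr.
- move=> r; rewrite in_itv/= => /andP[r1 r2].
  rewrite lee_fin /truncated_entropy; case: ifP => [/andP[_ h]|_]; last first.
    by case: ifP => // _; exact: entropy_ge0.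
  rewrite (le_trans r2 h) (ltW (lt_trans rho2 r1))/=.
  apply: entropy_anti; first by rewrite d0 (ltW (lt_trans rho2 r1)).
  by move=> u /le_trans; exact.
Qed.

(** The Darboux sum is taken from r0 / 2, and r0 / 2^k is 4 times the length of its k-th interval.
    Radii beyond the diameter are not seen by the integral; there the ball is all of T, the entropy
    is sqrt (ln e) = 1, and the cost is at most the sum of r0 / 2^k. *)
Lemma dyadic_entropy_sum d t (r0 : R) K : (0 < r0)%R -> (forall t, d t t = 0)%R ->
  (\sum_(k < K) r0 / 2 ^+ k * entropy d t (r0 / 2 ^+ k.+1) <=
   4 * (fine (ball_mass_functional mu d) + r0))%R.
Proof.
move=> r00 d0.
have h2 : (0 < r0 / 2)%R by rewrite divr_gt0.
have h := @dyadic_sum_le d t _ K h2 d0.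
have Gf := ball_mass_functional_fin t d0.
have {}h : (\sum_(k < K) (r0 / 2 / 2 ^+ k / 2 * truncated_entropy d t (r0 / 2 / 2 ^+ k)) <=
    fine (ball_mass_functional mu d))%R.
  rewrite -lee_fin fineK//; apply: le_trans h _.
  apply: le_trans (entropy_integral_le d t).
  apply: ge0_subset_integral => //.
  - by apply/measurable_EFinP; exact: measurable_truncated_entropy_r.
  - by move=> r _; rewrite lee_fin truncated_entropy_ge0.
have e0 k : (0 < r0 / 2 ^+ k)%R by rewrite divr_gt0// exprn_gt0.
have s1 : (\sum_(k < K) r0 / 2 ^+ k <= 2 * r0)%R.
  have -> : (\sum_(k < K) r0 / 2 ^+ k = 2 * r0 - 2 * (r0 / 2 ^+ K))%R.
    elim: {h} K => [|K IH]; first by rewrite big_ord0 expr0 divr1 subrr.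
    by rewrite big_ord_recr/= IH exprS; field; rewrite expf_neq0.
  by have := e0 K; lra.
apply: (@le_trans _ _ (4 * (\sum_(k < K) (r0 / 2 / 2 ^+ k / 2 * truncated_entropy d t (r0 / 2 / 2 ^+ k))) +
   \sum_(k < K) r0 / 2 ^+ k)%R); last by lra.
rewrite mulr_sumr -big_split/=; apply: ler_sum => k _.
have -> : (r0 / 2 ^+ k.+1 = r0 / 2 / 2 ^+ k)%R by rewrite exprS invfM mulrA.
have -> : (4 * (r0 / 2 / 2 ^+ k / 2 * truncated_entropy d t (r0 / 2 / 2 ^+ k)) =
   r0 / 2 ^+ k * truncated_entropy d t (r0 / 2 / 2 ^+ k))%R.
  by field; rewrite expf_neq0.
set x := (r0 / 2 / 2 ^+ k)%R.
have x0 : (0 <= x)%R by rewrite /x !divr_ge0 ?exprn_ge0 ?(ltW r00).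
suff : (entropy d t x <= truncated_entropy d t x + 1)%R.
  by move=> hx; have := ler_wpM2l (ltW (e0 k)) hx; rewrite mulrDr mulr1.
rewrite /truncated_entropy; case: ifPn; first by rewrite lerDl.
rewrite x0 /= -ltNge => dx; rewrite add0r.
rewrite -[leRHS]sqrtr1; apply: ler_wsqrtr.
have -> : ball_mass mu d t x = 1%R.
  rewrite -mu1; apply: eq_bigl => u; apply: le_trans (le_diam _ _ _) (ltW dx).
by rewrite divr1 expRK.
Qed.

End ball_mass.

(** * Decomposition into levels *)

(** The partial sums are nondecreasing, so the kept indices form an initial segment whose total is
    its last partial sum. The test at i includes [a i] itself: for energies this is still known one
    step in advance, and it rules out any overshoot of c. *)
Lemma sum_stopped_le (R : realType) (a : nat -> R) (c : R) (N : nat) : (forall i, 0 <= a i) -> 0 <= c ->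
  \sum_(1 <= i < N.+1) (if \sum_(1 <= l < i.+1) a l <= c then a i else 0) <= c.
Proof.
move=> a0 c0.
suff : \sum_(1 <= i < N.+1) (if \sum_(1 <= l < i.+1) a l <= c then a i else 0) <=
    Num.min (\sum_(1 <= l < N.+1) a l) c by rewrite le_min => /andP[].
elim: N => [|N IH]; first by rewrite !big_geq// le_min lexx.
move: IH; rewrite !le_min => /andP[h1 h2].
rewrite big_nat_recr//=; case: ifPn => h.
  have e : \sum_(1 <= i < N.+1) (if \sum_(1 <= l < i.+1) a l <= c then a i else 0) + a N.+1 <=
      \sum_(1 <= l < N.+2) a l by rewrite [leRHS]big_nat_recr//= lerD2r.
  by rewrite e (le_trans e).
rewrite addr0 h2 andbT; apply: le_trans h1 _.
by rewrite [leRHS]big_nat_recr//= lerDl.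
Qed.

Lemma sum_geometric_le (R : realType) (a : nat -> R) (b : R) N : (forall n, 0 <= a n) ->
  0 <= b -> (forall n, 2 * a n <= a n.+1) ->
  \sum_(n < N) (if a n <= b then a n else 0) <= 2 * b.
Proof.
move=> a0 b0 a2.
have tot n : \sum_(i < n) a i <= a n.
  elim: n => [|n IH]; first by rewrite big_ord0.
  by rewrite big_ord_recr/=; apply: le_trans (a2 n); rewrite mulr2n mulrDl mul1r lerD2r.
elim: N => [|N IH]; first by rewrite big_ord0 mulr_ge0.
rewrite big_ord_recr/=; case: ifPn => h; last by rewrite addr0.
apply: (@le_trans _ _ (2 * a N)); last by rewrite ler_wpM2l.
rewrite mulr2n mulrDl mul1r lerD2r; apply: le_trans (tot N).
by apply: ler_sum => i _; case: ifP.
Qed.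

(** * Square-function pseudometrics of selected increments *)

Section gamma_norm_facts.
Context (R : realType) (X : normedModType R) (m : nat).
Implicit Types A B C : {linear 'rV[R]_m -> X}.

Lemma gamma_norm_sub_sqr A B C :
  gamma_norm (A \- B) ^+ 2 <= 2 * gamma_norm (C \- A) ^+ 2 + 2 * gamma_norm (C \- B) ^+ 2.
Proof.
rewrite -lee_fin EFinD (EFinM 2 (gamma_norm _ ^+ 2)) (EFinM 2 (gamma_norm (C \- B) ^+ 2)).
rewrite -!seminorm_second_moment.
have mq (E : {linear 'rV[R]_m -> X}) : measurable_fun setT (fun x : m.-tuple R => (`|E (row_of_tuple x)| ^+ 2 : R)%:E).
  by apply/measurable_EFinP; apply: measurable_funX; exact: (measurable_seminorm E).
have q0 (E : {linear 'rV[R]_m -> X}) x : (0 <= (`|E (row_of_tuple x)| ^+ 2)%:E)%E.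
  by rewrite lee_fin sqr_ge0.
rewrite -!ge0_integralZl_EFin//.
rewrite -ge0_integralD//; last 2 first.
- by apply: emeasurable_funM => //; exact: mq.
- by apply: emeasurable_funM => //; exact: mq.
apply: ge0_integral_mono => x; first by rewrite lee_fin sqr_ge0.
rewrite -!EFinM -EFinD lee_fin /=.
set a := A _; set b := B _; set c := C _.
apply: (@le_trans _ _ ((`|c - a| + `|c - b|) ^+ 2)).
  rewrite ler_sqr ?nnegrE ?addr_ge0//.
  have -> : a - b = (c - b) - (c - a) by rewrite opprB [RHS]addrC subrKA.
  by rewrite [leRHS]addrC; exact: ler_normB.
have := sqr_ge0 (`|c - a| - `|c - b|); nra.
Qed.

Lemma gamma_norm_cond_sub (b : bool) A : gamma_norm (if b then A else (\0 : {linear 'rV[R]_m -> X})) ^+ 2 =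
  if b then gamma_norm A ^+ 2 else 0.
Proof.
case: b => //; apply/eqP; rewrite -eqe -seminorm_second_moment.
by rewrite integral0_eq// => x _; rewrite /= normr0 expr0n.
Qed.

Lemma gamma_norm_diag A : gamma_norm (A \- A) ^+ 2 = 0.
Proof.
apply/eqP; rewrite -eqe -seminorm_second_moment.
by rewrite integral0_eq// => x _; rewrite /= subrr normr0 expr0n.
Qed.

End gamma_norm_facts.

(* The square-function pseudometric with only the increments selected by [b] kept. *)
Section selected_dist.
Context (R : realType) (X : normedModType R) (T : finType) (m : nat -> nat)
  (A : forall i, T -> {linear 'rV[R]_(m i) -> X}).

Definition selected_energy (b : nat -> bool) (j : nat) (t u : T) : R :=
  \sum_(1 <= i < j.+1) (if b i then gamma_norm (A i t \- A i u) ^+ 2 else 0).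

Definition selected_dist b j t u : R := Num.sqrt (selected_energy b j t u).

Lemma selected_energy_ge0 b j t u : 0 <= selected_energy b j t u.
Proof. by apply: sumr_ge0 => i _; case: ifP => // _; exact: sqr_ge0. Qed.

Lemma selected_dist_sqr b j t u : selected_dist b j t u ^+ 2 = selected_energy b j t u.
Proof. by rewrite sqr_sqrtr// selected_energy_ge0. Qed.

Lemma selected_dist_ge0 b j t u : 0 <= selected_dist b j t u.
Proof. exact: sqrtr_ge0. Qed.

Lemma selected_dist_diag b j t : selected_dist b j t t = 0.
Proof.
rewrite /selected_dist /selected_energy big1 ?sqrtr0// => i _.
by case: ifP => // _; exact: gamma_norm_diag.
Qed.

Lemma selected_dist_le b j t u r : 0 <= r -> selected_energy b j t u <= r ^+ 2 ->
  selected_dist b j t u <= r.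
Proof. by move=> r0 h; rewrite -[r]ger0_norm// -sqrtr_sqr ler_wsqrtr. Qed.

Lemma selected_energy_le b j t u r : selected_dist b j t u <= r ->
  selected_energy b j t u <= r ^+ 2.
Proof.
move=> h; rewrite -selected_dist_sqr ler_sqr ?nnegrE ?selected_dist_ge0//.
exact: le_trans (selected_dist_ge0 _ _ _ _) h.
Qed.

(** At equal radii the inequality (x + y)^2 <= 2 x^2 + 2 y^2, summed over the increments, loses
    nothing: 2 r^2 + 2 r^2 = (2 r)^2. *)
Lemma selected_dist_quasi_triangle b j t u v r :
  selected_dist b j t u <= r -> selected_dist b j t v <= r ->
  selected_dist b j u v <= 2 * r.
Proof.
move=> h1 h2; have r0 := le_trans (selected_dist_ge0 _ _ _ _) h1.
apply: selected_dist_le; first by rewrite mulr_ge0.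
apply: (@le_trans _ _ (2 * selected_energy b j t u + 2 * selected_energy b j t v)); last first.
  by have := selected_energy_le h1; have := selected_energy_le h2; rewrite exprMn; lra.
rewrite !mulr_sumr -big_split/=; apply: ler_sum => i _.
by case: ifP => _; [exact: gamma_norm_sub_sqr|rewrite !mulr0 addr0].
Qed.

Lemma le_selected_energy (b b' : nat -> bool) j j' t u : (forall i, (1 <= i <= j)%N -> b i -> b' i /\ (i <= j')%N) ->
  selected_energy b j t u <= selected_energy b' j' t u.
Proof.
move=> h.
have E (c : nat -> bool) k K : (k <= K)%N -> selected_energy c k t u =
    \sum_(1 <= i < K.+1) (if (i <= k)%N && c i then gamma_norm (A i t \- A i u) ^+ 2 else 0).
  move=> kK; rewrite [RHS](@big_cat_nat _ _ _ k.+1)//=.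
  rewrite [X in _ = _ + X]big_nat_cond [X in _ = _ + X]big1 ?addr0; last first.
    by move=> i /andP[/andP[ki _] _]; rewrite leqNgt ki.
  apply: eq_big_nat => i /andP[_ ik].
  by have -> : (i <= k)%N by [].
rewrite (E b j (maxn j j') (leq_maxl _ _)) (E b' j' (maxn j j') (leq_maxr _ _)).
rewrite big_nat_cond [leRHS]big_nat_cond; apply: ler_sum => i /andP[/andP[i1 _] _].
case: ifPn => [/andP[ij bi]|_].
  have ii : (1 <= i <= j)%N by rewrite i1.
  by have [-> ->] := h i ii bi.
by case: ifP => // _; exact: sqr_ge0.
Qed.

End selected_dist.

Lemma square_dist_selected (R : realType) (X : normedModType R) (T : finType) (m : nat -> nat)
    (Omega : Type) (A : forall i, T -> Omega -> {linear 'rV[R]_(m i) -> X}) j w :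
  square_dist A j w = selected_dist (fun i t => A i t w) xpredT j.
Proof. by []. Qed.

Lemma measurable_selected_energy d (S : measurableType d) (R : realType) (X : normedModType R)
    (T : finType) (m : nat -> nat) (A : forall i, T -> S -> {linear 'rV[R]_(m i) -> X})
    (b : nat -> S -> bool) j t u : separable X ->
  (forall i t, (1 <= i <= j)%N -> op_measurable (A i t)) ->
  (forall i, (1 <= i <= j)%N -> measurable_fun setT (b i)) ->
  measurable_fun setT (fun w => selected_energy (fun i t => A i t w) (b^~ w) j t u).
Proof.
move=> sX; elim: j => [|j IH] mA mb.
  by rewrite /selected_energy; under eq_fun do rewrite big_geq//; exact: measurable_cst.
rewrite /selected_energy; under eq_fun do rewrite big_nat_recr//=.
apply: measurable_funD.
  apply: IH => [i t'|i] /andP[i1 ij]; first by apply: mA; rewrite i1 ltnW.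
  by apply: mb; rewrite i1 ltnW.
apply: measurable_fun_ifT; [by apply: mb; rewrite leqnn| |exact: measurable_cst].
apply: measurable_funX; apply: measurable_gamma_norm => //.
by apply: op_measurable_sub => //; apply: mA; rewrite leqnn.
Qed.

(** * Splitting the process by levels *)

Section level_decomposition.
Context (R : realType) (X : normedModType R) (D : R) (T : finType)
  (d : measure_display) (Omega : measurableType d) (P : probability Omega R) (N : nat)
  (F : nat -> set (set Omega)) (m : nat -> nat) (g : forall i, Omega -> (m i).-tuple R)
  (A : forall i, T -> Omega -> {linear 'rV[R]_(m i) -> X}) (mu : T -> R).
Hypotheses (sX : separable X) (D1 : 1 <= D) (XD : smooth2 X D).
Hypothesis filF : is_filtration N F.
Hypothesis pgA : predictable_gaussian P N F g A.
Hypotheses (mu0 : forall t, 0 < mu t) (mu1 : \sum_(t : T) mu t = 1).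
Variable t0 : T.
Variables (p eps : R).
Hypotheses (p1 : 1 <= p) (eps0 : 0 < eps).

(* [weight i] is F_(i-1)-measurable and nondecreasing in [i]. Hence the indices at
   a given level form a predictable interval, on which the functional and the
   diameter of the pseudometric are at most [eps * 4 ^+ n]. *)
Definition weight (i : nat) (w : Omega) : R :=
  fine (ball_mass_functional mu (square_dist A i w)) + Num.sqrt p * diam (square_dist A i w).

Definition level (n : nat) (x : R) : bool :=
  if n is k.+1 then (eps * 4 ^+ k < x) && (x <= eps * 4 ^+ n) else x <= eps.

Definition reached (n : nat) (w : Omega) : bool :=
  if n is k.+1 then eps * 4 ^+ k < weight N w else true.

(** At k = 0 this bounds the diameter of [level_dist n], because the weight contains sqrt p times
    the diameter. *)
Definition radius (n k : nat) : R := eps * 4 ^+ n / Num.sqrt p / 2 ^+ k.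

Definition level_energy n i u v (w : Omega) : R :=
  selected_energy (fun i t => A i t w) (fun l => level n (weight l w)) i u v.

(* The indicator is predictable and makes the energy bounded everywhere; on the
   pairs within distance [2 * radius n k] it has no effect. *)
Definition increment (n k : nat) (u v : T) (i : nat) (w : Omega) : {linear 'rV[R]_(m i) -> X} :=
  if level n (weight i w) && (level_energy n i u v w <= (2 * radius n k) ^+ 2)
  then (A i u w \- A i v w : {linear 'rV[R]_(m i) -> X}) else (\0 : {linear 'rV[R]_(m i) -> X}).

Definition max_increment n k u v (w : Omega) : R :=
  \big[Num.max/0]_(0 <= j < N.+1)
    `|\sum_(1 <= i < j.+1) increment n k u v i w (row_of_tuple (g i w))|.

Lemma sqrtp_gt0 : 0 < Num.sqrt p.
Proof. by rewrite sqrtr_gt0; exact: lt_le_trans p1. Qed.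

Lemma sqrtp_ge1 : 1 <= Num.sqrt p.
Proof. by rewrite -[leLHS]sqrtr1 ler_wsqrtr. Qed.

Lemma threshold_gt0 n : 0 < eps * 4 ^+ n.
Proof. by rewrite mulr_gt0// exprn_gt0. Qed.

Lemma radius_gt0 n k : 0 < radius n k.
Proof. by rewrite !divr_gt0 ?threshold_gt0 ?sqrtp_gt0// exprn_gt0. Qed.

Lemma square_dist_diag i w t : square_dist A i w t t = 0.
Proof. by rewrite square_dist_selected selected_dist_diag. Qed.

Lemma square_dist_mono i j w t u : (i <= j)%N -> square_dist A i w t u <= square_dist A j w t u.
Proof.
move=> ij; rewrite !square_dist_selected; apply: ler_wsqrtr.
apply: le_selected_energy => l /andP[_ li] _; split=> //; exact: leq_trans ij.
Qed.

Lemma weight_ge_functional i w : fine (ball_mass_functional mu (square_dist A i w)) <= weight i w.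
Proof. by rewrite lerDl mulr_ge0 ?sqrtr_ge0 ?diam_ge0. Qed.

Lemma functional_fin i w : ball_mass_functional mu (square_dist A i w) \is a fin_num.
Proof. by apply: (ball_mass_functional_fin mu0 t0) => t; exact: square_dist_diag. Qed.

Lemma weight_ge_diam i w : Num.sqrt p * diam (square_dist A i w) <= weight i w.
Proof. by rewrite lerDr fine_ge0// (ball_mass_functional_ge0 _ _ t0). Qed.

Lemma weight_ge0 i w : 0 <= weight i w.
Proof. by apply: le_trans (weight_ge_diam i w); rewrite mulr_ge0 ?sqrtr_ge0 ?diam_ge0. Qed.

Lemma weight_mono i j w : (i <= j)%N -> weight i w <= weight j w.
Proof.
move=> ij; apply: lerD.
  apply: fine_le; [exact: functional_fin|exact: functional_fin|].
  by apply: le_ball_mass_functional => // [t|t u]; [exact: square_dist_diag|exact: square_dist_mono].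
by rewrite ler_wpM2l ?sqrtr_ge0//; apply: le_diam_mono => t u; exact: square_dist_mono.
Qed.

Lemma weight0 w : weight 0 w = 0.
Proof.
have d0 t u : square_dist A 0 w t u = 0.
  by rewrite /square_dist big_geq// sqrtr0.
have diam0 : diam (square_dist A 0 w) = 0.
  by apply/eqP; rewrite eq_le diam_ge0 andbT; apply: diam_le => // t u; rewrite d0.
rewrite /weight diam0 mulr0 addr0.
have := ball_mass_functional_le_diam mu0 (fun t => d0 t t).
rewrite diam0 big1; last by move=> t _; rewrite mulr0.
move=> h; rewrite (_ : ball_mass_functional mu _ = 0%E)//.
by apply/eqP; rewrite eq_le h (ball_mass_functional_ge0 _ _ t0).
Qed.

Lemma predictable_operator i t : (1 <= i <= N)%N ->
  op_measurable (A i t : g_sigma_algebraType (F i.-1) -> _).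
Proof.
move=> /[dup] iN /andP[i1 iN']; have [_ _ _ h _] := pgA iN.
apply: adapted_op_measurable; last exact: h.
by case: filF => h1 _ _; apply: h1; rewrite (leq_trans (leq_pred _)).
Qed.

Lemma predictable_operator_le i l t : (1 <= i <= N)%N -> (1 <= l <= i)%N ->
  op_measurable (A l t : g_sigma_algebraType (F i.-1) -> _).
Proof.
move=> /andP[i1 iN] /andP[l1 li] v x.
case: filF => h1 _ h3.
have iN1 : (i.-1 <= N)%N by rewrite (leq_trans (leq_pred _)).
have li1 : (l.-1 <= i.-1)%N by rewrite -!subn1 leq_sub2r.
apply: (measurable_fun_subS (h1 _ (leq_trans li1 iN1)) (h1 _ iN1)).
  by apply: h3; rewrite li1.
by apply: predictable_operator; rewrite l1 (leq_trans li).
Qed.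

(** Stated over an arbitrary measurable space so that it yields both predictability with respect to
    F_(i-1) and measurability for the ambient sigma-algebra. *)
Lemma measurable_weight_gen dS (S : measurableType dS)
    (A' : forall i, T -> S -> {linear 'rV[R]_(m i) -> X}) i :
  (forall l t, (1 <= l <= i)%N -> op_measurable (A' l t)) ->
  measurable_fun setT (fun w => fine (ball_mass_functional mu (square_dist A' i w)) +
     Num.sqrt p * diam (square_dist A' i w)).
Proof.
move=> mA.
have md t u : measurable_fun setT (fun w => square_dist A' i w t u).
  apply: measurableT_comp; first by apply: continuous_measurable_fun; exact: sqrt_continuous.
  have := @measurable_selected_energy _ S R X T m A' (fun _ _ => true) i t u sX mA
    (fun _ _ => measurable_cst _).
  by [].
apply: measurable_funD.
  apply: measurableT_comp; first exact: fine_measurable.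
  exact: measurable_ball_mass_functional.
by apply: measurable_funM => //; exact: measurable_diam.
Qed.

Lemma measurable_weight i l : (1 <= i <= N)%N -> (1 <= l <= i)%N ->
  measurable_fun setT (weight l : g_sigma_algebraType (F i.-1) -> R).
Proof.
move=> iN /andP[l1 li].
apply: (@measurable_weight_gen _ (g_sigma_algebraType (F i.-1)) A) => l' t /andP[l1' ll].
by apply: predictable_operator_le => //; rewrite l1' (leq_trans ll).
Qed.

Lemma measurable_operator i t : (1 <= i <= N)%N -> op_measurable (A i t).
Proof.
move=> /[dup] iN /andP[i1 iN'] v x; case: filF => h1 h2 _.
have iN1 : (i.-1 <= N)%N by rewrite (leq_trans (leq_pred _)).
apply: (measurable_fun_sub (h1 _ iN1) (h2 _ iN1)); exact: predictable_operator.
Qed.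

Lemma measurable_weightN : measurable_fun setT (weight N).
Proof. by apply: measurable_weight_gen => l t lN; exact: measurable_operator. Qed.

Lemma measurable_level d' (S : measurableType d') (f : S -> R) n :
  measurable_fun setT f -> measurable_fun setT (fun w => level n (f w)).
Proof.
move=> mf; case: n => [|n] /=; first exact: measurable_fun_ler.
by apply: measurable_and; [exact: measurable_fun_ltr|exact: measurable_fun_ler].
Qed.

Lemma measurable_reached n : measurable [set w | reached n w].
Proof.
case: n => [|n] /=; first by rewrite (_ : [set _ | _] = setT)//; apply/seteqP; split.
rewrite -[X in measurable X]setTI.
apply: (@measurable_fun_ltr _ _ _ setT (cst (eps * 4 ^+ n)) (weight N)) => //.
exact: measurable_weightN.
Qed.

Lemma predictable_increment n k u v i : (1 <= i <= N)%N ->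
  op_measurable (increment n k u v i : g_sigma_algebraType (F i.-1) -> _).
Proof.
move=> iN.
apply: (@op_measurable_if _ (g_sigma_algebraType (F i.-1)) R X (m i)
  (fun w => level n (weight i w) && (level_energy n i u v w <= (2 * radius n k) ^+ 2))
  (fun w => A i u w \- A i v w)).
  have i1 : (1 <= i)%N by case/andP: iN.
  apply: measurable_and.
    by apply: measurable_level; apply: measurable_weight => //; rewrite i1 leqnn.
  apply: measurable_fun_ler => //.
  apply: (@measurable_selected_energy _ (g_sigma_algebraType (F i.-1)) R X T m A
     (fun l w => level n (weight l w))) => // [l t li|l li].
    exact: predictable_operator_le.
  by apply: measurable_level; exact: measurable_weight.
by apply: op_measurable_sub => //; exact: predictable_operator.
Qed.

Lemma level_reached n i w : (i <= N)%N -> level n (weight i w) -> reached n w.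
Proof.
move=> iN; case: n => //= n /andP[h _]; apply: lt_le_trans h _; exact: weight_mono.
Qed.

(** The energy of the cut-off increments is at most (2 radius)^2 on every path by [sum_stopped_le].
    As weights are nondecreasing, a level that the final weight does not reach has no increments, so
    [reached n] is an admissible localizing event. *)
Lemma integral_max_increment n k u v :
  (\int[P]_w (\1_[set w | reached n w] w * expR (max_increment n k u v w ^+ 2 /
     (544 * D ^+ 2 * (24 * (2 * radius n k)) ^+ 2)))%:E <=
   4%:E * P [set w | reached n w])%E.
Proof.
have rad0 := radius_gt0 n k.
apply: (@exponential_maximal_inequality R X D D1 XD sX d Omega P N F m g
  (increment n k u v) (2 * radius n k)) => //.
- by move=> i iN; have [h1 h2 h3 _ _] := pgA iN; split.
- by move=> i iN; exact: predictable_increment.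
- by rewrite mulr_gt0.
- move=> w; rewrite /increment.
  under eq_bigr do rewrite gamma_norm_cond_sub.
  apply: le_trans (@sum_stopped_le R (fun i => if level n (weight i w) then gamma_norm (A i u w \- A i v w) ^+ 2 else 0) ((2 * radius n k) ^+ 2) N _ _).
  + apply: ler_sum => i _; case: ifP => [/andP[-> h]|h]; first by rewrite ifT.
    by case: ifP => // h1; case: ifP => // h2; rewrite sqr_ge0.
  + by move=> i; case: ifP => // _; exact: sqr_ge0.
  + exact: sqr_ge0.
- exact: measurable_reached.
- move=> i w /andP[i1 iN] nG x; rewrite /increment.
  case: ifP => // /andP[h _]; exfalso; apply: nG => /=; exact: level_reached iN h.
Qed.

Definition level_process n j (w : Omega) (t : T) : X :=
  \sum_(1 <= i < j.+1) (if level n (weight i w) then A i t w (row_of_tuple (g i w)) else 0).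

Definition level_dist n (w : Omega) : T -> T -> R :=
  selected_dist (fun i t => A i t w) (fun l => level n (weight l w)) N.

(* [48 = 2 * 24] and [544] come from [exponential_maximal_inequality]. *)
Definition chaining_scale : R := 48 * D * Num.sqrt 544.

Lemma chaining_scale_gt0 : 0 < chaining_scale.
Proof.
have D0 := lt_le_trans ltr01 D1.
have s0 : 0 < Num.sqrt (544 : R) by rewrite sqrtr_gt0 ltr0n.
by rewrite /chaining_scale; move: (Num.sqrt 544) s0 => s s0; rewrite !mulr_gt0// ltr0n.
Qed.

Lemma chaining_scale_sqr n k : (chaining_scale * radius n k) ^+ 2 =
  544 * D ^+ 2 * (24 * (2 * radius n k)) ^+ 2.
Proof.
have s : Num.sqrt (544 : R) ^+ 2 = 544 by apply: sqr_sqrtr; exact: ler0n.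
rewrite /chaining_scale !exprMn s; move: (radius n k) (544 : R) => r c.
by ring.
Qed.

Lemma level_process_dist_le n k j w u v : (j <= N)%N ->
  level_dist n w u v <= 2 * radius n k ->
  `|level_process n j w u - level_process n j w v| <= max_increment n k u v w.
Proof.
move=> jN /selected_energy_le hE.
have -> : level_process n j w u - level_process n j w v =
    \sum_(1 <= i < j.+1) increment n k u v i w (row_of_tuple (g i w)).
  rewrite /level_process -sumrB; apply: eq_big_nat => i /andP[_ ij].
  have ij' : (i <= j)%N by [].
  rewrite /increment; case: ifPn => hl /=; last by rewrite subrr.
  rewrite ifT//; apply: le_trans hE; apply: le_selected_energy => l /andP[_ li] hb.
  by split=> //; exact: leq_trans li (leq_trans ij' jN).
rewrite /max_increment big_mkord.
exact: (le_bigmax _ (fun j : 'I_N.+1 => `|\sum_(1 <= i < j.+1) increment n k u v i w (row_of_tuple (g i w))|)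
  (Ordinal (jN : (j < N.+1)%N))).
Qed.

(** Take the last index i whose weight is at most eps 4^n; index 0, of weight 0, is always a
    candidate. Every increment of level n occurs up to i, so its energy is part of that of d_i. The
    level thus inherits the bounds encoded in the weight, although its metric is random. *)
Lemma level_dist_dominated n w : exists i, weight i w <= eps * 4 ^+ n /\
  forall u v, level_dist n w u v <= square_dist A i w u v.
Proof.
have ex0 : exists i, (i <= N)%N && (weight i w <= eps * 4 ^+ n).
  by exists 0%N; rewrite leq0n weight0 ltW// threshold_gt0.
have ub i : (i <= N)%N && (weight i w <= eps * 4 ^+ n) -> (i <= N)%N by case/andP.
case: (ex_maxnP ex0 ub) => i /andP[iN wi] imax.
exists i; split=> // u v; rewrite square_dist_selected; apply: ler_wsqrtr.
apply: le_selected_energy => l /andP[_ lN] hl; split=> //.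
apply: imax; rewrite lN /=; case: n hl {wi ub ex0} => [|n] /=; first by rewrite expr0 mulr1.
by case/andP.
Qed.

Lemma level_dist_diag n w t : level_dist n w t t = 0.
Proof. exact: selected_dist_diag. Qed.

Lemma level_dist_weight n w :
  fine (ball_mass_functional mu (level_dist n w)) <= eps * 4 ^+ n /\
  Num.sqrt p * diam (level_dist n w) <= eps * 4 ^+ n.
Proof.
have [i [wi di]] := level_dist_dominated n w.
split.
  apply: le_trans wi; apply: le_trans (weight_ge_functional i w).
  apply: fine_le.
  - by apply: (ball_mass_functional_fin mu0 t0) => t; exact: level_dist_diag.
  - exact: functional_fin.
  - by apply: le_ball_mass_functional => // t; exact: square_dist_diag.
apply: le_trans wi; apply: le_trans (weight_ge_diam i w).
by rewrite ler_wpM2l ?sqrtr_ge0//; exact: le_diam_mono.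
Qed.

Definition exponential_increment n k u v (w : Omega) : R := \1_[set w | reached n w] w *
  expR (max_increment n k u v w ^+ 2 / (chaining_scale * radius n k) ^+ 2).

Lemma exponential_increment_ge0 n k u v w : 0 <= exponential_increment n k u v w.
Proof. by apply: mulr_ge0; [rewrite indicE ler0n|exact: expR_ge0]. Qed.

Definition pair_moment n k (w : Omega) : R :=
  \sum_u \sum_v mu u * mu v * exponential_increment n k u v w.

Definition level_coef n k : R := (eps * 4 ^+ n) `^ p / 2 ^+ k.+1.

(* One random variable dominating the exponential moments of every level and
   scale; the factor [1 / 2 ^+ k.+1] makes the sum over scales converge, and the
   power [p] of the threshold makes the sum over levels geometric. *)
Definition chaining_potential (w : Omega) : \bar R :=
  (\sum_(n <oo) \sum_(k <oo) (level_coef n k * pair_moment n k w)%:E)%E.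

Lemma pair_moment_ge0 n k w : 0 <= pair_moment n k w.
Proof.
apply: sumr_ge0 => u _; apply: sumr_ge0 => v _.
apply: mulr_ge0; last exact: exponential_increment_ge0.
by apply: mulr_ge0; exact: ltW.
Qed.

Lemma level_coef_gt0 n k : 0 < level_coef n k.
Proof. by apply: divr_gt0; [apply: powR_gt0; exact: threshold_gt0|exact: exprn_gt0]. Qed.

Lemma level_term_ge0 n k w : (0 <= (level_coef n k * pair_moment n k w)%:E)%E.
Proof. by rewrite lee_fin mulr_ge0 ?pair_moment_ge0// ltW// level_coef_gt0. Qed.

Lemma level_term_le n k w : ((level_coef n k * pair_moment n k w)%:E <= chaining_potential w)%E.
Proof.
have term (f : nat -> \bar R) i : (forall j, (0 <= f j)%E) -> (f i <= \sum_(j <oo) f j)%E.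
  move=> f0; have := @nneseries_lim_ge R f xpredT 0 i.+1 (fun j _ _ => f0 j).
  by rewrite big_nat_recr//=; apply: le_trans; rewrite leeDr// sume_ge0.
apply: le_trans (term (fun k => (level_coef n k * pair_moment n k w)%:E) k _) _.
  by move=> j; exact: level_term_ge0.
apply: (term (fun n => \sum_(k <oo) (level_coef n k * pair_moment n k w)%:E)%E n).
by move=> j; apply: nneseries_ge0 => i _ _; exact: level_term_ge0.
Qed.

Lemma chaining_potential_ge0 w : (0 <= chaining_potential w)%E.
Proof. exact: le_trans (level_term_ge0 0 0 w) (level_term_le 0 0 w). Qed.

Section pathwise.
Variable w : Omega.
Hypothesis Uw : chaining_potential w \is a fin_num.

Definition potential_root : R := fine (chaining_potential w) `^ p^-1.

Lemma potential_root_ge0 : 0 <= potential_root. Proof. exact: powR_ge0. Qed.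

(** With x = U^(1/p) / c, the logarithm of x^p is at most p x. Squared, the left side is thus at
    most (c^2 / p) p x = c U^(1/p), so the factor 1 / sqrt p in the radius exactly cancels the p.
    The root of 4^n leaves the growth 2^n. *)
Lemma sqrt_ln_le n c : c = eps * 4 ^+ n ->
  c / Num.sqrt p * Num.sqrt (ln (Num.max 1 (fine (chaining_potential w) / c `^ p))) <=
  2 ^+ n * Num.sqrt (eps * potential_root).
Proof.
move=> cE; have c0 : 0 < c by rewrite cE; exact: threshold_gt0.
have pp : 0 < p := lt_le_trans ltr01 p1.
have u0 := potential_root_ge0.
have U0 : 0 <= fine (chaining_potential w) by apply: fine_ge0; exact: chaining_potential_ge0.
set Q := Num.max _ _.
have lnQ : ln Q <= p * (potential_root / c).
  rewrite /Q maxEle; case: ifPn => _; last by rewrite ln1 mulr_ge0 ?(ltW pp)// divr_ge0// ltW.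
  have -> : fine (chaining_potential w) / c `^ p = (potential_root / c) `^ p.
    rewrite powRM ?invr_ge0 ?(ltW c0)// /potential_root -powRrM mulVf ?gt_eqF// powRr1//.
    by congr (_ * _); rewrite -(powR_inv1 (ltW c0)) -powRrM mulN1r powRN.
  rewrite ln_powR ler_wpM2l ?(ltW pp)//.
  have : 0 <= potential_root / c by rewrite divr_ge0// ltW.
  (* If the potential vanishes, the convention ln 0 = 0 gives the bound. *)
  rewrite le_eqVlt => /orP[/eqP <-|y0]; first by rewrite ln0.
  rewrite -ler_expR lnK ?posrE//; apply: le_trans (expR_ge1Dx _).
  by rewrite lerDr.
have lnQ0 : 0 <= ln Q by rewrite ln_ge0// /Q le_max lexx.
have l0 : 0 <= c / Num.sqrt p * Num.sqrt (ln Q).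
  by apply: mulr_ge0; [apply: divr_ge0; [exact: ltW|]|]; exact: sqrtr_ge0.
have r0 : 0 <= 2 ^+ n * Num.sqrt (eps * potential_root).
  by apply: mulr_ge0; [exact: exprn_ge0|exact: sqrtr_ge0].
rewrite -(@ler_pXn2r _ 2)//.
rewrite !exprMn exprVn !sqr_sqrtr ?(ltW pp)//; last by rewrite mulr_ge0// ltW.
apply: (@le_trans _ _ (c ^+ 2 / p * (p * (potential_root / c)))).
  by rewrite ler_wpM2l// divr_ge0 ?sqr_ge0// ltW.
rewrite -exprM mulnC exprM (_ : 2 ^+ 2 = 4); last by rewrite -natrX.
by rewrite le_eqVlt; apply/orP; left; apply/eqP; rewrite cE; field; rewrite !gt_eqF ?exprn_gt0.
Qed.

Lemma level_process_unreached n j t : (j <= N)%N -> ~~ reached n w -> level_process n j w t = 0.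
Proof.
move=> jN nr; rewrite /level_process big_nat_cond big1// => i /andP[/andP[_ ij] _].
have ij' : (i <= j)%N by [].
case: ifPn => // /level_reached h; move: nr; rewrite h//; exact: leq_trans jN.
Qed.

Lemma level_process_osc n j t u : (j <= N)%N -> reached n w ->
  `|level_process n j w t - level_process n j w u| <=
  2 * (chaining_scale * (2 * (2 ^+ n * Num.sqrt (eps * potential_root)) + 20 * (eps * 4 ^+ n))).
Proof.
move=> jN rn.
have [hG hD] := level_dist_weight n w.
pose c := eps * 4 ^+ n; pose r0 := c / Num.sqrt p.
have c0 : 0 < c := threshold_gt0 n.
have sp := sqrtp_gt0; have sp1 := sqrtp_ge1.
have r00 : 0 < r0 by rewrite divr_gt0.
have rc : r0 <= c by rewrite ler_pdivrMr// ler_peMr// ltW.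
have U0 : 0 <= fine (chaining_potential w) by apply: fine_ge0; exact: chaining_potential_ge0.
pose Q := Num.max 1 (fine (chaining_potential w) / c `^ p).
have cp : 0 < c `^ p by rewrite powR_gt0.
have hQ k : \sum_u \sum_(v | level_dist n w u v <= 2 * (r0 / 2 ^+ k))
    mu u * mu v * expR ((`|level_process n j w u - level_process n j w v| /
      (chaining_scale * (r0 / 2 ^+ k))) ^+ 2) <= 2 ^+ k.+1 * Q.
  apply: (@le_trans _ _ (pair_moment n k w)).
    apply: ler_sum => x _; rewrite big_mkcond; apply: ler_sum => y _.
    have mm : 0 <= mu x * mu y by rewrite mulr_ge0// ltW.
    case: ifPn => [hd|_]; last first.
      exact: mulr_ge0 mm (exponential_increment_ge0 _ _ _ _ _).
    apply: (ler_wpM2l mm).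
    rewrite /exponential_increment indicE mem_set// mul1r ler_expR expr_div_n -/(radius n k).
    apply: ler_wpM2r; first by rewrite invr_ge0 sqr_ge0.
    have hl := @level_process_dist_le n k j w x y jN hd.
    by rewrite ler_sqr ?nnegrE// (le_trans _ hl).
  apply: (@le_trans _ _ (2 ^+ k.+1 * (fine (chaining_potential w) / c `^ p))); last first.
    by rewrite ler_wpM2l ?exprn_ge0// /Q le_max lexx orbT.
  have := level_term_le n k w; rewrite -(fineK Uw) lee_fin -ler_pdivlMl ?level_coef_gt0//.
  rewrite /level_coef -/c invf_div => h; apply: le_trans h _.
  by rewrite le_eqVlt; apply/orP; left; apply/eqP; rewrite mulrAC mulrA.
have hS t' K : \sum_(k < K) r0 / 2 ^+ k *
    Num.sqrt (ln (expR 1 / ball_mass mu (level_dist n w) t' (r0 / 2 ^+ k.+1))) <= 4 * (c + c).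
  apply: le_trans (dyadic_entropy_sum mu0 mu1 t' K r00 (@level_dist_diag n w)) _.
  by rewrite ler_wpM2l// lerD.
have Q1 : 1 <= Q by rewrite /Q le_max lexx.
have dle x y : level_dist n w x y <= r0.
  rewrite ler_pdivlMr// mulrC; apply: le_trans hD.
  by rewrite ler_wpM2l ?(ltW sp)//; exact: le_diam.
have dd t' : level_dist n w t' t' <= 0 by rewrite level_dist_diag.
have dtri x y z r : level_dist n w x y <= r -> level_dist n w x z <= r ->
    level_dist n w y z <= 2 * r by exact: selected_dist_quasi_triangle.
have cb t' := chaining_bound mu0 dd dtri mu1 r00 dle chaining_scale_gt0 Q1 hQ hS t'.
have hs := sqrt_ln_le (erefl c); rewrite -/r0 -/Q in hs.
set av := average _ _ _ in cb.
(* 20 = 4 + 2 * 8: the term 4 r0 with r0 <= c, and twice the entropy sum 4 (c + c). *)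
have {}cb t' : `|level_process n j w t' - av| <= chaining_scale *
   (2 * (2 ^+ n * Num.sqrt (eps * potential_root)) + 20 * c).
  apply: le_trans (cb t') _; rewrite ler_wpM2l ?(ltW chaining_scale_gt0)//.
  by rewrite -mulrA; lra.
have -> : level_process n j w t - level_process n j w u =
  (level_process n j w t - av) - (level_process n j w u - av) by rewrite opprB addrA subrK.
apply: le_trans (ler_normB _ _) _.
by rewrite mulr2n [leRHS]mulrDl mul1r lerD.
Qed.

Lemma sum_levels (x : R) (y : X) n :
  \sum_(k < n.+1) (if level k x then y else 0) = if x <= eps * 4 ^+ n then y else 0.
Proof.
elim: n => [|n IH]; first by rewrite big_ord1 /= expr0 mulr1.
rewrite big_ord_recr IH /=; case: leP => h /=; last by rewrite add0r.
rewrite addr0 (le_trans h)// ler_wpM2l ?(ltW eps0)// exprS ler_peMl ?exprn_ge0// ler1n//.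
Qed.

Lemma process_decomposition j t n : (j <= N)%N -> weight N w <= eps * 4 ^+ n ->
  gaussian_sum g A w j t = \sum_(k < n.+1) level_process k j w t.
Proof.
move=> jN wn; rewrite /level_process exchange_big/=; apply: eq_big_nat => i /andP[_ ij].
rewrite sum_levels ifT//; apply: le_trans wn; apply: weight_mono.
exact: leq_trans jN.
Qed.

Lemma last_level : exists n, weight N w <= eps * 4 ^+ n /\ eps * 4 ^+ n <= eps + 4 * weight N w.
Proof.
have exn : exists n, (fun n => weight N w <= eps * 4 ^+ n) n.
  exists (Num.bound (weight N w / eps)).
  have h : weight N w / eps < (Num.bound (weight N w / eps))%:R.
    by apply: archi_boundP; rewrite divr_ge0 ?weight_ge0// ltW.
  rewrite mulrC -ler_pdivrMr//; apply: le_trans (ltW h) _.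
  by rewrite -natrX ler_nat ltnW// ltn_expl.
case: (ex_minnP exn) => -[|n] hn nmin.
  exists 0%N; split=> //; rewrite expr0 mulr1 lerDl.
  by apply: mulr_ge0 => //; exact: weight_ge0.
exists n.+1; split=> //.
have : eps * 4 ^+ n < weight N w by rewrite ltNge; apply/negP => /nmin; rewrite ltnn.
by rewrite exprS; have := eps0; lra.
Qed.

(** The costs 2^n sqrt (eps U^(1/p)) and eps 4^n grow geometrically, so the last level n0 dominates.
    Its mixed term is the geometric mean of eps 4^n0 and U^(1/p), hence at most their half-sum. *)
Lemma max_osc_le : max_osc N (gaussian_sum g A w) <=
  336 * chaining_scale * (eps + weight N w + potential_root).
Proof.
have [n0 [h1 h2]] := last_level.
have cs := chaining_scale_gt0; have u0 := potential_root_ge0; have W0 := weight_ge0 N w.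
have c0 := threshold_gt0 n0.
set q := Num.sqrt (eps * potential_root).
have q0 : 0 <= q by exact: sqrtr_ge0.
have qq : 2 ^+ n0 * q <= (eps * 4 ^+ n0 + potential_root) / 2.
  have -> : 2 ^+ n0 * q = Num.sqrt (eps * 4 ^+ n0) * Num.sqrt potential_root.
    rewrite -sqrtrM ?(ltW c0)// mulrAC sqrtrM; last by rewrite mulr_ge0// ltW.
    rewrite mulrC; congr (_ * _).
    rewrite (_ : 4 = 2 ^+ 2 :> R); last by rewrite -natrX.
    by rewrite -exprM mulnC exprM sqrtr_sqr ger0_norm// exprn_ge0.
  have e1 := sqr_sqrtr (ltW c0); have e2 := sqr_sqrtr u0.
  rewrite -[in leRHS]e1 -[in leRHS]e2.
  have := sqr_ge0 (Num.sqrt (eps * 4 ^+ n0) - Num.sqrt potential_root).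
  move: (Num.sqrt (eps * 4 ^+ n0)) (Num.sqrt potential_root) => x y; lra.
suff main j t u : (j <= N)%N -> `|gaussian_sum g A w j t - gaussian_sum g A w j u| <=
    336 * chaining_scale * (eps + weight N w + potential_root).
  have r0 : 0 <= 336 * chaining_scale * (eps + weight N w + potential_root).
    apply: mulr_ge0; first by apply: mulr_ge0; [exact: ler0n|exact: ltW].
    by have := eps0; lra.
  rewrite /max_osc big_mkord; apply: bigmax_le => // -[j jN] _.
  by rewrite /osc; apply: bigmax_le => // t _; apply: bigmax_le => // u _; exact: main.
move=> jN; rewrite !(process_decomposition _ jN h1) -sumrB.
apply: le_trans (ler_norm_sum _ _ _) _.
apply: (@le_trans _ _ (\sum_(n < n0.+1)
   2 * (chaining_scale * (2 * (2 ^+ n * q) + 20 * (eps * 4 ^+ n))))).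
  apply: ler_sum => n _; have [rn|nr] := boolP (reached n w).
    exact: level_process_osc.
  rewrite !level_process_unreached// subrr normr0.
  apply: mulr_ge0 => //; apply: mulr_ge0; first exact: ltW.
  have := threshold_gt0 n; have : 0 <= 2 ^+ n * q by rewrite mulr_ge0 ?exprn_ge0.
  lra.
have geom (a : R) : 2 <= a -> \sum_(n < n0.+1) a ^+ n <= 2 * a ^+ n0.
  move=> a2; have a0 : 0 <= a by apply: le_trans a2; exact: ler0n.
  have a1 : 1 <= a by apply: le_trans a2; rewrite ler1n.
  have an k : 0 <= a ^+ k by exact: exprn_ge0.
  have ad k : 2 * a ^+ k <= a ^+ k.+1 by rewrite exprS; exact: ler_wpM2r.
  apply: le_trans (sum_geometric_le n0.+1 an (an n0) ad).
  by apply: ler_sum => -[k kn] _ /=; rewrite ifT//; exact: ler_weXn2l.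
have s2 := geom 2 (lexx _).
have s4 : \sum_(n < n0.+1) (4 : R) ^+ n <= 2 * 4 ^+ n0 by apply: geom; rewrite ler_nat.
have -> : \sum_(n < n0.+1) 2 * (chaining_scale * (2 * (2 ^+ n * q) + 20 * (eps * 4 ^+ n))) =
    2 * chaining_scale * (2 * ((\sum_(n < n0.+1) 2 ^+ n) * q) + 20 * (eps * \sum_(n < n0.+1) 4 ^+ n)).
  rewrite mulr_suml !mulr_sumr -big_split/= mulr_sumr; apply: eq_bigr => n _; ring.
have t1 := ler_wpM2r q0 s2; have t2 := ler_wpM2l (ltW eps0) s4.
(* 168 = 4 * 42: summation over levels leaves 42 = 2 + 2 * 20 times the last threshold, and this
   threshold is at most eps + 4 W_N. *)
rewrite (_ : 336 * chaining_scale * _ = 2 * chaining_scale * (168 * (eps + weight N w + potential_root))); last by ring.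
rewrite ler_wpM2l//; first by rewrite mulr_ge0// ltW.
have e0 := eps0; lra.
Qed.

End pathwise.

Lemma measurable_vector i : (1 <= i <= N)%N -> measurable_fun setT (g i).
Proof.
move=> /[dup] iN /andP[_ iN'] _ B mB; rewrite setTI.
case: filF => _ h _; apply: (h _ iN'); have [_ _ h' _ _] := pgA iN; exact: h'.
Qed.

Lemma measurable_increment n k u v i : (1 <= i <= N)%N -> op_measurable (increment n k u v i).
Proof.
move=> /[dup] iN /andP[i1 iN'] y x; case: filF => h1 h2 _.
have iN1 : (i.-1 <= N)%N by rewrite (leq_trans (leq_pred _)).
apply: (measurable_fun_sub (h1 _ iN1) (h2 _ iN1)); exact: predictable_increment.
Qed.

Lemma measurable_max_increment n k u v : measurable_fun setT (max_increment n k u v).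
Proof.
have mj j : (j <= N)%N -> measurable_fun setT
    (fun w => `|\sum_(1 <= i < j.+1) increment n k u v i w (row_of_tuple (g i w))|).
  move=> jN; apply: norm_measurable_normr; rewrite /index_iota.
  have h : forall i, i \in iota 1 (j.+1 - 1) -> (1 <= i <= N)%N.
    by move=> i; rewrite mem_iota subn1 add1n ltnS => /andP[-> ij]; exact: leq_trans jN.
  elim: (iota _ _) h => [|i s IH] h; first by under eq_fun do rewrite big_nil; exact: norm_measurable0.
  under eq_fun do rewrite big_cons.
  have iN := h i (mem_head _ _).
  apply: norm_measurableD => //.
    exact: (norm_measurable_op sX (measurable_increment n k u v iN) (measurable_vector iN)).
  by apply: IH => l ls; apply: h; rewrite inE ls orbT.
rewrite /max_increment /index_iota.
have h : forall j, j \in iota 0 (N.+1 - 0) -> (j <= N)%N by move=> j; rewrite mem_iota subn0 add0n ltnS.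
elim: (iota _ _) h => [|i s IH] h; first by under eq_fun do rewrite big_nil; exact: measurable_cst.
under eq_fun do rewrite big_cons.
apply: measurable_maxr; first by apply: mj; apply: h; exact: mem_head.
by apply: IH => l ls; apply: h; rewrite inE ls orbT.
Qed.

Lemma measurable_exponential_increment n k u v :
  measurable_fun setT (exponential_increment n k u v).
Proof.
apply: measurable_funM; first by apply: measurable_indic; exact: measurable_reached.
apply: measurableT_comp => //.
apply: measurable_funM => //; apply: measurable_funX; exact: measurable_max_increment.
Qed.

Lemma measurable_pair_moment n k : measurable_fun setT (pair_moment n k).
Proof.
apply: measurable_sum => u; apply: measurable_sum => v; apply: measurable_funM => //.
exact: measurable_exponential_increment.
Qed.

(** The measure mu x mu has total mass 1, so averaging over the pairs costs nothing and the
    cardinality of T never enters. *)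
Lemma integral_pair_moment n k :
  (\int[P]_w (pair_moment n k w)%:E <= 4%:E * P [set w | reached n w])%E.
Proof.
have mu2 u v : 0 <= mu u * mu v by rewrite mulr_ge0// ltW.
have PG : P [set w | reached n w] \is a fin_num.
  by apply: fin_num_measure; exact: measurable_reached.
rewrite -(fineK PG) -EFinM; set M := 4 * _.
have bnd u v : (\int[P]_w (mu u * mu v * exponential_increment n k u v w)%:E <= (mu u * mu v * M)%:E)%E.
  under eq_integral do rewrite EFinM.
  rewrite ge0_integralZl_EFin//; last 2 first.
  - by move=> w _; rewrite lee_fin exponential_increment_ge0.
  - by apply/measurable_EFinP; exact: measurable_exponential_increment.
  rewrite [leRHS]EFinM lee_wpmul2l ?lee_fin//.
  rewrite /M EFinM fineK//; apply: le_trans (integral_max_increment n k u v).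
  by under eq_integral do rewrite /exponential_increment chaining_scale_sqr.
have m2 u v : measurable_fun setT (fun w => (mu u * mu v * exponential_increment n k u v w)%:E).
  by apply/measurable_EFinP; apply: measurable_funM => //; exact: measurable_exponential_increment.
have m1 u : measurable_fun setT (fun w => (\sum_v mu u * mu v * exponential_increment n k u v w)%:E).
  apply/measurable_EFinP; apply: measurable_sum => v.
  by apply: measurable_funM => //; exact: measurable_exponential_increment.
have p2 u v w : (0 <= (mu u * mu v * exponential_increment n k u v w)%:E)%E.
  by rewrite lee_fin mulr_ge0// exponential_increment_ge0.
apply: (@le_trans _ _ (\sum_u \sum_v (mu u * mu v * M)%:E)%E).
  apply: (@le_trans _ _ (\sum_u \sum_v \int[P]_w (mu u * mu v * exponential_increment n k u v w)%:E)%E).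
    rewrite le_eqVlt; apply/orP; left; apply/eqP.
    under eq_integral do rewrite /pair_moment -sumEFin.
    rewrite ge0_integral_sum//; last first.
      move=> u w _; rewrite lee_fin; apply: sumr_ge0 => v _.
      by rewrite mulr_ge0//; exact: exponential_increment_ge0.
    apply: eq_bigr => u _.
    rewrite -ge0_integral_sum//.
    by under [RHS]eq_integral do rewrite sumEFin.
  by apply: lee_sum => u _; apply: lee_sum => v _; exact: bnd.
under eq_bigr do rewrite sumEFin.
rewrite sumEFin lee_fin le_eqVlt; apply/orP; left; apply/eqP.
under eq_bigr do rewrite -mulr_suml -mulr_sumr mu1 mulr1.
by rewrite -mulr_suml mu1 mul1r.
Qed.

Lemma measurable_level_term n k :
  measurable_fun setT (fun w => (level_coef n k * pair_moment n k w)%:E).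
Proof.
by apply/measurable_EFinP; apply: measurable_funM => //; exact: measurable_pair_moment.
Qed.

Lemma measurable_chaining_potential : measurable_fun setT chaining_potential.
Proof.
apply: ge0_emeasurable_sum => [n w _ _|n _].
  by apply: nneseries_ge0 => k _ _; exact: level_term_ge0.
apply: ge0_emeasurable_sum => [k w _ _|k _]; first exact: level_term_ge0.
exact: measurable_level_term.
Qed.

Lemma level_coef_series n (x : R) :
  (\sum_(k <oo) (level_coef n k * x)%:E = ((eps * 4 ^+ n) `^ p * x)%:E)%E.
Proof.
have half := @cvg_geometric_eseries_half R 1%R 0.
have e1 : (\sum_(k <oo) (1 / (2 ^ (k + 1))%:R)%:E = 1%:E :> \bar R)%E.
  by apply/cvg_lim => //; move: half; rewrite expr0 divr1.
rewrite -[RHS]mule1 -e1 -nneseriesZl//.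
apply: eq_eseriesr => k _; rewrite -EFinM /level_coef addn1 natrX div1r.
by congr EFin; rewrite mulrAC.
Qed.

(** The scales sum to 1. Each P(reached) is then put back under the integral as an indicator, so
    that the sum over levels is estimated path by path: a reached level has threshold at most eps +
    4 W_N, and the p-th powers of the thresholds at least double. The constant is 8 = 4 * 2, with 4
    from the maximal inequality and 2 from the geometric sum. *)
Lemma integral_chaining_potential :
  (\int[P]_w chaining_potential w <= \int[P]_w (8 * (eps + 4 * weight N w) `^ p)%:E)%E.
Proof.
have iS (f : nat -> Omega -> \bar R) : (forall n, measurable_fun setT (f n)) ->
    (forall n w, (0 <= f n w)%E) ->
    (\int[P]_w \sum_(n <oo) f n w = \sum_(n <oo) \int[P]_w f n w)%E.
  by move=> mf f0; rewrite integral_nneseries.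
pose h n w : \bar R := (level_coef n 0 * pair_moment n 0 w)%:E.
pose ind n k w : \bar R := (level_coef n k * (4 * \1_[set w | reached n w] w))%:E.
have i0 n w : 0 <= 4 * \1_[set w | reached n w] w :> R.
  by rewrite mulr_ge0// indicE ler0n.
have ind0 n k w : (0 <= ind n k w)%E.
  by rewrite lee_fin mulr_ge0// ltW// level_coef_gt0.
have mind n k : measurable_fun setT (ind n k).
  apply/measurable_EFinP; apply: measurable_funM => //; apply: measurable_funM => //.
  by apply: measurable_indic; exact: measurable_reached.
have mlt n k := measurable_level_term n k.
have lt0 n k w := level_term_ge0 n k w.
rewrite /chaining_potential iS; last 2 first.
- by move=> n; apply: ge0_emeasurable_sum.
- by move=> n w; apply: nneseries_ge0.
apply: (@le_trans _ _ (\sum_(n <oo) \int[P]_w \sum_(k <oo) ind n k w)%E).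
  apply: lee_nneseries => n _ => [_|].
    by apply: integral_ge0 => w _; apply: nneseries_ge0.
  rewrite !iS//; apply: lee_nneseries => k _ => [_|]; first by apply: integral_ge0.
  under eq_integral do rewrite EFinM.
  rewrite ge0_integralZl_EFin//; last 3 first.
  - by move=> w _; rewrite lee_fin pair_moment_ge0.
  - by apply/measurable_EFinP; exact: measurable_pair_moment.
  - exact: ltW (level_coef_gt0 _ _).
  rewrite /ind; under [leRHS]eq_integral do rewrite EFinM.
  rewrite ge0_integralZl_EFin//; last 2 first.
  - apply/measurable_EFinP; apply: measurable_funM => //.
    by apply: measurable_indic; exact: measurable_reached.
  - exact: ltW (level_coef_gt0 _ _).
  rewrite lee_wpmul2l//; first by rewrite lee_fin ltW// level_coef_gt0.
  apply: le_trans (integral_pair_moment n k) _.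
  under [leRHS]eq_integral do rewrite EFinM.
  rewrite ge0_integralZl_EFin//; last first.
    by apply/measurable_EFinP; apply: measurable_indic; exact: measurable_reached.
  by rewrite integral_indic ?setIT//; exact: measurable_reached.
rewrite -iS; last 2 first.
- by move=> n; apply: ge0_emeasurable_sum.
- by move=> n w; apply: nneseries_ge0.
apply: ge0_integral_mono => w; first by apply: nneseries_ge0 => n _ _; apply: nneseries_ge0.
rewrite /ind; under eq_eseriesr do rewrite level_coef_series//.
apply: lime_le.
  by apply: is_cvg_nneseries => n _ _; rewrite lee_fin mulr_ge0// powR_ge0.
apply: nearW => K; rewrite sumEFin lee_fin big_mkord.
have c0 n : 0 <= (eps * 4 ^+ n) `^ p by exact: powR_ge0.
have W0 := weight_ge0 N w.
have c2 n : 2 * (eps * 4 ^+ n) `^ p <= (eps * 4 ^+ n.+1) `^ p.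
  rewrite exprSr mulrA [leRHS]powRM ?(ltW (threshold_gt0 n))// mulrC ler_wpM2l//.
  apply: (@le_trans _ _ (4 `^ 1)); first by rewrite powRr1// ler_nat.
  by apply: ler_powR => //; rewrite ler1n.
have b0 : 0 <= (eps + 4 * weight N w) `^ p by exact: powR_ge0.
rewrite (_ : 8 * _ = 4 * (2 * (eps + 4 * weight N w) `^ p)); last by ring.
apply: le_trans (ler_wpM2l _ (sum_geometric_le K c0 b0 c2)); last exact: ler0n.
rewrite mulr_sumr; apply: ler_sum => -[n nK] _ /=.
rewrite mulrCA; apply: ler_wpM2l; first exact: ler0n.
rewrite indicE; case: ifPn => [_|hn].
  by rewrite ler_piMr//; case: (_ \in _).
rewrite memNset ?mulr0//= => hr; move: hn => /negP; apply.
apply: ge0_ler_powR; rewrite ?nnegrE ?(ltW (threshold_gt0 _))//.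
- exact: le_trans ler01 p1.
- by have := eps0; lra.
case: n nK hr => [|n] nK /= hr; first by rewrite expr0 mulr1 lerDl mulr_ge0.
by rewrite exprS; have := eps0; lra.
Qed.

Lemma max_osc_ge0 (f : nat -> T -> X) : 0 <= max_osc N f.
Proof. by rewrite /max_osc big_mkord; exact: bigmax_ge_id. Qed.

Lemma powR_add3_le (a b c : R) : 0 <= a -> 0 <= b -> 0 <= c ->
  (a + b + c) `^ p <= 3 `^ p * (a `^ p + b `^ p + c `^ p).
Proof.
move=> a0 b0 c0; have pp : 0 <= p := le_trans ler01 p1.
have a1 := powR_ge0 a p; have b1 := powR_ge0 b p; have c1 := powR_ge0 c p.
pose M := Num.max a (Num.max b c).
have [aM bM cM] : [/\ a <= M, b <= M & c <= M] by rewrite /M !le_max !lexx !orbT.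
have M0 : 0 <= M by exact: le_trans aM.
apply: (@le_trans _ _ ((3 * M) `^ p)).
  by apply: ge0_ler_powR => //; rewrite ?nnegrE; lra.
rewrite powRM// ler_wpM2l ?powR_ge0//.
by rewrite /M !maxEle; case: ifP => _; [case: ifP => _|]; lra.
Qed.

(** 216 = 3 * 8 * 9: the factor 3 comes from the p-th power of a sum of three terms, 8 from eps + 4
    W <= 8 max(eps, W), and 9 from 1 + 8 * 8^p <= 9 * 8^p <= (9 * 8)^p. *)
Definition osc_scale : R := 216 * (336 * chaining_scale).

Lemma integral_max_osc :
  (\int[P]_w (max_osc N (gaussian_sum g A w) `^ p)%:E <=
   (osc_scale `^ p)%:E * ((eps `^ p)%:E + \int[P]_w (weight N w `^ p)%:E))%E.
Proof.
have pp : 0 <= p := le_trans ler01 p1.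
have cs : 0 < 336 * chaining_scale by apply: mulr_gt0; [rewrite ltr0n|exact: chaining_scale_gt0].
rewrite /osc_scale; have mO := max_osc_le; move: (336 * chaining_scale) cs mO => S S0 mO.
have S3 : 0 < (3 * S) `^ p by apply: powR_gt0; apply: mulr_gt0.
pose V w : R := eps `^ p + weight N w `^ p.
have V0 w : 0 <= V w by rewrite addr_ge0// powR_ge0.
have mW : measurable_fun setT (fun w => weight N w `^ p).
  exact: (measurableT_comp (measurable_powR p) measurable_weightN).
have mV : measurable_fun setT V by exact: measurable_funD.
have mU := measurable_chaining_potential; have U0 w := chaining_potential_ge0 w.
have EV : (\int[P]_w (V w)%:E = (eps `^ p)%:E + \int[P]_w (weight N w `^ p)%:E)%E.
  under eq_integral do rewrite EFinD.
  rewrite ge0_integralD//; last 3 first.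
  - by move=> w _; rewrite lee_fin powR_ge0.
  - by move=> w _; rewrite lee_fin powR_ge0.
  - by apply/measurable_EFinP.
  by rewrite integral_cst// [X in (_ * X + _)%E]probability_setT mule1.
apply: (@le_trans _ _ (\int[P]_w (((3 * S) `^ p)%:E * ((V w)%:E + chaining_potential w)))%E).
  apply: ge0_integral_mono => w; first by rewrite lee_fin powR_ge0.
  (* Where the potential is infinite, so is the right-hand integrand. *)
  have [fU|] := boolP (chaining_potential w \is a fin_num); last first.
    rewrite ge0_fin_numE// -leNgt leye_eq => /eqP ->.
    by rewrite addeC addye// gt0_muley ?lte_fin// leey.
  rewrite -(fineK fU) -EFinD -EFinM lee_fin.
  have r0 := potential_root_ge0 w; have W0 := weight_ge0 N w.
  have e0 := ltW eps0.
  apply: (@le_trans _ _ ((S * (eps + weight N w + potential_root w)) `^ p)).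
    apply: ge0_ler_powR => //; rewrite ?nnegrE ?max_osc_ge0 ?mO//.
    by apply: mulr_ge0; [exact: ltW|lra].
  rewrite powRM ?(ltW S0)//; last by lra.
  rewrite [(3 * S) `^ p]powRM ?(ltW S0)// [3 `^ p * _]mulrC -mulrA ler_wpM2l ?powR_ge0//.
  apply: le_trans (powR_add3_le e0 W0 r0) _; rewrite ler_wpM2l ?powR_ge0// lerD2l.
  by rewrite /potential_root -powRrM mulVf ?gt_eqF ?(lt_le_trans ltr01)// powRr1// fine_ge0.
rewrite ge0_integralZl_EFin//; last 3 first.
- by move=> w _; rewrite adde_ge0 ?lee_fin.
- by apply: emeasurable_funD => //; apply/measurable_EFinP.
- exact: ltW.
rewrite ge0_integralD//; last 2 first.
- by move=> w _; rewrite lee_fin.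
- by apply/measurable_EFinP.
apply: (@le_trans _ _ (((3 * S) `^ p)%:E * (\int[P]_w (V w)%:E + (8 * 8 `^ p)%:E * \int[P]_w (V w)%:E))%E).
  rewrite lee_wpmul2l ?lee_fin ?(ltW S3)// leeD2l//.
  apply: le_trans integral_chaining_potential _.
  have Vm : measurable_fun setT (fun w => (V w)%:E) by apply/measurable_EFinP.
  have Vp w : setT w -> (0 <= (V w)%:E)%E by rewrite lee_fin.
  have c8 : 0 <= 8 * 8 `^ p :> R by rewrite mulr_ge0// powR_ge0.
  rewrite -(ge0_integralZl_EFin P measurableT Vp Vm c8).
  apply: ge0_integral_mono => w; rewrite lee_fin; first by rewrite mulr_ge0// powR_ge0.
  rewrite -mulrA ler_wpM2l//; have W0 := weight_ge0 N w; have e0 := ltW eps0.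
  pose M := Num.max eps (weight N w).
  have [eM wM] : eps <= M /\ weight N w <= M by rewrite /M !le_max !lexx orbT.
  apply: (@le_trans _ _ ((8 * M) `^ p)).
    by apply: ge0_ler_powR => //; rewrite ?nnegrE; lra.
  rewrite powRM//; last by lra.
  rewrite ler_wpM2l ?powR_ge0// /V /M maxEle.
  by case: ifP => _; rewrite ?lerDl ?lerDr powR_ge0.
rewrite -EV -[X in (X + _)%E]mul1e -ge0_muleDl ?lee_fin ?mulr_ge0 ?powR_ge0// muleA -EFinD -EFinM.
apply: lee_wpmul2r; first by apply: integral_ge0 => w _; rewrite lee_fin.
rewrite lee_fin (_ : 216 * S = 3 * S * 72); last by ring.
rewrite [leRHS]powRM ?mulr_ge0 ?(ltW S0)// ler_wpM2l ?(ltW S3)//.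
have a8 : 8 <= 8 `^ p :> R by rewrite -[leLHS]powRr1//; apply: ler_powR => //; rewrite ler1n.
have a9 : 9 <= 9 `^ p :> R by rewrite -[leLHS]powRr1//; apply: ler_powR => //; rewrite ler1n.
rewrite (_ : 72 = 9 * 8); last by ring.
rewrite powRM//; move: (8 `^ p) (9 `^ p) a8 a9 => x y x8 y9.
apply: (@le_trans _ _ (9 * x)); first by lra.
by rewrite ler_wpM2r//; lra.
Qed.

End level_decomposition.

(** * Removing eps and collecting the constants *)

Section moment_bound.
Context (R : realType) (X : normedModType R) (D : R) (T : finType)
  (d : measure_display) (Omega : measurableType d) (P : probability Omega R) (N : nat)
  (F : nat -> set (set Omega)) (m : nat -> nat) (g : forall i, Omega -> (m i).-tuple R)
  (A : forall i, T -> Omega -> {linear 'rV[R]_(m i) -> X}) (mu : T -> R).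
Hypotheses (sX : separable X) (D1 : 1 <= D) (XD : smooth2 X D).
Hypothesis filF : is_filtration N F.
Hypothesis pgA : predictable_gaussian P N F g A.
Hypotheses (mu0 : forall t, 0 < mu t) (mu1 : \sum_(t : T) mu t = 1).
Variable t0 : T.

Lemma osc_scale_gt0 : 0 < osc_scale D.
Proof.
rewrite /osc_scale; apply: mulr_gt0; first by rewrite ltr0n.
by apply: mulr_gt0; [rewrite ltr0n|exact: chaining_scale_gt0].
Qed.

Lemma moment_max_osc (p : R) : 1 <= p ->
  (\int[P]_w (max_osc N (gaussian_sum g A w) `^ p)%:E <=
   (osc_scale D `^ p)%:E * \int[P]_w (weight A mu p N w `^ p)%:E)%E.
Proof.
move=> p1; have pp : 0 < p := lt_le_trans ltr01 p1.
have K0 : 0 < osc_scale D `^ p by rewrite powR_gt0 ?osc_scale_gt0.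
apply/lee_addgt0Pr => e e0.
(* The weight does not depend on [eps], so eps may be tuned until osc_scale^p eps^p is exactly the
   slack e. *)
pose eps := (e / osc_scale D `^ p) `^ p^-1.
have eps0 : 0 < eps by rewrite powR_gt0 ?divr_gt0.
have epsp : eps `^ p = e / osc_scale D `^ p.
  by rewrite /eps -powRrM mulVf ?gt_eqF// powRr1// ltW// divr_gt0.
apply: le_trans (integral_max_osc sX D1 XD filF pgA mu0 mu1 t0 p1 eps0) _.
have I0 : (0 <= \int[P]_w (weight A mu p N w `^ p)%:E)%E.
  by apply: integral_ge0 => w _; rewrite lee_fin powR_ge0.
have e0' : (0 <= (e / osc_scale D `^ p)%:E)%E by rewrite lee_fin ltW// divr_gt0.
rewrite epsp (ge0_muleDr _ e0' I0).
by rewrite -EFinM mulrC divfK ?gt_eqF// addeC.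
Qed.

Lemma weight_EFin (p : R) w : ball_mass_functional mu (square_dist A N w) +
  (Num.sqrt p * diam (square_dist A N w))%:E = (weight A mu p N w)%:E :> \bar R.
Proof. by rewrite /weight EFinD fineK//; exact: functional_fin. Qed.

Lemma Lnorm_max_osc (p : R) : 1 <= p ->
  ('N[P]_(p%:E)[ (fun w => (max_osc N (gaussian_sum g A w))%:E) ] <=
   (osc_scale D)%:E * 'N[P]_(p%:E)[ (fun w =>
         ball_mass_functional mu (square_dist A N w) +
         (Num.sqrt p * diam (square_dist A N w))%:E) ])%E.
Proof.
move=> p1; have pp : 0 < p := lt_le_trans ltr01 p1.
have K0 := osc_scale_gt0; have := moment_max_osc p1.
move: (osc_scale D) K0 => K K0 mm; rewrite unlock; under eq_integral do rewrite gee0_abs ?lee_fin ?max_osc_ge0// poweR_EFin.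
under [in leRHS]eq_integral do rewrite weight_EFin gee0_abs ?lee_fin ?(weight_ge0 _ _ t0)// poweR_EFin.
have I0 : (0 <= \int[P]_w (weight A mu p N w `^ p)%:E)%E.
  by apply: integral_ge0 => w _; rewrite lee_fin powR_ge0.
have L0 : (0 <= \int[P]_w (max_osc N (gaussian_sum g A w) `^ p)%:E)%E.
  by apply: integral_ge0 => w _; rewrite lee_fin powR_ge0.
have E : K%:E = ((K `^ p)%:E `^ p^-1)%E.
  by rewrite poweR_EFin -powRrM mulfV ?gt_eqF// powRr1// ltW.
rewrite E -poweRM ?lee_fin ?powR_ge0//.
apply: gt0_ler_poweR; rewrite ?invr_ge0 ?(ltW pp)//.
- by rewrite in_itv/= leey L0.
- by rewrite in_itv/= leey andbT mule_ge0// lee_fin powR_ge0.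
Qed.

Lemma expectation_max_osc :
  ('E_P[(fun w => max_osc N (gaussian_sum g A w))] <=
   (2 * osc_scale D)%:E * \int[P]_w ball_mass_functional mu (square_dist A N w))%E.
Proof.
(* With p = 0 the weight is the functional itself, which makes the latter
   measurable. *)
have w0 w : ball_mass_functional mu (square_dist A N w) = (weight A mu 0 N w)%:E.
  by rewrite -weight_EFin sqrtr0 mul0r adde0.
rewrite unlock.
have := moment_max_osc (lexx 1).
under eq_integral do rewrite powRr1 ?max_osc_ge0//.
under [in leRHS]eq_integral do rewrite powRr1 ?(weight_ge0 _ _ t0)//.
rewrite powRr1 ?(ltW osc_scale_gt0)// => /le_trans; apply.
rewrite [2 * _]mulrC [(_ * 2)%:E]EFinM -muleA lee_wpmul2l ?lee_fin ?(ltW osc_scale_gt0)//.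
have -> : (\int[P]_w ball_mass_functional mu (square_dist A N w) = \int[P]_w (weight A mu 0 N w)%:E)%E.
  by apply: eq_integral => w _; exact: w0.
rewrite -ge0_integralZl_EFin//; last 2 first.
- by move=> w _; rewrite lee_fin weight_ge0.
- by apply/measurable_EFinP; exact: (measurable_weightN sX filF pgA mu0 t0).
apply: ge0_integral_mono => w; first by rewrite lee_fin weight_ge0.
(* At p = 1 the weight is the functional plus the diameter, at most twice the functional; hence the
   factor 2. *)
have dg : ((diam (square_dist A N w))%:E <= ball_mass_functional mu (square_dist A N w))%E.
  by apply: (diam_le_ball_mass_functional mu0 mu1 t0) => t; exact: square_dist_diag.
move: dg; rewrite w0 -EFinM !lee_fin /weight sqrtr1 sqrtr0 mul1r mul0r addr0.
move: (fine _) (diam _) => a b; lra.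
Qed.

End moment_bound.

Theorem theorem2p4 (R : realType) :
  exists2 C : R, 0 < C &
    forall (X : completeNormedModType R) (D : R) (T : finType)
      (d : measure_display) (Omega : measurableType d)
      (P : probability Omega R) (N : nat) (F : nat -> set (set Omega))
      (m : nat -> nat) (g : forall i, Omega -> (m i).-tuple R)
      (A : forall i, T -> Omega -> {linear 'rV[R]_(m i) -> X})
      (mu : T -> R),
    separable X -> 1 <= D -> smooth2 X D ->
    (0 < #|T|)%N ->
    is_filtration N F ->
    predictable_gaussian P N F g A ->
    (forall t, 0 < mu t) -> \sum_(t : T) mu t = 1 ->
    (forall p : R, 1 <= p ->
      ('N[P]_(p%:E)[ (fun w => (max_osc N (gaussian_sum g A w))%:E) ] <=
       (C * D)%:E *
       'N[P]_(p%:E)[ (fun w =>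
         ball_mass_functional mu (square_dist A N w) +
         (Num.sqrt p * diam (square_dist A N w))%:E) ])%E) /\
    ('E_P[(fun w => max_osc N (gaussian_sum g A w))] <=
     (C * D)%:E * \int[P]_w ball_mass_functional mu (square_dist A N w))%E.
Proof.
(* [osc_scale] is linear in D, so its value at 1 is the universal part; the factor 2 serves the
   bound for the expectation. *)
exists (2 * osc_scale 1); first by rewrite mulr_gt0 ?osc_scale_gt0.
move=> X D T d Omega P N F m g A mu sX D1 XD T0 filF pgA mu0 mu1.
have t0 : T by move: T0 => /card_gt0P/cid[].
have CD : 2 * osc_scale 1 * D = 2 * osc_scale D.
  rewrite /osc_scale /chaining_scale mulr1; move: (Num.sqrt 544) (48 : R) (336 : R) (216 : R) => a b c e.
  by ring.
split=> [p p1|]; rewrite CD; last exact: (expectation_max_osc sX D1 XD filF pgA mu0 mu1 t0).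
apply: le_trans (Lnorm_max_osc sX D1 XD filF pgA mu0 mu1 t0 p1) _.
apply: lee_wpmul2r; first exact: Lnorm_ge0.
by rewrite lee_fin ler_peMl ?ler1n// ltW// osc_scale_gt0.
Qed.
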